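(* Let $c$ be a standard Coxeter element of $W$. For every $m\in\mathbb{Z}$ and every $w\in W$, $$(q-1)^{\ell_T(w)-r}\,[\mathcal{T}_w]\,\mathrm{H}\big(\Delta^{2m}\mathbf{B}(c^{-1})\big)\Big|_{q=1}=\begin{cases}\zeta^{(m)}_{\mathrm{NC}(W,c^{-1})}(w,c^{-1}) & \text{if } w\in\mathrm{NC}(W,c^{-1}),\\ 0&\text{otherwise.}\end{cases}$$
   Context: Coxeter setup: $(W,S)$ is a finite irreducible Coxeter system of rank $r=|S|$; $e$ is the identity; $w_\circ$ is the longest element; $T$ is the set of reflections (all $W$-conjugates of elements of $S$). For $w\in W$, $\ell_T(w)$ is the least $k$ such that $w$ is a product of $k$ reflections. The absolute order is: $x\le_T y$ iff $\ell_T(y)=\ell_T(x)+\ell_T(x^{-1}y)$. A standard Coxeter element is a product of all the simple reflections, each used exactly once, in some order. $\mathrm{NC}(W,c^{-1})$ is the interval between $e$ and $c^{-1}$ in the absolute order. Braid group: $\mathbf{B}_W$ is the (Artin) braid group of $W$, with generators $\mathbf{s}$ ($s\in S$) and the braid relations. For $w\in W$ with reduced word $(s_1,\ldots,s_k)$, $\mathbf{B}(w)=\mathbf{s}_1\cdots\mathbf{s}_k$. $\Delta=\mathbf{B}(w_\circ)$. Hecke algebra: $\mathrm{H}_W$ is the quotient of $\mathbb{Z}[q^{\pm1}][\mathbf{B}_W]$ by the relations $(\mathbf{s}-q)(\mathbf{s}+1)=0$ for $s\in S$; $\mathrm{H}$ denotes the quotient map. $\mathcal{T}_w=\mathrm{H}(\mathbf{B}(w))$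 for $w\in W$ form the standard basis, and $[\mathcal{T}_w]\mathrm{x}$ is the coefficient of $\mathcal{T}_w$ in $\mathrm{x}\in\mathrm{H}_W$. Zeta function: $\zeta_{\mathrm{NC}(W,c^{-1})}$ is the zeta function of the poset $\mathrm{NC}(W,c^{-1})$ in its incidence algebra, and $\zeta^{(m)}_{\mathrm{NC}(W,c^{-1})}$ is its $m$th power in the incidence algebra (under convolution); for $m<0$ this is the $|m|$th power of the inverse, so $\zeta^{(-1)}$ is the Möbius function. *)

(* Defs.v *)
From HB Require Import structures.
From mathcomp Require Import all_boot all_order all_algebra all_fingroup.
From mathcomp Require Import generic_quotient boolp finmap.
From mathcomp.multinomials Require Import monalg.

Set Implicit Arguments.
Unset Strict Implicit.
Unset Printing Implicit Defensive.

Import GRing.Theory.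

Local Open Scope ring_scope.
Local Open Scope quotient_scope.

Inductive word_cong (X : Type) (R : seq X -> seq X -> Prop) :
  seq X -> seq X -> Prop :=
| word_cong_rel u v : R u v -> word_cong R u v
| word_cong_refl u : word_cong R u u
| word_cong_sym u v : word_cong R u v -> word_cong R v u
| word_cong_trans u v w : word_cong R u v -> word_cong R v w -> word_cong R u w
| word_cong_cat u u' v v' :
    word_cong R u u' -> word_cong R v v' -> word_cong R (u ++ v) (u' ++ v').

(* Unlike choose P x0, this satisfies P as soon as some element does. *)
Definition xchoose_or (T : choiceType) (P : pred T) (x0 : T) : T :=
  match pselect (exists x, P x) with
  | left ex => xchoose ex
  | right _ => x0
  end.

Lemma xchoose_orP (T : choiceType) (P : pred T) (x0 : T) :
  (exists x, P x) -> P (xchoose_or P x0).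
Proof. by rewrite /xchoose_or; case: pselect => // ex _; exact: xchooseP. Qed.

Definition generator (W : finGroupType) (S : {set W}) : Type := {s : W | s \in S}.
HB.instance Definition _ (W : finGroupType) (S : {set W}) :=
  Finite.on (generator S).

Section Coxeter.
Variables (W : finGroupType) (S : {set W}).

Definition word_val (u : seq (generator S)) : W :=
  (\prod_(s <- u) val s)%g.

Definition cox_order (s t : generator S) : nat := #[val s * val t]%g.

Variant coxeter_rel : seq (generator S) -> seq (generator S) -> Prop :=
| CoxeterRel s t :
    coxeter_rel (flatten (nseq (cox_order s t) [:: s; t])) [::].

(* W = < S | (st)^{m(s,t)} = 1 >; since m(s,s) = 1 makes every generator its
   own inverse, the monoid presentation is the group presentation. *)
Definition coxeter_system : Prop :=
  [/\ forall s, s \in S -> #[s]%g = 2%N,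
      <<S>>%g = [set: W] &
      forall u : seq (generator S),
        word_val u = 1%g -> word_cong coxeter_rel u [::]].

Definition coxeter_irreducible : Prop :=
  S != set0 /\
  forall J : {set W}, J \subset S -> J != set0 -> J != S ->
    exists s t, [/\ s \in J, t \in S :\: J & (s * t)%g <> (t * s)%g].

Definition standard_coxeter_element (c : W) : Prop :=
  exists2 u : seq W, perm_eq u (enum S) & c = (\prod_(s <- u) s)%g.

(* A ^+ k is the set of all products of k elements of A; the value 0 for w
   outside <<A>> is a dummy. *)
Definition glength (A : {set W}) (w : W) : nat :=
  match pselect (exists k, w \in (A ^+ k)%g) with
  | left ex => ex_minn ex
  | right _ => 0%N
  end.

Definition reflections : {set W} := class_support S [set: W].

Definition reflength (w : W) : nat := glength reflections w.

Definition abs_le (x y : W) : bool :=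
  reflength y == (reflength x + reflength (x^-1 * y)%g)%N.

Definition NC (y : W) : {set W} := [set w | abs_le 1%g w && abs_le w y].

Definition reduced_word (w : W) (u : seq (generator S)) : bool :=
  (word_val u == w) && (size u == glength S w).

Definition a_reduced_word (w : W) : seq (generator S) :=
  xchoose_or (reduced_word w) [::].

Definition longest_element : W := [arg max_(w > 1%g) glength S w].

End Coxeter.

Section BraidGroup.
Variables (W : finGroupType) (S : {set W}).

Fixpoint alternating (T : Type) (n : nat) (s t : T) : seq T :=
  if n is n'.+1 then s :: alternating n' t s else [::].

(* The letter (s, false) stands for the generator s, (s, true) for its
   inverse. *)
Definition braid_word : Type := seq (generator S * bool).
HB.instance Definition _ := Countable.on braid_word.

Definition positive_word (u : seq (generator S)) : braid_word :=
  [seq (s, false) | s <- u].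

Variant braid_rel : braid_word -> braid_word -> Prop :=
| BraidCancel s b : braid_rel [:: (s, b); (s, ~~ b)] [::]
| BraidRel s t : s != t ->
    braid_rel (positive_word (alternating (cox_order s t) s t))
              (positive_word (alternating (cox_order s t) t s)).

Definition braid_equiv : rel braid_word :=
  fun u v => `[< word_cong braid_rel u v >].

Lemma braid_equiv_is_equiv : equiv_class_of braid_equiv.
Proof.
split=> [u|u v|v u w]; first by apply/asboolP; exact: word_cong_refl.
  by apply/asboolP/asboolP; exact: word_cong_sym.
by move=> /asboolP uv /asboolP vw; apply/asboolP; exact: word_cong_trans vw.
Qed.

Canonical braid_equiv_equiv := EquivRelPack braid_equiv_is_equiv.
Canonical braid_equiv_encModRel := defaultEncModRel braid_equiv.

Definition braid : Type := {eq_quot braid_equiv}.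
HB.instance Definition _ := Choice.on braid.
HB.instance Definition _ := EqQuotient.on braid.

Lemma braid_eqP (u v : braid_word) :
  reflect (word_cong braid_rel u v) (\pi_braid u == \pi_braid v).
Proof. by rewrite piE; exact: asboolP. Qed.

Definition braid_winv (u : braid_word) : braid_word :=
  rev [seq (x.1, ~~ x.2) | x <- u].

Definition braid_one : braid := \pi_braid [::].
Definition braid_mul (x y : braid) : braid := \pi_braid (repr x ++ repr y).
Definition braid_inv (x : braid) : braid := \pi_braid (braid_winv (repr x)).

Lemma braid_pi_mul u v : braid_mul (\pi_braid u) (\pi_braid v) = \pi_braid (u ++ v).
Proof.
by apply/eqP/braid_eqP; apply: word_cong_cat; apply/braid_eqP; rewrite reprK.
Qed.

Lemma braid_winv_cat u v : braid_winv (u ++ v) = braid_winv v ++ braid_winv u.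
Proof. by rewrite /braid_winv map_cat rev_cat. Qed.

Lemma braid_winvl u : word_cong braid_rel (braid_winv u ++ u) [::].
Proof.
elim: u => [|[s b] u IHu]; first exact: word_cong_refl.
rewrite -cat1s braid_winv_cat -catA; apply: word_cong_trans IHu.
apply: word_cong_cat (word_cong_refl _ _) _; rewrite catA -[X in word_cong _ _ X]cat0s.
apply: word_cong_cat (word_cong_refl _ _); apply: word_cong_rel.
by have := BraidCancel s (~~ b); rewrite negbK.
Qed.

Lemma braid_mulA : associative braid_mul.
Proof.
elim/quotW=> x; elim/quotW=> y; elim/quotW=> z.
by rewrite (braid_pi_mul y) (braid_pi_mul x) (braid_pi_mul x) braid_pi_mul catA.
Qed.

Lemma braid_mul1 : left_id braid_one braid_mul.
Proof. by elim/quotW=> x; rewrite braid_pi_mul. Qed.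

Lemma braid_mulr1 : right_id braid_one braid_mul.
Proof. by elim/quotW=> x; rewrite braid_pi_mul cats0. Qed.

Lemma braid_mulV : left_inverse braid_one braid_inv braid_mul.
Proof.
move=> x; rewrite /braid_inv -[X in braid_mul _ X]reprK braid_pi_mul.
by apply/eqP/braid_eqP; exact: braid_winvl.
Qed.

Lemma braid_mulrV : right_inverse braid_one braid_inv braid_mul.
Proof.
move=> x; rewrite -[LHS]braid_mul1 -[X in braid_mul X _](braid_mulV (braid_inv x)).
by rewrite -braid_mulA [X in braid_mul _ X]braid_mulA braid_mulV braid_mul1 braid_mulV.
Qed.

HB.instance Definition _ := isGroup.Build braid
  braid_mulA braid_mul1 braid_mulr1 braid_mulV braid_mulrV.

Definition braid_gen (s : generator S) : braid := \pi_braid [:: (s, false)].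

(* By Matsumoto's theorem, the reduced word of w that is used is immaterial. *)
Definition braid_lift (w : W) : braid :=
  (\prod_(s <- a_reduced_word S w) braid_gen s)%g.

Definition half_twist : braid := braid_lift (longest_element S).

End BraidGroup.

Definition expgz (G : groupType) (x : G) (m : int) : G :=
  match m with Posz n => (x ^+ n)%g | Negz n => (x ^- n.+1)%g end.

(* Z[q, q^-1], realised inside its field of fractions Q(q). *)
Notation ratfun := {fraction {poly int}}.
Local Notation "p %:F" := (FracField.tofrac p).

Definition is_laurent : {pred ratfun} :=
  fun f => `[< exists (p : {poly int}) (n : nat), f = p%:F / ('X^n)%:F >].

Lemma tofracXn_neq0 (n : nat) : ('X^n : {poly int})%:F != 0 :> ratfun.
Proof. by rewrite tofrac_eq0 -size_poly_eq0 size_polyXn. Qed.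

Lemma is_laurent_subring : subring_closed is_laurent.
Proof.
split=> [|f g|f g].
- by apply/asboolP; exists 1, 0%N; rewrite expr0 tofrac1 divr1.
- move=> /asboolP[p [m ->]] /asboolP[p' [n ->]]; apply/asboolP.
  exists (p * 'X^n - p' * 'X^m), (m + n)%N.
  by rewrite -mulNr addf_div ?tofracXn_neq0 // exprD tofracB !tofracM mulNr.
- move=> /asboolP[p [m ->]] /asboolP[p' [n ->]]; apply/asboolP.
  by exists (p * p'), (m + n)%N; rewrite exprD !tofracM mulf_div.
Qed.

HB.instance Definition _ :=
  GRing.isSubringClosed.Build ratfun is_laurent is_laurent_subring.

Record laurent := Laurent { laurent_val : ratfun; _ : laurent_val \in is_laurent }.
HB.instance Definition _ := [isSub for laurent_val].
HB.instance Definition _ := [Choice of laurent by <:].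
HB.instance Definition _ := [SubChoice_isSubComNzRing of laurent by <:].

Lemma is_laurentX : ('X : {poly int})%:F \in is_laurent.
Proof. by apply/asboolP; exists 'X, 0%N; rewrite expr0 tofrac1 divr1. Qed.

Definition laurent_q : laurent := Laurent is_laurentX.

(* The rational function f is regular at q = 1, where its value is v. *)
Definition value_at1 (f : ratfun) (v : int) : Prop :=
  exists p d : {poly int},
    [/\ d.[1] != 0, f = p%:F / d%:F & p.[1] = v * d.[1]].

Section GroupAlgebra.
Variables (R : comNzRingType) (G : groupType).
Local Open Scope fset_scope.
Local Open Scope ring_scope.

(* The library puts a ring structure on {malg R[K]} only for monoids K without
   nontrivial units; galg is the same module with the group ring product. *)
Definition galg : Type := {malg R[G]}.
HB.instance Definition _ := GRing.Lmodule.on galg.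

Implicit Types (x y z : galg) (g h : G) (a b : R).

Definition galg_scaled g a : galg := mkmalgU g a.
Definition galg_in g : galg := galg_scaled g 1.

Definition galg_mul x y : galg :=
  \sum_(g <- msupp x) \sum_(h <- msupp y) galg_scaled (g * h)%g (x@_g * y@_h).

Lemma galg_mulw (d e : {fset G}) x y : msupp x `<=` d -> msupp y `<=` e ->
  galg_mul x y =
    \sum_(g <- d) \sum_(h <- e) galg_scaled (g * h)%g (x@_g * y@_h).
Proof.
move=> xd ye; rewrite /galg_mul (big_fset_incl _ xd) /=.
  apply: eq_bigr => g _; apply: big_fset_incl => // h _ /mcoeff_outdom ->.
  by rewrite mulr0 /galg_scaled monalgU0.
move=> g _ /mcoeff_outdom xg.
by rewrite big1 // => h _; rewrite xg mul0r /galg_scaled monalgU0.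
Qed.

Lemma galg_mulDl : left_distributive galg_mul +%R.
Proof.
move=> x y z; set d := msupp x `|` msupp y.
rewrite (@galg_mulw d (msupp z) x) ?fsubsetUl //.
rewrite (@galg_mulw d (msupp z) y) ?fsubsetUr //.
rewrite (@galg_mulw d (msupp z) (x + y)) ?msuppD_le //.
rewrite -big_split /=; apply: eq_bigr => g _.
rewrite -big_split /=; apply: eq_bigr => h _.
by rewrite mcoeffD mulrDl /galg_scaled monalgUD.
Qed.

Lemma galg_mulDr : right_distributive galg_mul +%R.
Proof.
move=> z x y; set d := msupp x `|` msupp y.
rewrite (@galg_mulw (msupp z) d z x) ?fsubsetUl //.
rewrite (@galg_mulw (msupp z) d z y) ?fsubsetUr //.
rewrite (@galg_mulw (msupp z) d z (x + y)) ?msuppD_le //.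
rewrite -big_split /=; apply: eq_bigr => g _.
rewrite -big_split /=; apply: eq_bigr => h _.
by rewrite mcoeffD mulrDr /galg_scaled monalgUD.
Qed.

Lemma galg_mul0 : left_zero 0 galg_mul.
Proof. by move=> x; rewrite /galg_mul msupp0 big_seq_fset0. Qed.

Lemma galg_mulr0 : right_zero 0 galg_mul.
Proof.
by move=> x; rewrite /galg_mul big1 // => g _; rewrite msupp0 big_seq_fset0.
Qed.

Lemma galg_mulUU g h a b :
  galg_mul (galg_scaled g a) (galg_scaled h b) = galg_scaled (g * h)%g (a * b).
Proof.
rewrite (@galg_mulw [fset g] [fset h]) ?msuppU_le // !big_seq_fset1.
by rewrite !mcoeffUU.
Qed.

Lemma galgE x : x = \sum_(g <- msupp x) galg_scaled g x@_g.
Proof. exact: monalgE. Qed.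

Lemma galg_mul_suml (I : Type) (r : seq I) (F : I -> galg) y :
  galg_mul (\sum_(i <- r) F i) y = \sum_(i <- r) galg_mul (F i) y.
Proof.
by elim/big_rec2: _ => [|i u v _ <-]; rewrite ?galg_mul0 ?galg_mulDl.
Qed.

Lemma galg_mul_sumr (I : Type) (r : seq I) (F : I -> galg) y :
  galg_mul y (\sum_(i <- r) F i) = \sum_(i <- r) galg_mul y (F i).
Proof.
by elim/big_rec2: _ => [|i u v _ <-]; rewrite ?galg_mulr0 ?galg_mulDr.
Qed.

Lemma galg_mulA : associative galg_mul.
Proof.
move=> x y z; rewrite [x]galgE [y]galgE [z]galgE !galg_mul_suml.
apply: eq_bigr => g _.
rewrite galg_mul_sumr [X in _ = galg_mul X _]galg_mul_sumr galg_mul_suml.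
apply: eq_bigr => h _; rewrite !galg_mul_sumr; apply: eq_bigr => k _.
by rewrite !galg_mulUU mulrA mulgA.
Qed.

Lemma galg_mul1 : left_id (galg_in 1%g) galg_mul.
Proof.
move=> x; rewrite [x]galgE galg_mul_sumr; apply: eq_bigr => g _.
by rewrite galg_mulUU mul1g mul1r.
Qed.

Lemma galg_mulr1 : right_id (galg_in 1%g) galg_mul.
Proof.
move=> x; rewrite [x]galgE galg_mul_suml; apply: eq_bigr => g _.
by rewrite galg_mulUU mulg1 mulr1.
Qed.

Lemma galg_1_neq0 : galg_in 1%g != 0.
Proof. by rewrite /galg_in /galg_scaled monalgU_eq0 oner_eq0. Qed.

HB.instance Definition _ := GRing.Zmodule_isNzRing.Build galg
  galg_mulA galg_mul1 galg_mulr1 galg_mulDl galg_mulDr galg_1_neq0.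

Lemma galg_scaledM g h a b :
  galg_scaled g a * galg_scaled h b = galg_scaled (g * h)%g (a * b).
Proof. exact: galg_mulUU. Qed.

Lemma galg_scalerU g a b : a *: galg_scaled g b = galg_scaled g (a * b).
Proof.
by apply/malgP=> h; rewrite mcoeffZ !mcoeffU; case: eqP; rewrite ?mulr0.
Qed.

Lemma galg_scalerAl a x y : a *: (x * y) = (a *: x) * y.
Proof.
rewrite [x]galgE [y]galgE [in RHS]scaler_sumr !mulr_suml [LHS]scaler_sumr.
apply: eq_bigr => g _; rewrite !mulr_sumr [LHS]scaler_sumr; apply: eq_bigr => h _.
by rewrite galg_scalerU !galg_scaledM galg_scalerU mulrA.
Qed.

Lemma galg_scalerAr a x y : a *: (x * y) = x * (a *: y).
Proof.
rewrite [x]galgE [y]galgE [in RHS]scaler_sumr !mulr_suml [LHS]scaler_sumr.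
apply: eq_bigr => g _; rewrite !mulr_sumr [LHS]scaler_sumr; apply: eq_bigr => h _.
by rewrite galg_scalerU !galg_scaledM galg_scalerU mulrCA.
Qed.

HB.instance Definition _ := GRing.Lmodule_isLalgebra.Build R galg galg_scalerAl.
HB.instance Definition _ := GRing.Lalgebra_isAlgebra.Build R galg galg_scalerAr.

Lemma galg_in1 : galg_in 1%g = 1.
Proof. by []. Qed.

Lemma galg_inM g h : galg_in (g * h)%g = galg_in g * galg_in h.
Proof. by rewrite [RHS]galg_scaledM mulr1. Qed.

End GroupAlgebra.

Section GroupAlgebraLift.
Variables (R : comNzRingType) (G : groupType) (A : algType R) (f : G -> A).

Definition galg_lift (x : galg R G) : A := \sum_(g <- msupp x) x@_g *: f g.

Lemma galg_liftw (d : {fset G}) (x : galg R G) : fsubset (msupp x) d ->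
  galg_lift x = \sum_(g <- d) x@_g *: f g.
Proof.
move=> xd; apply: (big_fset_incl _ xd) => /= g _ /mcoeff_outdom ->.
by rewrite scale0r.
Qed.

Lemma galg_liftB : zmod_morphism galg_lift.
Proof.
move=> x y; set d := fsetU (msupp x) (msupp y).
rewrite (@galg_liftw d x) ?fsubsetUl // (@galg_liftw d y) ?fsubsetUr //.
rewrite (@galg_liftw d (x - y)) ?msuppB_le // -sumrB.
by apply: eq_bigr => g _; rewrite mcoeffB scalerBl.
Qed.
HB.instance Definition _ :=
  GRing.isZmodMorphism.Build (galg R G) A galg_lift galg_liftB.

Lemma galg_liftU g a : galg_lift (galg_scaled g a) = a *: f g.
Proof.
by rewrite (@galg_liftw [fset g]%fset) ?msuppU_le // big_seq_fset1 mcoeffUU.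
Qed.

Hypothesis f1 : f 1%g = 1.
Hypothesis fM : forall g h, f (g * h)%g = f g * f h.

Lemma galg_lift1 : galg_lift 1 = 1.
Proof. by rewrite [LHS]galg_liftU scale1r f1. Qed.

Lemma galg_liftM x y : galg_lift (x * y) = galg_lift x * galg_lift y.
Proof.
rewrite [x]galgE [y]galgE mulr_suml !raddf_sum mulr_suml.
apply: eq_bigr => g _; rewrite mulr_sumr raddf_sum mulr_sumr.
apply: eq_bigr => h _; rewrite galg_scaledM /=.
by rewrite !galg_liftU fM -scalerAl -scalerAr scalerA.
Qed.

End GroupAlgebraLift.

Section Hecke.
Variables (W : finGroupType) (S : {set W}).

Notation B := (braid S).
Notation LB := (galg laurent B).

Definition hecke_rel (s : generator S) : LB :=
  (galg_in laurent (braid_gen s) - laurent_q%:A) * (galg_in laurent (braid_gen s) + 1).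

(* The two-sided ideal generated by the elements (s - q)(s + 1). *)
Definition hecke_ideal : {pred LB} := fun x =>
  `[< exists r : seq (LB * generator S * LB),
        x = \sum_(t <- r) t.1.1 * hecke_rel t.1.2 * t.2 >].

Lemma hecke_ideal_zmod : zmod_closed hecke_ideal.
Proof.
split=> [|x y /asboolP[r ->] /asboolP[r' ->]]; apply/asboolP.
  by exists [::]; rewrite big_nil.
exists (r ++ [seq (- t.1.1, t.1.2, t.2) | t <- r']).
rewrite big_cat big_map /= -sumrN; congr (_ + _).
by apply: eq_bigr => t _; rewrite !mulNr.
Qed.
HB.instance Definition _ := GRing.isZmodClosed.Build LB hecke_ideal hecke_ideal_zmod.

Lemma hecke_idealMl x y : y \in hecke_ideal -> x * y \in hecke_ideal.
Proof.
move=> /asboolP[r ->]; apply/asboolP.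
exists [seq (x * t.1.1, t.1.2, t.2) | t <- r].
by rewrite big_map mulr_sumr; apply: eq_bigr => t _; rewrite /= !mulrA.
Qed.

Lemma hecke_idealMr x y : x \in hecke_ideal -> x * y \in hecke_ideal.
Proof.
move=> /asboolP[r ->]; apply/asboolP.
exists [seq (t.1.1, t.1.2, t.2 * y) | t <- r].
by rewrite big_map mulr_suml; apply: eq_bigr => t _; rewrite /= !mulrA.
Qed.

Definition braid_sign (b : B) : laurent^o := (-1) ^+ size (repr b).

Lemma braid_cong_odd (u v : braid_word S) :
  word_cong (@braid_rel W S) u v -> odd (size u) = odd (size v).
Proof.
elim=> {u v}; last by move=> u u' v v' _ uu' _ vv'; rewrite !size_cat !oddD uu' vv'.
- have alt n (s t : generator S) : size (alternating n s t) = n.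
    by elim: n s t => //= n IHn s t; rewrite IHn.
  by move=> u v [s b //|s t _]; rewrite /positive_word !size_map !alt.
- by [].
- by move=> u v _ ->.
- by move=> u v w _ -> _ ->.
Qed.

Lemma braid_signE (u : braid_word S) : braid_sign (\pi_B u) = (-1) ^+ size u.
Proof.
rewrite /braid_sign -signr_odd -[RHS]signr_odd; congr (_ ^+ nat_of_bool _).
by apply: braid_cong_odd; apply/braid_eqP; rewrite reprK.
Qed.

Lemma braid_signM b c : braid_sign (b * c)%g = braid_sign b * braid_sign c.
Proof. by rewrite [LHS]braid_signE size_cat exprD. Qed.

Lemma braid_sign1 : braid_sign 1%g = 1.
Proof. by rewrite [LHS]braid_signE. Qed.

Lemma hecke_ideal_proper : 1 \notin hecke_ideal.
Proof.
apply/negP => /asboolP[r] /(congr1 (galg_lift braid_sign)).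
rewrite galg_lift1 ?braid_sign1 // raddf_sum big1 => [|t _].
  by apply/eqP; exact: oner_neq0.
rewrite /= !(galg_liftM braid_signM).
have -> : galg_lift braid_sign (galg_in laurent (braid_gen t.1.2) + 1) = 0.
  rewrite raddfD /= [X in _ + X]galg_lift1 ?braid_sign1 //.
  by rewrite galg_liftU scale1r braid_signE expr1 addNr.
by rewrite mulr0 mulr0 mul0r.
Qed.

Definition hecke : Type := {ideal_quot hecke_ideal}.
HB.instance Definition _ := GRing.Zmodule.on hecke.
HB.instance Definition _ := EqQuotient.on hecke.

Definition hecke_pi (x : LB) : hecke := \pi_hecke x.

Lemma hecke_piE x y : (hecke_pi x == hecke_pi y) = (x - y \in hecke_ideal).
Proof. by rewrite Quotient.idealrBE. Qed.

Definition hecke_mul (x y : hecke) : hecke := hecke_pi (repr x * repr y).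
Definition hecke_scale (a : laurent) (x : hecke) : hecke := hecke_pi (a *: repr x).

Lemma hecke_piB : zmod_morphism hecke_pi.
Proof. by move=> x y; rewrite /hecke_pi raddfB. Qed.
HB.instance Definition _ :=
  GRing.isZmodMorphism.Build LB hecke hecke_pi hecke_piB.

Lemma hecke_pi_reprB x : repr (hecke_pi x) - x \in hecke_ideal.
Proof. by rewrite -hecke_piE /hecke_pi reprK. Qed.

Lemma hecke_pi_mul x y : hecke_mul (hecke_pi x) (hecke_pi y) = hecke_pi (x * y).
Proof.
apply/eqP; rewrite hecke_piE -[_ * _ - _](subrKA (x * repr (hecke_pi y))).
rewrite -mulrBl -mulrBr rpredD //.
  by apply: hecke_idealMr; exact: hecke_pi_reprB.
by apply: hecke_idealMl; exact: hecke_pi_reprB.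
Qed.

Lemma hecke_pi_scale a x : hecke_scale a (hecke_pi x) = hecke_pi (a *: x).
Proof.
apply/eqP; rewrite hecke_piE -scalerBr -mulr_algl.
by apply: hecke_idealMl; exact: hecke_pi_reprB.
Qed.

Lemma hecke_piW (P : hecke -> Prop) : (forall x, P (hecke_pi x)) -> forall x, P x.
Proof. by move=> Ppi x; rewrite -[x]reprK; exact: Ppi. Qed.

Lemma hecke_mulA : associative hecke_mul.
Proof.
elim/hecke_piW=> x; elim/hecke_piW=> y; elim/hecke_piW=> z.
by rewrite (hecke_pi_mul y) (hecke_pi_mul x) (hecke_pi_mul x) hecke_pi_mul mulrA.
Qed.

Lemma hecke_mul1 : left_id (hecke_pi 1) hecke_mul.
Proof. by elim/hecke_piW=> x; rewrite hecke_pi_mul mul1r. Qed.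

Lemma hecke_mulr1 : right_id (hecke_pi 1) hecke_mul.
Proof. by elim/hecke_piW=> x; rewrite hecke_pi_mul mulr1. Qed.

Lemma hecke_mulDl : left_distributive hecke_mul +%R.
Proof.
elim/hecke_piW=> x; elim/hecke_piW=> y; elim/hecke_piW=> z.
by rewrite !hecke_pi_mul -raddfD hecke_pi_mul mulrDl raddfD.
Qed.

Lemma hecke_mulDr : right_distributive hecke_mul +%R.
Proof.
elim/hecke_piW=> x; elim/hecke_piW=> y; elim/hecke_piW=> z.
by rewrite !hecke_pi_mul -raddfD hecke_pi_mul mulrDr raddfD.
Qed.

Lemma hecke_1_neq0 : hecke_pi 1 != 0.
Proof. by rewrite -(raddf0 hecke_pi) hecke_piE subr0 hecke_ideal_proper. Qed.

HB.instance Definition _ := GRing.Zmodule_isNzRing.Build hecke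
  hecke_mulA hecke_mul1 hecke_mulr1 hecke_mulDl hecke_mulDr hecke_1_neq0.

Lemma hecke_piM : monoid_morphism hecke_pi.
Proof. by split=> // x y; rewrite [RHS]hecke_pi_mul. Qed.
HB.instance Definition _ :=
  GRing.isMonoidMorphism.Build LB hecke hecke_pi hecke_piM.

Lemma hecke_scalerA a b x :
  hecke_scale a (hecke_scale b x) = hecke_scale (a * b) x.
Proof.
by elim/hecke_piW: x => x; rewrite (hecke_pi_scale b) !hecke_pi_scale scalerA.
Qed.

Lemma hecke_scale1r : left_id 1 hecke_scale.
Proof. by elim/hecke_piW=> x; rewrite hecke_pi_scale scale1r. Qed.

Lemma hecke_scalerDr : right_distributive hecke_scale +%R.
Proof.
move=> a; elim/hecke_piW=> x; elim/hecke_piW=> y.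
by rewrite !hecke_pi_scale -raddfD hecke_pi_scale scalerDr raddfD.
Qed.

Lemma hecke_scalerDl x : {morph hecke_scale^~ x : a b / a + b}.
Proof.
by elim/hecke_piW: x => x a b; rewrite !hecke_pi_scale scalerDl raddfD.
Qed.

HB.instance Definition _ := GRing.Zmodule_isLmodule.Build laurent hecke
  hecke_scalerA hecke_scale1r hecke_scalerDr hecke_scalerDl.

Lemma hecke_piZ : scalable hecke_pi.
Proof. by move=> a x; rewrite [RHS]hecke_pi_scale. Qed.
HB.instance Definition _ :=
  GRing.isScalable.Build laurent LB hecke *:%R hecke_pi hecke_piZ.

Lemma hecke_scalerAl a (x y : hecke) : a *: (x * y) = (a *: x) * y.
Proof.
elim/hecke_piW: x => x; elim/hecke_piW: y => y.
by rewrite -rmorphM -!linearZ -rmorphM /= scalerAl.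
Qed.
HB.instance Definition _ :=
  GRing.Lmodule_isLalgebra.Build laurent hecke hecke_scalerAl.

Lemma hecke_scalerAr a (x y : hecke) : a *: (x * y) = x * (a *: y).
Proof.
elim/hecke_piW: x => x; elim/hecke_piW: y => y.
by rewrite -rmorphM -!linearZ -rmorphM /= scalerAr.
Qed.
HB.instance Definition _ :=
  GRing.Lalgebra_isAlgebra.Build laurent hecke hecke_scalerAr.

Definition hecke_of_braid (b : B) : hecke := hecke_pi (galg_in laurent b).

Definition std_basis (w : W) : hecke := hecke_of_braid (braid_lift S w).

(* The elements T_w form a basis of hecke, so the family of coefficients
   chosen here exists and is unique. *)
Definition std_coeffs (x : hecke) : {ffun W -> laurent} :=
  xchoose_or (fun a : {ffun W -> laurent} => x == \sum_w a w *: std_basis w) 0.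

End Hecke.

(* Incidence algebra over Z of a finite set P partially ordered by le. Its
   elements are the functions f on pairs (x, y) supported on the pairs
   x, y \in P with x <= y. *)
Section Incidence.
Variables (X : finType) (P : {set X}) (le : rel X).

Notation incidence := {ffun X * X -> int}.

Definition inc_pair (x y : X) : bool := [&& x \in P, y \in P & le x y].

Definition inc_supp (f : incidence) : bool :=
  [forall x, forall y, ~~ inc_pair x y ==> (f (x, y) == 0)].

Definition inc_mul (f g : incidence) : incidence :=
  [ffun p => \sum_(z | inc_pair p.1 z && inc_pair z p.2) f (p.1, z) * g (z, p.2)].

Definition inc_one : incidence := [ffun p => ((p.1 \in P) && (p.1 == p.2))%:R].

Definition zeta : incidence := [ffun p => (inc_pair p.1 p.2)%:R].

(* The inverse in the incidence algebra (f itself if f is not invertible). *)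
Definition inc_inv (f : incidence) : incidence :=
  xchoose_or
    (fun g => [&& inc_supp g, inc_mul f g == inc_one & inc_mul g f == inc_one]) f.

Definition inc_pow (f : incidence) (m : int) : incidence :=
  match m with
  | Posz n => iter n (inc_mul f) inc_one
  | Negz n => iter n.+1 (inc_mul (inc_inv f)) inc_one
  end.

End Incidence.

(* Main.v *)
(* Write h = q - 1, l for the length and lT for the reflection length.
   - If b is a braid with image g in W, then the coefficient of T_v in H(b) is
     divisible by h^(lT(v g^-1)): multiplying by a generator s or by its inverse
     moves g to sg and costs at most one factor h.  Applied to Delta^(2m) B(u), whose
     image is u, this gives a matrix of leading coefficients indexed by pairs (v, u),
     which is an element of the incidence algebra of the absolute order on the
     interval below c^-1.  Products of pure braids go to products of matrices, by the
     equality case of the triangle inequality for lT.  So it suffices that Delta^2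
     goes to the zeta function, i.e. that all leading coefficients for v <= u <= c are
     equal to 1, for every standard Coxeter element c.
   - This is proved for all parabolic subgroups W_J, by induction on |J|.  Let s be
     the last letter of c = c's and K = J - s.  Conjugation by T_s carries the leading
     coefficient at (v, u) for c to the one at (svs, sus) for sc'.  If s lies below v
     (or if v = 1 and s lies below u), then u = xs with x <= c' in W_K, and the trace
     form gives the coefficient for W_J in terms of the one for W_K: writing
     w_J = w_K d one has Delta_J^2 = Delta_K^2 T_d T_(d^-1), and for a in W_K,
     tau(T_a T_d T_(d^-1)) = q^l(d) [a = 1] and
     tau(T_a T_d T_(d^-1) T_s) = h q^l(d) [a = 1].
   - A reflection below v becomes the current last letter after finitely many such
     rotations: otherwise its positive root would stay positive under all powers of
     c, and the sum of its orbit would be a nonzero fixed vector of c.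
   Reflection lengths of Coxeter elements and the fact that u <= c forces u into the
   parabolic subgroup of c come from the geometric representation, on which c - 1 is
   invertible. *)

Require Import Defs.
From HB Require Import structures.
From mathcomp Require Import all_boot all_order all_algebra all_fingroup.
From mathcomp Require Import boolp finmap generic_quotient.
From mathcomp.multinomials Require Import monalg.
From mathcomp Require Import Rstruct zify ring lra.
From Stdlib Require Rtrigo1.

Set Implicit Arguments.
Unset Strict Implicit.
Unset Printing Implicit Defensive.

Import GRing.Theory Num.Theory Order.TTheory.
Local Open Scope ring_scope.
Local Open Scope quotient_scope.

Local Notation Rl := Rdefinitions.R.

(** * The geometric representation *)

Section Chebyshev.
Import Rtrigo_def Rtrigo1.

Definition cheb_angle (m : nat) : Rl := PI / m%:R.

(** The value U_(k-1)(cos(pi/m)) of a Chebyshev polynomial of the second kind. For k = 2 it is 2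
    cos(pi/m), the negative of an off-diagonal Cartan entry. *)
Definition cheb (m k : nat) : Rl :=
  sin (k%:R * cheb_angle m) / sin (cheb_angle m).

Variable m : nat.
Hypothesis m_gt1 : (1 < m)%N.

Let th := cheb_angle m.

Lemma cheb_angle_gt0 : 0 < th.
Proof.
rewrite divr_gt0 ?ltr0n ?(ltnW m_gt1) //; apply/RltP; exact: PI_RGT_0.
Qed.

Lemma mul_cheb_angle : m%:R * th = PI.
Proof. by rewrite mulrC divfK // pnatr_eq0 -lt0n ltnW. Qed.

Lemma sin_mul_angle_gt0 k : (0 < k < m)%N -> 0 < sin (k%:R * th).
Proof.
case/andP=> k0 km; apply/RltP; apply: sin_gt_0; apply/RltP.
  by rewrite mulr_gt0 ?ltr0n ?cheb_angle_gt0.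
by rewrite -mul_cheb_angle ltr_pM2r ?ltr_nat ?cheb_angle_gt0.
Qed.

Lemma sin_angle_gt0 : 0 < sin th.
Proof. by rewrite -[th]mul1r; apply: (@sin_mul_angle_gt0 1). Qed.

Let sn0 : sin th != 0. Proof. by rewrite gt_eqF // sin_angle_gt0. Qed.

Lemma cheb0 : cheb m 0 = 0.
Proof. by rewrite /cheb mul0r sin_0 mul0r. Qed.

Lemma cheb1 : cheb m 1 = 1.
Proof. by rewrite /cheb mul1r divff. Qed.

Lemma sinPI : sin PI = 0. Proof. exact: sin_PI. Qed.

Lemma cosPI : cos PI = -1. Proof. exact: cos_PI. Qed.

Lemma sinD a b : sin (a + b) = sin a * cos b + cos a * sin b.
Proof. exact: sin_plus. Qed.

Lemma cosD a b : cos (a + b) = cos a * cos b - sin a * sin b.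
Proof. exact: cos_plus. Qed.

Lemma cheb2 : cheb m 2 = cos th *+ 2.
Proof.
rewrite /cheb -/th [2%:R]/(1 + 1) mulrDl mul1r sinD [cos th * _]mulrC -mulr2n.
by rewrite -mulrnAr mulrAC divff // mul1r.
Qed.

Lemma chebSS k : cheb m k.+2 = cheb m 2 * cheb m k.+1 - cheb m k.
Proof.
rewrite cheb2 /cheb -/th mulrA -mulrBl; congr (_ / _).
rewrite (_ : k.+2%:R * th = k.+1%:R * th + th); last first.
  by rewrite -[in LHS]addn1 natrD mulrDl mul1r.
have -> : k%:R * th = k.+1%:R * th - th.
  by rewrite -[k.+1]addn1 natrD mulrDl mul1r addrK.
set a := _ * th; rewrite !sinD.
have -> : sin (- th) = - sin th by exact: sin_neg.
have -> : cos (- th) = cos th by exact: cos_neg.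
ring.
Qed.

Lemma cheb_gt0 k : (0 < k < m)%N -> 0 < cheb m k.
Proof. by move=> km; rewrite divr_gt0 ?sin_mul_angle_gt0 ?sin_angle_gt0. Qed.

Lemma cheb_ge0 k : (k <= m)%N -> 0 <= cheb m k.
Proof.
case: k => [|k] km; first by rewrite cheb0.
case: (ltngtP k.+1 m) km => // [km|->] _; first by rewrite ltW // cheb_gt0.
by rewrite /cheb mul_cheb_angle sinPI mul0r.
Qed.

Lemma mul_cheb_angle2 : (2 * m)%:R * th = PI + PI.
Proof. by rewrite natrM -mulrA mul_cheb_angle mulr_natl. Qed.

(** The angle is 2 pi. Together with [cheb_doubleS] this makes the m-th power of st trivial on the
    plane of the two roots. *)
Lemma cheb_double : cheb m (2 * m) = 0.
Proof. by rewrite /cheb mul_cheb_angle2 sinD sinPI !mul0r mulr0 addr0 mul0r. Qed.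

Lemma cheb_doubleS : cheb m (2 * m).+1 = 1.
Proof.
rewrite /cheb -addn1 natrD mulrDl mul1r mul_cheb_angle2 sinD.
rewrite (sinD PI) (cosD PI PI) sinPI cosPI.
rewrite !mul0r !mulr0 addr0 mul0r add0r subr0 mulrNN !mul1r.
exact: divff.
Qed.

(** Makes the rank two Gram determinant positive, so that the plane of two simple roots splits off
    in [plane_decomp]. *)
Lemma cheb2_sqr_lt4 : cheb m 2 * cheb m 2 < 4.
Proof.
have sc : sin th * sin th + cos th * cos th = 1.
  by have := sin2_cos2 th; rewrite /Rpow_def.pow /RIneq.Rsqr.
have := sin_angle_gt0; rewrite cheb2; move: sc; set c := cos th; set s := sin th.
nra.
Qed.

End Chebyshev.

(** * Word length with respect to a subset of a finite group *)

Section GeneratingLength.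
Variables (gT : finGroupType) (A : {set gT}).

Lemma mem_expgsP k w :
  reflect (exists u : seq gT, [/\ size u = k, all (mem A) u & w = \prod_(a <- u) a]%g)
          (w \in A ^+ k)%g.
Proof.
elim: k w => [|k IHk] w.
  rewrite expg0; apply: (iffP set1P) => [->|[u [/size0nil-> _ ->]]]; last by rewrite big_nil.
  by exists [::]; rewrite big_nil.
rewrite expgS; apply: (iffP mulsgP) => [[a b aA /IHk[u [su uA ->]] ->]|].
  by exists (a :: u); rewrite /= su aA uA big_cons.
case=> [[|a u] [//= [su] /andP[aA uA] ->]]; rewrite big_cons.
by exists a (\prod_(a <- u) a)%g => //; apply/IHk; exists u.
Qed.

Lemma glength_le u : all (mem A) u -> (glength A (\prod_(a <- u) a)%g <= size u)%N.
Proof.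
move=> uA; rewrite /glength; case: pselect => // ex.
by case: ex_minnP => k _; apply; apply/mem_expgsP; exists u.
Qed.

Lemma glengthP w : w \in <<A>>%g ->
  exists u, [/\ size u = glength A w, all (mem A) u & w = \prod_(a <- u) a]%g.
Proof.
case/gen_prodgP=> n [f fA ->]; rewrite /glength; case: pselect => [ex|nex].
  by case: ex_minnP => k /mem_expgsP.
case: nex; exists n; apply/mem_expgsP; exists [seq f i | i <- index_enum (ordinal n : finType)].
rewrite size_map big_map [X in size X]unlock -enumT size_enum_ord; split=> //.
  by apply/allP=> _ /mapP[i _ ->]; exact: fA.
Qed.

End GeneratingLength.

(** * The Coxeter length function and its parity *)

Section CoxeterLength.
Variables (W : finGroupType) (S : {set W}).
Hypothesis coxWS : coxeter_system S.
Local Notation I := (generator S).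
Implicit Types (s t : I) (u v : seq I) (w x y : W).
Local Open Scope group_scope.

Lemma gen_neq1 s : val s != 1.
Proof. by case: coxWS => ord2 _ _; rewrite -order_gt1 ord2 ?(valP s). Qed.

Lemma gen_mulK s : val s * val s = 1.
Proof. by case: coxWS => ord2 _ _; have := expg_order (val s); rewrite ord2 ?(valP s) // expgS expg1. Qed.

Lemma gen_inv s : (val s)^-1 = val s.
Proof. by apply/eqP; rewrite eq_invg_mul gen_mulK. Qed.

Lemma mulKgen s : cancel (mulg (val s)) (mulg (val s)).
Proof. by move=> w; rewrite mulgA gen_mulK mul1g. Qed.

Lemma mulgenK s : cancel (mulg^~ (val s)) (mulg^~ (val s)).
Proof. by move=> w; rewrite -mulgA gen_mulK mulg1. Qed.

Lemma word_val_nil : word_val ([::] : seq I) = 1.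
Proof. exact: big_nil. Qed.

Lemma word_val_cons s u : word_val (s :: u) = val s * word_val u.
Proof. exact: big_cons. Qed.

Lemma word_val_cat u v : word_val (u ++ v) = word_val u * word_val v.
Proof. exact: big_cat. Qed.

Lemma word_val_rcons u s : word_val (rcons u s) = word_val u * val s.
Proof. by rewrite -cats1 word_val_cat word_val_cons word_val_nil mulg1. Qed.

Lemma word_val_rev u : word_val (rev u) = (word_val u)^-1.
Proof.
elim: u => [|s u IHu]; first by rewrite word_val_nil invg1.
by rewrite rev_cons word_val_rcons IHu word_val_cons invMg gen_inv.
Qed.

Definition len w := glength S w.

Lemma len_word_le u : (len (word_val u) <= size u)%N.
Proof.
have := @glength_le _ S (map val u); rewrite size_map big_map; apply.
by apply/allP=> _ /mapP[s _ ->]; exact: valP.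
Qed.

Lemma reduced_exists w : exists u, word_val u = w /\ size u = len w.
Proof.
have [_ genS _] := coxWS; rewrite /len.
have /(@glengthP _ S)[u [<- uS ->]] : w \in <<S>> by rewrite genS inE.
elim: u uS => [|a u IHu] /=; first by exists [::]; rewrite word_val_nil big_nil.
case/andP=> aS /IHu[v [vE vs]].
by exists (exist _ a aS :: v); rewrite word_val_cons vE /= vs big_cons.
Qed.

Lemma len1 : len 1 = 0%N.
Proof. by apply/eqP; rewrite -leqn0 -word_val_nil len_word_le. Qed.

Lemma len_eq0 w : (len w == 0%N) = (w == 1).
Proof.
apply/eqP/eqP=> [|->]; last exact: len1.
by have [u [<- <-]] := reduced_exists w => /size0nil->; rewrite word_val_nil.
Qed.

Lemma lenM_le x y : (len (x * y) <= len x + len y)%N.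
Proof.
have [u [<- <-]] := reduced_exists x; have [v [<- <-]] := reduced_exists y.
by rewrite -word_val_cat (leq_trans (len_word_le _)) ?size_cat.
Qed.

Lemma len_gen_le s : (len (val s) <= 1)%N.
Proof. by have := len_word_le [:: s]; rewrite word_val_cons word_val_nil mulg1. Qed.

Lemma lenV w : len w^-1 = len w.
Proof.
have leV x : (len x^-1 <= len x)%N.
  have [u [<- <-]] := reduced_exists x.
  by rewrite -word_val_rev (leq_trans (len_word_le _)) ?size_rev.
by apply/eqP; rewrite eqn_leq leV -[X in (len X <= _)%N]invgK leV.
Qed.

Lemma word_cong_odd u v : word_cong (@coxeter_rel W S) u v -> odd (size u) = odd (size v).
Proof.
elim=> {u v} [u v [s t]|//|u v _ ->|u v w _ -> _ ->|u u' v v' _ uu' _ vv'] //.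
  by elim: (cox_order s t) => //= n IHn; rewrite negbK.
by rewrite !size_cat !oddD uu' vv'.
Qed.

Lemma word_val_cong u v : word_val u = word_val v ->
  word_cong (@coxeter_rel W S) (u ++ rev v) [::].
Proof.
by have [_ _] := coxWS; move=> H uv; apply: H; rewrite word_val_cat word_val_rev uv mulgV.
Qed.

Lemma word_val_odd u v : word_val u = word_val v -> odd (size u) = odd (size v).
Proof.
move/word_val_cong/word_cong_odd; rewrite size_cat size_rev oddD /=.
by case: odd; case: odd.
Qed.

Lemma odd_len u : odd (len (word_val u)) = odd (size u).
Proof. by have [v [vE <-]] := reduced_exists (word_val u); exact: word_val_odd. Qed.

Lemma odd_lenMgen w s : odd (len (w * val s)) = ~~ odd (len w).
Proof.
have [u [<- _]] := reduced_exists w.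
by rewrite -word_val_rcons !odd_len size_rcons.
Qed.

(** Subadditivity bounds the change of length by one. The relators have even length, so the parity
    must change, and the change is exactly one. *)
Lemma lenMgen w s : len (w * val s) = if (len (w * val s) < len w)%N then (len w).-1 else (len w).+1.
Proof.
have h1 := lenM_le w (val s); have h2 := lenM_le (w * val s) (val s).
rewrite mulgenK in h2; have h3 := len_gen_le s; have h4 := odd_lenMgen w s.
case: ifP => h5; move: (len (w * _)) (len w) (len (val s)) h1 h2 h3 h4 h5 => a b c; lia.
Qed.

Lemma lenMgen_lt w s : (len (w * val s) < len w)%N -> len w = (len (w * val s)).+1.
Proof. by move=> h; have := lenMgen w s; rewrite h; lia. Qed.

Lemma lenMgen_ge w s : ~~ (len (w * val s) < len w)%N -> len (w * val s) = (len w).+1.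
Proof. by move=> h; have := lenMgen w s; rewrite (negPf h). Qed.

Lemma lenMgen_nlt w s : (len w < len (w * val s))%N = ~~ (len (w * val s) < len w)%N.
Proof. by have := lenMgen w s; case: ifP; lia. Qed.

Lemma lengenM w s : len (val s * w) = len (w^-1 * val s).
Proof. by rewrite -lenV invMg gen_inv. Qed.

Lemma len_gen s : len (val s) = 1%N.
Proof. by apply/eqP; rewrite eqn_leq len_gen_le lt0n len_eq0 gen_neq1. Qed.

Lemma exists_descent w : w != 1 -> exists s, (len (w * val s) < len w)%N.
Proof.
have [u [<- su]] := reduced_exists w.
case/lastP: u su => [|u s] su; first by rewrite word_val_nil eqxx.
by exists s; rewrite -su word_val_rcons mulgenK size_rcons ltnS len_word_le.
Qed.

End CoxeterLength.

(** * Alternating words and rank two suffixes *)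

Section Alternating.
Variables (W : finGroupType) (S : {set W}).
Hypothesis coxWS : coxeter_system S.
Local Notation I := (generator S).
Implicit Types (s t : I) (w x y : W).

(** Indexed by its last letter t and grown at the right end, to fit the removal of right descents;
    [alternating] is indexed by its first letter. *)
Fixpoint altr (k : nat) s t : seq I :=
  if k is k'.+1 then rcons (altr k' t s) t else [::].

Lemma size_altr k s t : size (altr k s t) = k.
Proof. by elim: k s t => //= k IHk s t; rewrite size_rcons IHk. Qed.

Local Open Scope group_scope.

Lemma altr_quotient k s t :
  (word_val (altr k s t))^-1 * word_val (altr k t s) = (val t * val s) ^+ k.
Proof.
elim: k s t => [|k IHk] s t /=; first by rewrite !word_val_nil mulVg expg0.
rewrite !word_val_rcons invMg gen_inv // expgSr !mulgA -[_ * _^-1 * _]mulgA IHk.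
congr (_ * _); elim: k {IHk} => [|k IHk]; first by rewrite !expg0 mulg1 mul1g.
by rewrite [in RHS]expgS -[RHS]mulgA -IHk expgS !mulgA.
Qed.

Lemma word_val_altrC s t :
  word_val (altr (cox_order s t) s t) = word_val (altr (cox_order s t) t s).
Proof.
apply/eqP; rewrite eq_mulVg1 altr_quotient /cox_order.
by rewrite -[_ * val s]invgK invMg !gen_inv // expgVn expg_order invg1.
Qed.

Lemma cox_orderC s t : cox_order s t = cox_order t s.
Proof. by rewrite /cox_order -orderV invMg !gen_inv. Qed.

Lemma cox_order_gt1 s t : s != t -> (1 < cox_order s t)%N.
Proof.
by move=> st; rewrite order_gt1 -eq_invg_mul gen_inv.
Qed.

(** Remove t and s in turn from the right until the letter due next is not a descent, or m letters
    are gone. On an early stop the letter removed last is an ascent of x by construction, the other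
    one by the stopping test. *)
Lemma strip_altr m w s t : (0 < m)%N -> (len S (w * val t) < len S w)%N ->
  exists k x, [/\ (0 < k <= m)%N, w = x * word_val (altr k s t),
    len S w = (len S x + k)%N &
    k = m \/ (len S x < len S (x * val s))%N /\ (len S x < len S (x * val t))%N].
Proof.
elim: m w s t => // m IHm w s t _ wt.
have lw := lenMgen_lt coxWS wt; set y := w * val t in wt lw.
have Ew : w = y * val t by rewrite /y mulgenK.
have [ys|ys] := boolP (len S (y * val s) < len S y)%N; last first.
  exists 1%N, y; rewrite /= word_val_cons word_val_nil mulg1 addn1.
  split=> //; right; rewrite (lenMgen_nlt coxWS y s) ys; split=> //.
  by rewrite -Ew.
case: m IHm => [|m] IHm.
  exists 1%N, y; rewrite /= word_val_cons word_val_nil mulg1 addn1.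
  by split=> //; left.
have [//|k [x [km yE ly xk]]] := IHm y t s _ ys.
exists k.+1, x; split; [by lia | | by lia | ].
  by rewrite Ew yE /= word_val_rcons mulgA.
by case: xk => [->|[]]; [left|right].
Qed.

End Alternating.

(** * Simple reflections on the real space spanned by the simple roots *)

Section Geometric.
Variables (W : finGroupType) (S : {set W}).
Local Notation I := (generator S).
Implicit Types (s t r : I) (u : seq I) (w x y : W).

Definition geom : Type := {ffun I -> Rl^o}.
HB.instance Definition _ := GRing.Lmodule.on geom.
HB.instance Definition _ := Vector.on geom.
Implicit Types (v : geom) (a b : Rl).

(** The symmetric normalisation: the entry off the diagonal is -2 cos(pi/m(s,t)). *)
Definition cartan s t : Rl :=
  if s == t then 2 else - cheb (cox_order s t) 2.

Definition cartan_pair s v : Rl := \sum_t cartan s t * v t.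

Definition sroot s : geom := [ffun t => (t == s)%:R].

Definition sact s v : geom := v - cartan_pair s v *: sroot s.

Definition wact u v : geom := foldr sact v u.

(** The choice of word is harmless by [geoactE], which follows from the Coxeter relations holding on
    this space. *)
Definition geoact w v : geom := wact (a_reduced_word S w) v.

Lemma cartan_pair_linear s a v v' :
  cartan_pair s (a *: v + v') = a * cartan_pair s v + cartan_pair s v'.
Proof.
rewrite /cartan_pair mulr_sumr -big_split /=; apply: eq_bigr => t _.
by rewrite !ffunE /= mulrDr; congr (_ + _); rewrite mulrCA.
Qed.

Lemma cartan_pair_root s t : cartan_pair s (sroot t) = cartan s t.
Proof.
rewrite /cartan_pair (bigD1 t) //= ffunE eqxx mulr1 big1 ?addr0 // => r /negPf rt.
by rewrite ffunE rt mulr0.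
Qed.

Lemma sact_linear s : linear (sact s).
Proof.
move=> a v v'; rewrite /sact cartan_pair_linear scalerDl scalerBr opprD -scalerA.
by rewrite addrACA.
Qed.
HB.instance Definition _ s := GRing.isLinear.Build Rl geom geom *:%R (sact s) (sact_linear s).

Lemma wact_linear u : linear (wact u).
Proof. elim: u => [//|s u IHu] a v v'.
have wactE z : wact (s :: u) z = sact s (wact u z) by [].
by rewrite !wactE IHu linearP. Qed.
HB.instance Definition _ u := GRing.isLinear.Build Rl geom geom *:%R (wact u) (wact_linear u).

Lemma wact_cat u u' v : wact (u ++ u') v = wact u (wact u' v).
Proof. exact: foldr_cat. Qed.

HB.instance Definition _ w := GRing.Linear.copy (geoact w) (wact (a_reduced_word S w)).

Lemma sact_sroot s : sact s (sroot s) = - sroot s.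
Proof.
by rewrite /sact cartan_pair_root /cartan eqxx [2]/(1 + 1) scalerDl scale1r opprD addrA addrN add0r.
Qed.

Lemma sactK s : involutive (sact s).
Proof.
by move=> v; rewrite {2}/sact linearB linearZ /= sact_sroot scalerN opprK /sact subrK.
Qed.

End Geometric.

(** * The Coxeter relations in the geometric representation *)

Section GeometricRep.
Variables (W : finGroupType) (S : {set W}).
Hypothesis coxWS : coxeter_system S.
Local Notation I := (generator S).
Local Notation V := (geom S).
Implicit Types (s t r : I) (u : seq I) (w x y : W) (v : V) (a b : Rl).

Lemma wact_cons s u v : wact (s :: u) v = sact s (wact u v).
Proof. by []. Qed.

Lemma cartanC s t : cartan s t = cartan t s.
Proof. by rewrite /cartan eq_sym cox_orderC. Qed.

Lemma cartan_pair0 r : cartan_pair r (0 : V) = 0.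
Proof. by rewrite /cartan_pair big1 // => t _; rewrite ffunE mulr0. Qed.

Lemma cartan_pair_plane r s t a b v0 :
  cartan_pair r (a *: sroot s + b *: sroot t + v0) =
    a * cartan r s + b * cartan r t + cartan_pair r v0.
Proof. by rewrite -addrA !cartan_pair_linear !cartan_pair_root addrA. Qed.

Lemma sact_plane s t a b v0 : s != t -> cartan_pair s v0 = 0 ->
  sact s (a *: sroot s + b *: sroot t + v0) =
    (b * cheb (cox_order s t) 2 - a) *: sroot s + b *: sroot t + v0.
Proof.
move=> st v00; rewrite /sact cartan_pair_plane v00 /cartan eqxx (negPf st) addr0.
rewrite addrC !addrA -scaleNr -scalerDl; congr (_ *: _ + _ + _); ring.
Qed.

(** Induction on k with the recursion [chebSS], used twice per step; the component v0, on which both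
    pairings vanish, is fixed. *)
Lemma iter_sact_plane s t a b v0 k : s != t ->
  cartan_pair s v0 = 0 -> cartan_pair t v0 = 0 ->
  let f := cheb (cox_order s t) in
  iter k (fun v => sact s (sact t v)) (a *: sroot s + b *: sroot t + v0) =
    (a * f (2 * k).+1 - b * f (2 * k)%N) *: sroot s
    + (a * f (2 * k)%N + b * (f (2 * k).+1 - f 2 * f (2 * k)%N)) *: sroot t + v0.
Proof.
move=> st sv0 tv0 f; have m1 := cox_order_gt1 coxWS st.
elim: k => [|k IHk].
  by rewrite muln0 [f 0%N]cheb0 [f 1%N]cheb1 // !mulr0 subr0 add0r !mulr1 subr0 mulr1.
rewrite iterS IHk mulnS add2n /f (chebSS m1 (2 * k).+1) (chebSS m1 (2 * k)) -/f.
rewrite [_ *: sroot s + _ *: sroot t]addrC sact_plane 1?eq_sym // cox_orderC //.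
rewrite [_ *: sroot t + _ *: sroot s]addrC sact_plane // -/f.
by congr (_ *: _ + _ *: _ + _); ring.
Qed.

Lemma plane_decomp s t v : s != t ->
  exists a b v0, [/\ v = a *: sroot s + b *: sroot t + v0,
    cartan_pair s v0 = 0 & cartan_pair t v0 = 0].
Proof.
move=> st; set x := cheb (cox_order s t) 2.
have D0 : 4 - x * x != 0.
  by rewrite gt_eqF // subr_gt0 cheb2_sqr_lt4 // cox_order_gt1.
set p := cartan_pair s v; set r := cartan_pair t v.
(* Cramer's rule for 2a - xb = p and -xa + 2b = r, of determinant 4 - x^2. *)
exists ((2 * p + x * r) / (4 - x * x)), ((2 * r + x * p) / (4 - x * x)).
set a := _ / _; set b := _ / _.
have pairE s' : cartan_pair s' (v - (a *: sroot s + b *: sroot t)) =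
    cartan_pair s' v - (a * cartan s' s + b * cartan s' t).
  by rewrite addrC -scaleN1r cartan_pair_linear -[b *: _]addr0 addrA cartan_pair_plane
    cartan_pair0; ring.
exists (v - (a *: sroot s + b *: sroot t)); rewrite addrC subrK !pairE.
rewrite /cartan !eqxx (negPf st) eq_sym (negPf st) (cox_orderC coxWS t s) -/x -/p -/r /a /b.
by split=> //; field.
Qed.

Lemma wact_braid s t v : wact (flatten (nseq (cox_order s t) [:: s; t])) v = v.
Proof.
have wactE k : wact (flatten (nseq k [:: s; t])) v =
    iter k (fun v => sact s (sact t v)) v 
    by elim: k => [//|k IHk]; rewrite iterS -IHk -!wact_cons.
rewrite wactE; have [<-|st] := eqVneq s t.
  by rewrite /cox_order gen_mulK // order1 /= sactK.
have [a [b [v0 [-> sv0 tv0]]]] := plane_decomp v st.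
have m1 := cox_order_gt1 coxWS st.
rewrite iter_sact_plane // cheb_double // cheb_doubleS //.
by congr (_ *: _ + _ *: _ + _); ring.
Qed.

Lemma wact_cong (v : V) (u u' : seq I) : word_cong (@coxeter_rel W S) u u' -> wact u v = wact u' v.
Proof.
move=> uu'; elim: uu' v => {u u'} [u u' [s t] v|//|u u' _ IH v|u u' u2 _ IH1 _ IH2 v|].
- exact: wact_braid.
- by rewrite IH.
- by rewrite IH1 IH2.
- by move=> u1 u1' u2 u2' _ IH1 _ IH2 v; rewrite !wact_cat IH2 IH1.
Qed.

Lemma wact_revK u v : wact (rev u) (wact u v) = v.
Proof. by elim: u v => // s u IHu v; rewrite rev_cons -cats1 wact_cat /= sactK [wact _ _]IHu. Qed.

Lemma wact_val u u' v : word_val u = word_val u' -> wact u v = wact u' v.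
Proof.
move=> /(word_val_cong coxWS)/(wact_cong (wact u' v)).
by rewrite wact_cat wact_revK.
Qed.

Lemma a_reduced_wordP w :
  word_val (a_reduced_word S w) = w /\ size (a_reduced_word S w) = len S w.
Proof.
have /xchoose_orP : exists u, reduced_word w u.
  by have [u [uw su]] := reduced_exists coxWS w; exists u; rewrite /reduced_word uw su !eqxx.
by move=> /(_ [::])/andP[/eqP uw /eqP su].
Qed.

Lemma geoactE u v : geoact (word_val u) v = wact u v.
Proof. by apply: wact_val; have [] := a_reduced_wordP (word_val u). Qed.

Lemma geoact1 v : geoact 1%g v = v.
Proof. by rewrite -(word_val_nil S) geoactE. Qed.

Lemma geoactM x y v : geoact (x * y)%g v = geoact x (geoact y v).
Proof.
have [[u [<- _]] [u' [<- _]]] := (reduced_exists coxWS x, reduced_exists coxWS y).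
by rewrite -word_val_cat !geoactE wact_cat.
Qed.

Lemma geoact_gen s v : geoact (val s) v = sact s v.
Proof. by rewrite -[val s]mulg1 -(word_val_nil S) -word_val_cons geoactE. Qed.

Lemma geoactK x : cancel (@geoact W S x) (geoact x^-1%g).
Proof. by move=> v; rewrite -geoactM mulVg geoact1. Qed.

Lemma geoactVK x : cancel (@geoact W S x^-1%g) (geoact x).
Proof. by move=> v; rewrite -geoactM mulgV geoact1. Qed.

End GeometricRep.

(** * Positivity of roots and the exchange property *)

Section Positivity.
Variables (W : finGroupType) (S : {set W}).
Hypothesis coxWS : coxeter_system S.
Local Notation I := (generator S).
Local Notation V := (geom S).
Implicit Types (s t r : I) (u : seq I) (w x y : W) (v : V) (a b : Rl).

Definition nneg v := forall r, 0 <= v r.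

(** Each letter of the word only raises the Chebyshev index j by one and exchanges the two roots.
    The coefficients stay nonnegative as long as the index does not exceed m(s,t). *)
Lemma altr_root k j s t : s != t -> (j + k < cox_order s t)%N ->
  let f := cheb (cox_order s t) in
  exists a b, [/\ 0 <= a, 0 <= b &
    wact (altr k s t) (f j.+1 *: sroot s + f j *: sroot t) = a *: sroot s + b *: sroot t].
Proof.
move=> st jk f; have m1 := cox_order_gt1 coxWS st.
elim: k j s t st @f jk m1 => [|k IHk] j s t st f jk m1.
  by exists (f j.+1), (f j); rewrite !cheb_ge0 //; lia.
rewrite /= -cats1 wact_cat /= -[_ + _]addr0 [_ *: _ + _ *: _]addrC.
rewrite sact_plane ?cartan_pair0 1?eq_sym // addr0 (cox_orderC coxWS) -/(f 2).
have [] := IHk j.+1 t s; rewrite 1?eq_sym ?(cox_orderC coxWS t s) ?addSnnS //.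
move=> a [b [a0 b0 Eab]]; exists b, a; split=> //.
by rewrite mulrC -chebSS // Eab addrC.
Qed.

Lemma altr_root_nneg k s t x : s != t -> (k < cox_order s t)%N ->
  nneg (geoact x (sroot s)) -> nneg (geoact x (sroot t)) ->
  nneg (geoact (x * word_val (altr k s t))%g (sroot s)).
Proof.
move=> st km xs xt r; have m1 := cox_order_gt1 coxWS st.
have [a [b [a0 b0]]] := @altr_root k 0 s t st km.
rewrite cheb1 // cheb0 // scale1r scale0r addr0 => Eab.
rewrite geoactM // geoactE // Eab linearP linearZ /= ffunE [(a *: _ : V) _]ffunE [(b *: _ : V) _]ffunE.
by rewrite addr_ge0 // mulr_ge0.
Qed.

(* Strip from w a maximal alternating suffix in s and a descent t <> s of w: what
   remains is shorter and sends both simple roots to positive ones. *)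
Theorem ascent_root_nneg w s : (len S w < len S (w * val s)%g)%N -> nneg (geoact w (sroot s)).
Proof.
have [n] := ubnP (len S w); elim: n w s => // n IHn w s wn ws.
have [->|w1] := eqVneq w 1%g.
  by move=> r; rewrite geoact1 // ffunE ler0n.
have [t wt] := exists_descent coxWS w1.
have st : s != t by apply: contraTneq wt => <-; rewrite -leqNgt ltnW.
have m1 := cox_order_gt1 coxWS st.
have [k [x [/andP[k0 km] wE lw xst]]] := strip_altr coxWS s (ltnW m1) wt.
(* A suffix of full length m could be rewritten by the braid relation to end in s, which would make
   s a descent of w. *)
have kltm : (k < cox_order s t)%N.
  rewrite ltn_neqAle km andbT; apply: contraTneq ws => kE.
  rewrite -leqNgt [in X in (X <= _)%N]wE kE word_val_altrC // -(prednK (ltnW m1)) /=.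
  rewrite word_val_rcons mulgA mulgenK // lw kE -[in X in (_ <= X)%N](prednK (ltnW m1)) addnS ltnW // ltnS.
  by rewrite (leq_trans (lenM_le coxWS _ _)) // leq_add2l (leq_trans (len_word_le _)) ?size_altr.
case: xst => [kE|[xs xt]]; first by rewrite kE ltnn in kltm.
by rewrite wE; apply: altr_root_nneg => //; apply: IHn => //; lia.
Qed.

Lemma descent_root_nneg w s : (len S (w * val s)%g < len S w)%N -> nneg (- geoact w (sroot s)).
Proof.
move=> ws; have : nneg (geoact (w * val s)%g (sroot s)).
  by apply: ascent_root_nneg; rewrite mulgenK.
by rewrite geoactM // geoact_gen // sact_sroot linearN.
Qed.

Lemma root_neq0 w s : geoact w (sroot s) != 0.
Proof.
apply/eqP=> /(congr1 (geoact w^-1%g)); rewrite geoactK // linear0 => /ffunP/(_ s)/eqP.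
by rewrite !ffunE eqxx oner_eq0.
Qed.

Lemma nneg_anti v : nneg v -> nneg (- v) -> v = 0.
Proof.
move=> v0 Nv0; apply/ffunP=> r; rewrite [RHS]ffunE; apply/le_anti.
by have := Nv0 r; rewrite ffunE oppr_ge0 v0 => ->.
Qed.

Lemma root_sign w s : nneg (geoact w (sroot s)) \/ nneg (- geoact w (sroot s)).
Proof.
have [ws|] := boolP (len S (w * val s)%g < len S w)%N.
  by right; apply: descent_root_nneg.
by rewrite -lenMgen_nlt // => /ascent_root_nneg; left.
Qed.

Lemma nneg_root_ascent w s : nneg (geoact w (sroot s)) -> (len S w < len S (w * val s)%g)%N.
Proof.
move=> ws0; rewrite lenMgen_nlt //; apply/negP=> /descent_root_nneg/(nneg_anti ws0)/eqP.
by rewrite (negPf (root_neq0 w s)).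
Qed.

Lemma nneg_root_descent w s : nneg (- geoact w (sroot s)) -> (len S (w * val s)%g < len S w)%N.
Proof.
move=> ws0; apply: contraT; rewrite -lenMgen_nlt // => /ascent_root_nneg ws.
by have /eqP := nneg_anti ws ws0; rewrite (negPf (root_neq0 w s)).
Qed.

Lemma geoact_faithful w : (forall v, geoact w v = v) -> w = 1%g.
Proof.
move=> wid; apply/eqP/negPn/negP=> /(exists_descent coxWS)[s /descent_root_nneg].
by rewrite wid => /(_ s); rewrite !ffunE eqxx oppr_ge0 ler10.
Qed.

Definition bil v v' : Rl := \sum_s v s * cartan_pair s v'.

Lemma bilE v v' : bil v v' = \sum_s \sum_t v s * cartan s t * v' t.
Proof.
by apply: eq_bigr => s _; rewrite mulr_sumr; apply: eq_bigr => t _; rewrite mulrA.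
Qed.

Lemma bilC v v' : bil v v' = bil v' v.
Proof.
rewrite !bilE exchange_big; apply: eq_bigr => s _; apply: eq_bigr => t _.
by rewrite cartanC //; ring.
Qed.

Lemma bil_linear v a v1 v2 : bil v (a *: v1 + v2) = a * bil v v1 + bil v v2.
Proof.
rewrite /bil mulr_sumr -big_split; apply: eq_bigr => s _ /=.
by rewrite cartan_pair_linear; ring.
Qed.

Lemma bilZ v a v1 : bil v (a *: v1) = a * bil v v1.
Proof.
rewrite /bil mulr_sumr; apply: eq_bigr => s _.
by rewrite -[a *: v1]addr0 cartan_pair_linear cartan_pair0; ring.
Qed.

Lemma bil_root v s : bil v (sroot s) = cartan_pair s v.
Proof.
rewrite bilC /bil (bigD1 s) //= ffunE eqxx mul1r big1 ?addr0 // => r /negPf rs.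
by rewrite ffunE rs mul0r.
Qed.

Lemma bil_sactr v v' s : bil v (sact s v') = bil v v' - cartan_pair s v' * cartan_pair s v.
Proof. by rewrite /sact addrC -scaleNr bil_linear bil_root; ring. Qed.

Lemma bil_sact v v' s : bil (sact s v) (sact s v') = bil v v'.
Proof.
rewrite bil_sactr bilC bil_sactr [bil v' v]bilC.
have -> : cartan_pair s (sact s v) = - cartan_pair s v.
  rewrite /sact addrC -scaleNr cartan_pair_linear cartan_pair_root /cartan eqxx; ring.
ring.
Qed.

Lemma bil_geoact w v v' : bil (geoact w v) (geoact w v') = bil v v'.
Proof.
have [u [<- _]] := reduced_exists coxWS w; rewrite !geoactE //.
by elim: u => // s u IHu; rewrite !wact_cons bil_sact.
Qed.

Lemma bil_root_norm w s : bil (geoact w (sroot s)) (geoact w (sroot s)) = 2.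
Proof. by rewrite bil_geoact bil_root cartan_pair_root /cartan eqxx. Qed.

Definition refl_vec v v' : V := v' - bil v v' *: v.

Lemma geoact_conj_gen w s v :
  geoact (w * val s * w^-1)%g v = refl_vec (geoact w (sroot s)) v.
Proof.
rewrite !geoactM // geoact_gen // /sact linearB linearZ /= geoactVK //.
rewrite /refl_vec -[in bil _ v](geoactVK coxWS w v) bil_geoact.
by rewrite bilC bil_root.
Qed.

(** A reflection acts by a formula in its root alone, and the representation is faithful. *)
Lemma conj_gen_eq x y s t : geoact x (sroot s) = geoact y (sroot t) ->
  (x * val s * x^-1 = y * val t * y^-1)%g.
Proof.
move=> E; apply/eqP; rewrite eq_mulgV1; apply/eqP/geoact_faithful => v.
by rewrite geoactM // geoact_conj_gen E -geoact_conj_gen geoactVK.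
Qed.

Lemma root_proportional w s t a : 0 <= a -> geoact w (sroot t) = a *: sroot s ->
  geoact w (sroot t) = sroot s.
Proof.
move=> a0 E; suff a1 : a = 1 by rewrite E a1 scale1r.
have : bil (geoact w (sroot t)) (geoact w (sroot t)) = a * a * 2.
  by rewrite E bilZ bilC bilZ bil_root cartan_pair_root /cartan eqxx mulrA.
rewrite bil_root_norm => /eqP; nra.
Qed.

(** The reflection s changes only the coordinate at s. A positive root that it makes negative has no
    other nonzero coordinate, and its norm 2 fixes the multiple. *)
Lemma simple_root_switch w s t : nneg (geoact w (sroot t)) ->
  nneg (- sact s (geoact w (sroot t))) -> geoact w (sroot t) = sroot s.
Proof.
set v := geoact w (sroot t) => v0 sv0.
apply: (@root_proportional _ _ _ (v s)); rewrite ?v0 //.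
apply/ffunP=> r; rewrite !ffunE; have [->|rs] := eqVneq r s; first by rewrite [RHS]mulr1.
have := sv0 r; rewrite !ffunE (negPf rs) scaler0 subr0 oppr_ge0 => vr.
by rewrite [RHS]mulr0; apply/le_anti; rewrite vr v0.
Qed.

(** Apply the letters of u to the simple root of s, from right to left. The root starts positive and
    ends negative; the letter at which the sign changes is the one to delete. *)
Lemma exchange u s : (len S (word_val u * val s)%g < len S (word_val u))%N ->
  exists u1 r u2, u = u1 ++ r :: u2 /\ (word_val u * val s = word_val (u1 ++ u2))%g.
Proof.
elim: u => [|r u IHu].
  by rewrite word_val_nil mul1g len1 // len_gen.
move/descent_root_nneg; rewrite geoactE // wact_cons -geoactE // => Nru.
have [u0|Nu0] := root_sign (word_val u) s.
  exists [::], r, u; split=> //.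
  have := simple_root_switch u0 Nru; rewrite -[RHS](geoact1 coxWS) => /conj_gen_eq.
  rewrite mul1g invg1 mulg1 word_val_cons => <-. by rewrite mulgKV mulgenK.
have [u1 [t [u2 [-> E]]]] := IHu (nneg_root_descent Nu0).
by exists (r :: u1), t, u2; split=> //; rewrite word_val_cons -mulgA E -word_val_cons.
Qed.

(** The positive root of t moved by w turns negative under s, so it is the simple root of s. This is
    the input for the commutation of left and right operators. *)
Lemma descent_switch w s t :
  (len S w < len S (w * val t)%g)%N ->
  (len S (val s * w * val t)%g < len S (val s * w)%g)%N ->
  (val s * w = w * val t)%g.
Proof.
move=> /ascent_root_nneg w0 /descent_root_nneg; rewrite geoactM // geoact_gen // => sw0.
have := simple_root_switch w0 sw0; rewrite -[RHS](geoact1 coxWS) => /conj_gen_eq.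
by rewrite mul1g invg1 mulg1 => <-; rewrite mulgKV.
Qed.

End Positivity.

(** * Standard parabolic subgroups *)

Section Parabolic.
Variables (W : finGroupType) (S : {set W}).
Hypothesis coxWS : coxeter_system S.
Local Notation I := (generator S).
Local Notation V := (geom S).
Implicit Types (s t r : I) (u : seq I) (w x y : W) (v : V) (a b : Rl) (J K : {set I}).

Definition parabolic J w := exists2 u, all (mem J) u & word_val u = w.

Lemma parabolic1 J : parabolic J 1%g.
Proof. by exists [::]; rewrite ?word_val_nil. Qed.

Lemma parabolicM J x y : parabolic J x -> parabolic J y -> parabolic J (x * y)%g.
Proof.
move=> [u uJ <-] [u' u'J <-]; exists (u ++ u'); rewrite ?word_val_cat //.
by rewrite all_cat uJ.
Qed.

Lemma parabolicV J x : parabolic J x -> parabolic J x^-1%g.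
Proof. by move=> [u uJ <-]; exists (rev u); rewrite ?all_rev ?word_val_rev. Qed.

Lemma parabolic_gen J s : s \in J -> parabolic J (val s).
Proof. by move=> sJ; exists [:: s]; rewrite /= ?sJ // word_val_cons word_val_nil mulg1. Qed.

Lemma parabolicS J K w : J \subset K -> parabolic J w -> parabolic K w.
Proof. by move=> /subsetP JK [u /allP uJ <-]; exists u => //; apply/allP=> s /uJ/JK. Qed.

Lemma parabolicT w : parabolic setT w.
Proof. by have [u [<- _]] := reduced_exists coxWS w; exists u => //; apply/allP=> s _; rewrite /= inE. Qed.

(** A word in J is shortened by the exchange property, which only deletes letters and so never
    leaves J. *)
Lemma parabolic_reduced J w : parabolic J w ->
  exists u, [/\ all (mem J) u, word_val u = w & size u = len S w].
Proof.
case=> u uJ <-; have [n] := ubnP (size u); elim: n u uJ => // n IHn u uJ.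
case/lastP: u uJ => [|u s]; first by exists [::]; rewrite word_val_nil len1.
rewrite all_rcons size_rcons ltnS => /andP[sJ uJ] un.
have [u' [u'J vE su']] := IHn u uJ un; rewrite word_val_rcons -vE.
rewrite -vE in su'; have u'n : (size u' <= size u)%N by rewrite su' vE len_word_le.
have [us|us] := boolP (len S (word_val u' * val s)%g < len S (word_val u'))%N.
  have [u1 [r [u2 [u'E ->]]]] := exchange coxWS us.
  move: u'J u'n; rewrite u'E all_cat /= size_cat /= => /and3P[u1J _ u2J] u12.
  apply: IHn; rewrite ?all_cat ?u1J // size_cat.
  by apply: leq_trans (ltnW un); rewrite -addnS.
exists (rcons u' s); split; rewrite ?all_rcons ?sJ ?word_val_rcons //.
by rewrite size_rcons su' (lenMgen_ge coxWS us).
Qed.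

Lemma parabolic_genE J s : parabolic J (val s) -> s \in J.
Proof.
case/parabolic_reduced=> u; rewrite len_gen // => -[]; case: u => [|r []] //=.
by rewrite andbT word_val_cons word_val_nil mulg1 => rJ /val_inj <-.
Qed.

Lemma parabolic_coord J w v r : parabolic J w -> r \notin J -> geoact w v r = v r.
Proof.
case=> u uJ <- rJ; rewrite geoactE //; elim: u uJ => // s u IHu /= /andP[sJ uJ].
rewrite ffunE IHu // !ffunE; have [rs|_] := eqVneq r s; first by rewrite -rs (negPf rJ) in sJ.
by rewrite scaler0 subr0.
Qed.

Lemma geomE v : v = \sum_s v s *: sroot s.
Proof.
apply/ffunP=> r; rewrite sum_ffunE (bigD1 r) //= !ffunE eqxx big1 ?addr0 => [|s sr].
  by rewrite [RHS]mulr1.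
by rewrite !ffunE eq_sym (negPf sr) scaler0.
Qed.

Lemma parabolic_root_coord J w s r : parabolic J w -> s \in J -> r \notin J ->
  geoact w (sroot s) r = 0.
Proof.
move=> wJ sJ rJ; rewrite (parabolic_coord _ wJ) // ffunE.
by case: eqP sJ rJ => // -> ->.
Qed.

Lemma coset_decomp J w : exists x y, [/\ w = (x * y)%g, parabolic J y &
  forall s, s \in J -> (len S x < len S (x * val s)%g)%N].
Proof.
have [n] := ubnP (len S w); elim: n w => // n IHn w wn.
have [/'exists_andP[s [sJ ws]]|] :=
    boolP [exists s, (s \in J) && (len S (w * val s)%g < len S w)%N].
  have [|x [y [wE yJ xJ]]] := IHn (w * val s)%g; first by apply: leq_trans ws _.
  exists x, (y * val s)%g; split=> //; first by rewrite mulgA -wE mulgenK.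
  by apply: parabolicM => //; apply: parabolic_gen.
rewrite negb_exists => /forallP wJ; exists w, 1%g; rewrite mulg1.
split=> //; first exact: parabolic1.
by move=> s sJ; rewrite lenMgen_nlt //; have := wJ s; rewrite sJ.
Qed.

(** Converse of [parabolic_coord]. If the minimal coset representative x were not 1, it would have a
    descent s outside J and send its root to a negative one, although the coordinate at s is still
    1. *)
Lemma parabolic_of_coord J w :
  (forall v r, r \notin J -> geoact w v r = v r) -> parabolic J w.
Proof.
move=> wJ; have [x [y [wE yJ xJ]]] := coset_decomp J w.
have [x1|/(exists_descent coxWS)[s xs]] := eqVneq x 1%g; first by rewrite wE x1 mul1g.
have sJ : s \notin J by apply/negP => /xJ; rewrite lenMgen_nlt // xs.
have := descent_root_nneg coxWS xs s; rewrite ffunE oppr_ge0.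
have -> : x = (w * y^-1)%g by rewrite wE mulgK.
rewrite geoactM // wJ // (parabolic_coord _ (parabolicV yJ)) // ffunE eqxx.
by rewrite ler10.
Qed.

Definition longest_in J w := parabolic J w /\ forall x, parabolic J x -> (len S x <= len S w)%N.

Lemma longest_in_exists J : exists w, longest_in J w.
Proof.
pose P w := `[< parabolic J w >].
have P1 : P 1%g by apply/asboolP; exact: parabolic1.
exists [arg max_(w > 1%g | P w) len S w]; case: arg_maxnP => // w /asboolP wJ wmax.
by split=> // x xJ; apply: wmax; apply/asboolP.
Qed.

(** By maximality w makes every simple root of J negative. A letter that lengthens x contributes a
    positive root in the span of J, so it shortens wx. *)
Lemma longest_in_lenM J w x : longest_in J w -> parabolic J x ->
  (len S (w * x)%g + len S x)%N = len S w.
Proof.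
move=> [wJ wmax] /parabolic_reduced[u [uJ <-]]; elim/last_ind: u uJ => [|u s IHu].
  by rewrite word_val_nil mulg1 len1 // addn0.
rewrite all_rcons word_val_rcons size_rcons => /andP[sJ uJ] us.
have leu := len_word_le u; have h := lenMgen coxWS (word_val u) s.
have us' : (len S (word_val u) < len S (word_val u * val s)%g)%N by rewrite -us ltnS.
rewrite ltnNge ltnW //= in h.
have : (len S (w * word_val u * val s)%g < len S (w * word_val u)%g)%N.
  apply: nneg_root_descent => //; rewrite geoactM //.
  move=> r; rewrite [geoact (word_val u) _]geomE linear_sum -sumrN sum_ffunE sumr_ge0 // => t _.
  rewrite linearZ -scalerN ffunE; have [tJ|tJ] := boolP (t \in J); last first.
    by rewrite (parabolic_root_coord _ sJ tJ) ?scale0r //; exists u.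
  apply: mulr_ge0; first exact: ascent_root_nneg.
  apply: descent_root_nneg => //; rewrite ltn_neqAle wmax ?andbT.
    apply/eqP=> /(congr1 odd); rewrite odd_lenMgen //; by case: odd.
  by apply: parabolicM => //; apply: parabolic_gen.
by rewrite h in us *; case: us => /(IHu uJ) <- /(lenMgen_lt coxWS)->; rewrite mulgA addnS.
Qed.

Lemma longest_in_sqr J w : longest_in J w -> (w * w = 1)%g.
Proof.
move=> wJ; have := longest_in_lenM wJ wJ.1; rewrite -[X in _ = X]add0n => /addIn/eqP.
by rewrite len_eq0 // => /eqP.
Qed.

Lemma longest_in_inv J w : longest_in J w -> (w^-1)%g = w.
Proof. by move=> /longest_in_sqr wJ; apply/eqP; rewrite eq_invg_mul wJ. Qed.

Lemma longest_in_lenMl J w x : longest_in J w -> parabolic J x ->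
  (len S (x * w)%g + len S x)%N = len S w.
Proof.
move=> wJ xJ; rewrite -lenV // invMg (longest_in_inv wJ) -[len S x]lenV //.
by apply: (longest_in_lenM wJ); apply: parabolicV.
Qed.

(** The element wsw has length l(w) - l(ws) = l(s) = 1 and lies in the parabolic subgroup. *)
Lemma longest_in_conj J w s : longest_in J w -> s \in J ->
  exists2 s', s' \in J & (w * val s = val s' * w)%g.
Proof.
move=> wJ sJ; have wsJ : parabolic J (w * val s)%g.
  by apply: parabolicM; [exact: wJ.1|exact: parabolic_gen].
have wswJ := parabolicM wsJ wJ.1.
have l1 : len S (w * val s * w)%g = 1%N.
  have := longest_in_lenMl wJ wsJ; have := longest_in_lenM wJ (parabolic_gen sJ).
  by rewrite len_gen //; lia.
have [u []] := parabolic_reduced wswJ; rewrite l1; case: u => [|s' []] //=.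
rewrite andbT word_val_cons word_val_nil mulg1 => s'J s'E _; exists s' => //.
by rewrite s'E -mulgA (longest_in_sqr wJ) mulg1.
Qed.

Lemma longest_in_longest_element : longest_in setT (longest_element S).
Proof.
split; first exact: parabolicT.
by move=> x _; rewrite /longest_element; case: arg_maxnP => // w _ wmax; apply: wmax.
Qed.

End Parabolic.

(** * Reflection length and Coxeter elements *)

Section ReflectionLength.
Variables (W : finGroupType) (S : {set W}).
Hypothesis coxWS : coxeter_system S.
Local Notation I := (generator S).
Local Notation V := (geom S).
Local Notation T := (reflections S).
Local Notation rl := (reflength S).
Implicit Types (s t r : I) (w x y : W) (v : V).
Local Open Scope group_scope.

Lemma reflectionP w : reflect (exists y s, w = y * val s * y^-1) (w \in T).
Proof.
apply: (iffP imset2P) => [[a y aS _ ->]|[y [s ->]]].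
  by exists y^-1, (exist _ a aS); rewrite /conjg mulgA invgK.
by exists (val s) y^-1; rewrite ?inE ?(valP s) // /conjg mulgA invgK.
Qed.

Lemma reflection_gen s : val s \in T.
Proof. by apply/reflectionP; exists 1, s; rewrite mul1g invg1 mulg1. Qed.

Lemma reflectionJ w x : w \in T -> x * w * x^-1 \in T.
Proof.
case/reflectionP=> y [s ->]; apply/reflectionP; exists (x * y), s.
by rewrite invMg !mulgA.
Qed.

Lemma reflection_mulK w : w \in T -> w * w = 1.
Proof.
case/reflectionP=> y [s ->]; rewrite !mulgA mulgKV -[_ * val s * val s]mulgA.
by rewrite gen_mulK // mulg1 mulgV.
Qed.

Lemma reflection_inv w : w \in T -> w^-1 = w.
Proof. by move/reflection_mulK => ww; apply/eqP; rewrite eq_invg_mul ww. Qed.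

Lemma refl_word_le (us : seq W) : all (mem T) us -> (rl (\prod_(a <- us) a) <= size us)%N.
Proof. exact: glength_le. Qed.

Lemma refl_wordP w : exists us, [/\ size us = rl w, all (mem T) us & w = \prod_(a <- us) a].
Proof.
apply: glengthP; have [_ genST _] := coxWS.
have : w \in <<S>> by rewrite genST inE.
apply/subsetP/genS; apply/subsetP=> a aS.
by have := reflection_gen (exist _ a aS).
Qed.

Lemma rl1 : rl 1 = 0%N.
Proof. by apply/eqP; rewrite -leqn0 -[1](big_nil _ mulg predT (@id W)) (@refl_word_le [::]). Qed.

Lemma rl_eq0 w : (rl w == 0%N) = (w == 1).
Proof.
apply/eqP/eqP=> [|->]; last exact: rl1.
by have [us [<- _ ->]] := refl_wordP w => /size0nil->; rewrite big_nil.
Qed.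

Lemma rlM_le x y : (rl (x * y) <= rl x + rl y)%N.
Proof.
have [us [<- uT ->]] := refl_wordP x; have [vs [<- vT ->]] := refl_wordP y.
by rewrite -big_cat -size_cat refl_word_le // all_cat uT.
Qed.

Lemma rl_refl_le w : w \in T -> (rl w <= 1)%N.
Proof. by move=> wT; have := @refl_word_le [:: w]; rewrite big_seq1 /= wT; apply. Qed.

Lemma rl_gen s : rl (val s) = 1%N.
Proof.
by apply/eqP; rewrite eqn_leq rl_refl_le ?reflection_gen // lt0n rl_eq0 gen_neq1.
Qed.

Lemma rlV w : rl w^-1 = rl w.
Proof.
have leV x : (rl x^-1 <= rl x)%N.
  have [us [<- uT ->]] := refl_wordP x.
  suff -> : (\prod_(a <- us) a)^-1 = \prod_(a <- rev us) a.
    by rewrite -(size_rev us) refl_word_le // all_rev.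
  elim: us uT => [_|a us IHus /= /andP[aT uT]]; first by rewrite !big_nil invg1.
  rewrite big_cons invMg IHus // rev_cons -cats1 big_cat big_seq1.
  by rewrite reflection_inv.
by apply/eqP; rewrite eqn_leq leV -[X in (rl X <= _)%N]invgK leV.
Qed.

Lemma rl_conj x w : rl (x * w * x^-1) = rl w.
Proof.
have leJ z y : (rl (z * y * z^-1) <= rl y)%N.
  have [us [<- uT ->]] := refl_wordP y.
  have -> : z * (\prod_(a <- us) a) * z^-1 = \prod_(a <- map (fun a => z * a * z^-1) us) a.
    elim: us {uT} => [|a us IHus]; first by rewrite !big_nil mulg1 mulgV.
    by rewrite /= !big_cons -IHus !mulgA mulgKV.
  rewrite -(size_map (fun a => z * a * z^-1) us) refl_word_le // all_map.
  by apply: sub_all uT => a aT; apply: reflectionJ.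
apply/eqP; rewrite eqn_leq leJ -[X in (rl X <= _)%N](_ : x^-1 * (x * w * x^-1) * x^-1^-1 = w) ?leJ //.
by rewrite invgK !mulgA mulVg mul1g mulgKV.
Qed.

Lemma rl_mulC x y : rl (x * y) = rl (y * x).
Proof. by rewrite -(rl_conj y (x * y)) -!mulgA mulgV mulg1. Qed.

Lemma rl_divC x y : rl (x * y^-1) = rl (y * x^-1).
Proof. by rewrite -rlV invMg invgK. Qed.

Lemma rl_triangle y x z : (rl (x * z^-1) <= rl (x * y^-1) + rl (y * z^-1))%N.
Proof. by have := rlM_le (x * y^-1) (y * z^-1); rewrite mulgA mulgKV. Qed.

Lemma rl_diff_le x y : (rl y <= rl x + rl (x * y^-1))%N.
Proof. by have := rlM_le (y * x^-1) x; rewrite mulgKV addnC -rl_divC. Qed.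

(** Reflection length is invariant under inversion and conjugation. The quotient in this form
    measures the divisibility by q - 1 later on. *)
Lemma abs_leE x y : abs_le S x y = (rl y == (rl x + rl (x * y^-1))%N).
Proof. by rewrite /abs_le rl_divC (rl_mulC y). Qed.

Lemma abs_le_refl x : abs_le S x x.
Proof. by rewrite abs_leE mulgV rl1 addn0. Qed.

Lemma abs_le1 x : abs_le S 1 x.
Proof. by rewrite /abs_le rl1 invg1 mul1g. Qed.

Lemma abs_le_trans y x z : abs_le S x y -> abs_le S y z -> abs_le S x z.
Proof.
rewrite !abs_leE => /eqP xy /eqP yz.
by have h1 := rl_triangle y x z; have h2 := rl_diff_le x z; lia.
Qed.

Lemma abs_le_eq x y : abs_le S x y -> (rl y <= rl x)%N -> x = y.
Proof.
rewrite abs_leE => /eqP xy yx; have : rl (x * y^-1) == 0%N by lia.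
by rewrite rl_eq0 -eq_mulgV1 => /eqP.
Qed.

Lemma abs_le_conj z x y : abs_le S (z * x * z^-1) (z * y * z^-1) = abs_le S x y.
Proof.
rewrite !abs_leE !rl_conj -[in RHS](rl_conj z (x * y^-1)).
by rewrite !invMg invgK !mulgA mulgKV.
Qed.

(** Equality case of the triangle inequality. It identifies the intermediate indices that contribute
    to a leading coefficient. *)
Lemma abs_le_between x y u : abs_le S x u ->
  (rl (x * y^-1) + rl (y * u^-1) <= rl (x * u^-1))%N -> abs_le S x y && abs_le S y u.
Proof.
rewrite !abs_leE => /eqP xu h.
by have h1 := rl_diff_le y u; have h2 := rl_diff_le x y; lia.
Qed.

Lemma rl_between x y u : abs_le S x y -> abs_le S y u ->
  (rl (x * y^-1) + rl (y * u^-1))%N = rl (x * u^-1).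
Proof.
move=> xy yu; have := abs_le_trans xy yu; move: xy yu.
by rewrite !abs_leE => /eqP xy /eqP yu /eqP xu; lia.
Qed.

Lemma exists_reflection_le w : w != 1 -> exists2 a, a \in T & abs_le S a w.
Proof.
have [[|a us] [su uT wE]] := refl_wordP w; first by rewrite wE big_nil eqxx.
move: uT su => /= /andP[aT uT] su _; exists a => //; rewrite /abs_le.
have E : a^-1 * w = \prod_(b <- us) b by rewrite wE big_cons mulKg.
have h1 : (rl w <= rl a + rl (\prod_(b <- us) b))%N by rewrite wE big_cons rlM_le.
have h2 := refl_word_le uT; have h3 := rl_refl_le aT.
by rewrite E eqn_leq h1 -su /= -add1n leq_add //.
Qed.

End ReflectionLength.

(** * Coxeter elements of parabolic subgroups: reflection words, intervals and rotation *)

Section CoxeterElement.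
Variables (W : finGroupType) (S : {set W}).
Hypothesis coxWS : coxeter_system S.
Local Notation I := (generator S).
Local Notation V := (geom S).
Local Notation T := (reflections S).
Local Notation rl := (reflength S).
Implicit Types (s t r : I) (g : seq I) (w x y : W) (v : V).

Definition letters g : {set I} := [set s in g].

Definition root_space g : {vspace V} := <<map (@sroot W S) g>>%VS.

Lemma root_spaceP g v : reflect (forall r, r \notin g -> v r = 0) (v \in root_space g).
Proof.
apply: (iffP idP) => [|vg].
  elim: g v => [|s g IHg] v; rewrite /root_space /= ?span_nil ?memv0.
    by move=> /eqP-> r _; rewrite ffunE.
  rewrite span_cons => /memv_addP[_ /vlineP[a ->] [v' /IHg v'g ->]] r.
  rewrite inE negb_or => /andP[rs /v'g v'r].
  by rewrite !ffunE v'r (negPf rs) scaler0 addr0.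
rewrite [v]geomE memv_suml // => s _; have [sg|/vg->] := boolP (s \in g).
  by rewrite memvZ // memv_span // map_f.
by rewrite scale0r mem0v.
Qed.

Lemma dim_root_space g : uniq g -> \dim (root_space g) = size g.
Proof.
move=> ug; rewrite -(size_map (@sroot W S)); apply/eqP.
rewrite -/(free (map (@sroot W S) g)).
elim: g ug => [|s g IHg] /=; first by rewrite nil_free.
move=> /andP[sg ug]; rewrite free_cons IHg // andbT.
apply/negP => /root_spaceP/(_ s sg)/eqP; rewrite ffunE eqxx.
by rewrite oner_eq0.
Qed.

Lemma refl_word_roots (us : seq W) : all (mem T) us ->
  exists bs : seq V, [/\ size bs = size us,
    forall w, w \in us -> exists2 b, b \in bs & exists y s,
      w = (y * val s * y^-1)%g /\ b = geoact y (sroot s) &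
    forall v, geoact (\prod_(a <- us) a)%g v - v \in <<bs>>%VS].
Proof.
elim: us => [_|a us IHus /= /andP[/reflectionP[y [s ->]] /IHus[bs [sb bT bsp]]]].
  by exists [::]; split=> // v; rewrite big_nil geoact1 // subrr mem0v.
exists (geoact y (sroot s) :: bs); split=> [|w|v]; first by rewrite /= sb.
  rewrite inE => /predU1P[->|/bT[b bb ex]]; last by exists b; rewrite // inE bb orbT.
  by exists (geoact y (sroot s)); rewrite ?mem_head //; exists y, s.
rewrite big_cons geoactM // geoact_conj_gen // /refl_vec addrAC span_cons addrC.
by rewrite memv_add // memvN memvZ // memv_line.
Qed.

(** If v is fixed by sc', then c' v = s v. Since c' does not involve s, it keeps the coordinate at
    s, so s fixes v; hence so does c', and induction applies. *)
Lemma cox_elt_fixed g v : uniq g -> geoact (word_val g) v = v ->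
  forall s, s \in g -> sact s v = v.
Proof.
elim: g => // s g IHg /= /andP[sg ug].
rewrite geoactE // wact_cons => /(congr1 (sact s)); rewrite sactK -geoactE // => gv.
have sE : cartan_pair s v = 0.
  have /(congr1 (fun v : V => v s)) := gv.
  rewrite (@parabolic_coord _ _ coxWS (letters g)) ?inE //; last first.
    by exists g => //; apply/allP=> r; rewrite /= inE.
  rewrite !ffunE eqxx => /eqP; rewrite -subr_eq0 opprB addrC subrK.
  by rewrite [_ *: _]mulr1 => /eqP.
have sv : sact s v = v by rewrite /sact sE scale0r subr0.
move=> r; rewrite inE => /predU1P[->//|]; apply: IHg => //.
by rewrite gv sv.
Qed.

(** The sum over the parabolic subgroup kills each of its simple roots, because s negates its own
    root. It therefore kills v, yet it multiplies v by the order of the subgroup. *)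
Lemma parabolic_fixed0 g v : v \in root_space g ->
  (forall s, s \in g -> sact s v = v) -> v = 0.
Proof.
move=> /root_spaceP vg vfix; pose P w := `[< parabolic (letters g) w >].
pose p (v : V) := \sum_(w | P w) geoact w v.
have wfix w : P w -> geoact w v = v.
  case/asboolP=> u ug <-; rewrite geoactE //; elim: u ug => // s u IHu /=.
  by rewrite inE => /andP[sg ug]; rewrite IHu // vfix.
have p0 s : s \in g -> p (sroot s) = 0.
  move=> sg; have Ps : parabolic (letters g) (val s) by apply: parabolic_gen; rewrite inE.
  have : p (sroot s) = - p (sroot s).
    rewrite {1}/p (reindex_inj (mulIg (val s))) /= -sumrN; apply: eq_big => w.
      apply/asboolP/asboolP => [h|h]; last exact: parabolicM.
      by rewrite -[w](mulgenK coxWS s); apply: parabolicM.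
    by move=> _; rewrite geoactM // geoact_gen // sact_sroot linearN.
  by move/eqP; rewrite -addr_eq0 -mulr2n -scaler_nat scaler_eq0 pnatr_eq0 => /eqP.
have pv : p v = 0.
  have -> : p v = \sum_(w | P w) \sum_s v s *: geoact w (sroot s).
    apply: eq_bigr => w _; rewrite {1}[v]geomE linear_sum.
    by apply: eq_bigr => s _; rewrite linearZ.
  rewrite exchange_big big1 //= => s _.
  rewrite -scaler_sumr -/(p _); have [sg|/vg->] := boolP (s \in g); last by rewrite scale0r.
  by rewrite p0 // scaler0.
have : p v = v *+ #|P| by rewrite /p (eq_bigr _ wfix) sumr_const.
rewrite pv => /esym/eqP; rewrite -scaler_nat scaler_eq0 pnatr_eq0 => /orP[/eqP P0|/eqP//].
by have := card0_eq P0 1%g; rewrite inE => /asboolP[]; exact: parabolic1.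
Qed.

(** Carter's argument: c - 1 is injective on the root space, hence onto, and its image lies in the
    span of the roots of [us]. This bounds the number of reflections; in the case of equality their
    roots span exactly the root space. *)
Theorem cox_elt_refl_word g (us : seq W) : uniq g -> all (mem T) us ->
  word_val g = (\prod_(a <- us) a)%g ->
  (size g <= size us)%N /\ (size us = size g ->
    forall w, w \in us -> parabolic (letters g) w).
Proof.
move=> ug uT gE; have [bs [sb bT bsp]] := refl_word_roots uT.
set c := word_val g in gE.
have gJ : parabolic (letters g) c by exists g => //; apply/allP=> s; rewrite /= inE.
have cJ v r : r \notin g -> geoact c v r = v r.
  by move=> rg; apply: (parabolic_coord coxWS _ gJ); rewrite inE.
pose f := (linfun (@geoact W S c) - \1)%VF.
have fE v : f v = geoact c v - v by rewrite add_lfunE opp_lfunE id_lfunE lfunE.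
have fV : (f @: root_space g <= root_space g)%VS.
  apply/subvP=> _ /memv_imgP[v _ ->]; rewrite fE.
  by apply/root_spaceP=> r rg; rewrite !ffunE cJ // subrr.
have fker : (root_space g :&: lker f = 0)%VS.
  apply/eqP; rewrite -subv0; apply/subvP=> v; rewrite memv_cap memv_ker memv0 fE.
  case/andP=> vg; rewrite subr_eq0 => /eqP cv; apply/eqP/(parabolic_fixed0 vg).
  exact: cox_elt_fixed.
have fimg : (f @: root_space g = root_space g)%VS.
  by apply/eqP; rewrite eqEdim fV (limg_dim_eq fker) leqnn.
have sub : (root_space g <= <<bs>>)%VS.
  by rewrite -fimg; apply/subvP=> _ /memv_imgP[v _ ->]; rewrite fE gE.
have dimbs : (\dim <<bs>>%VS <= size us)%N by rewrite -sb dim_span.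
have dimg := dim_root_space ug.
split=> [|sus w wus]; first by rewrite -dimg (leq_trans (dimvS sub)).
have bsg : (<<bs>>%VS == root_space g)%VS by rewrite eq_sym eqEdim sub dimg -sus.
have [b bb [y [s [wE bE]]]] := bT w wus.
apply: parabolic_of_coord => // v r; rewrite inE => rg.
rewrite wE geoact_conj_gen // -bE !ffunE.
have /root_spaceP/(_ r rg)-> : b \in root_space g by rewrite -(eqP bsg) memv_span.
by rewrite scaler0 subr0.
Qed.

Lemma rl_cox_elt g : uniq g -> rl (word_val g) = size g.
Proof.
move=> ug; apply/eqP; rewrite eqn_leq.
have -> : (rl (word_val g) <= size g)%N.
  have := @refl_word_le _ S (map val g); rewrite size_map /word_val big_map; apply.
  by apply/allP=> _ /mapP[s _ ->]; exact: reflection_gen.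
have [us [<- uT gE]] := refl_wordP coxWS (word_val g).
by have [] := cox_elt_refl_word ug uT gE.
Qed.

(** Shortest reflection words of w and of its complement concatenate to a shortest one of c, all of
    whose letters lie in the parabolic subgroup. *)
Lemma cox_elt_le_parabolic g w : uniq g -> abs_le S w (word_val g) ->
  parabolic (letters g) w.
Proof.
move=> ug /eqP; rewrite rl_cox_elt //.
have [us [<- uT wE]] := refl_wordP coxWS w.
have [vs [<- vT vE]] := refl_wordP coxWS (w^-1 * word_val g)%g.
rewrite -size_cat => sg.
have [] := @cox_elt_refl_word g (us ++ vs) ug.
- by rewrite all_cat uT.
- by rewrite big_cat /= -wE -vE mulKVg.
move=> _ /(_ (esym sg)) usvs; rewrite wE.
have : forall a, a \in us -> parabolic (letters g) a.
  by move=> a aus; apply: usvs; rewrite mem_cat aus.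
elim: us {uT wE sg usvs} => [|a us IHus] usP; first by rewrite big_nil; exact: parabolic1.
rewrite big_cons; apply: parabolicM; first by apply: usP; rewrite mem_head.
by apply: IHus => b bus; apply: usP; rewrite inE bus orbT.
Qed.

(** The reflection negates its own root but preserves the coordinates outside g. *)
Lemma reflection_root_coord g y s r : parabolic (letters g) (y * val s * y^-1)%g ->
  r \notin g -> geoact y (sroot s) r = 0.
Proof.
move=> tJ rg; have := parabolic_coord coxWS (geoact y (sroot s)) tJ (r := r).
rewrite inE => /(_ rg); rewrite geoact_conj_gen // !ffunE bil_root_norm //.
by move=> /eqP; rewrite -subr_eq0 addrAC subrr add0r oppr_eq0 mulf_eq0 pnatr_eq0 => /eqP.
Qed.

(* Conjugating by the last letters of successive rotations of g, the positive root
   of t must at some point become the current last letter: otherwise all its images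
   under powers of c would be positive, and their sum would be a nonzero fixed
   vector of c in the span of the roots of g. *)
Theorem rotation_ind (P : seq I -> W -> Prop) g (t : W) : uniq g -> t \in T ->
  parabolic (letters g) t ->
  (forall g' s, perm_eq (rcons g' s) g -> P (rcons g' s) (val s)) ->
  (forall g' s (t' : W), perm_eq (rcons g' s) g -> t' \in T ->
     P (s :: g') (val s * t' * val s)%g -> P (rcons g' s) t') ->
  P g t.
Proof.
move=> ug /reflectionP[y0 [s0 ->]] tJ Pbase Pstep; apply/not_notP => nP.
(* A counterexample recorded with its positive root. A rotation by s keeps it a counterexample by
   [Pstep], and the root stays positive: otherwise it would be the root of s, which [Pbase]
   excludes. *)
pose Inv g' b := exists y s, [/\ b = geoact y (sroot s), nneg b,
  parabolic (letters g) (y * val s * y^-1)%g & ~ P g' (y * val s * y^-1)%g].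
have Inv0 : exists b, Inv g b.
  have [p|p] := root_sign coxWS y0 s0.
    by exists (geoact y0 (sroot s0)), y0, s0.
  have E : geoact (y0 * val s0)%g (sroot s0) = - geoact y0 (sroot s0).
    by rewrite geoactM // geoact_gen // sact_sroot linearN.
  exists (- geoact y0 (sroot s0)), (y0 * val s0)%g, s0.
  by rewrite E invMg gen_inv // !mulgA mulgenK.
have Inv1 g' s b : perm_eq (rcons g' s) g -> Inv (rcons g' s) b -> Inv (s :: g') (sact s b).
  move=> gg' [y [r [bE b0 bJ nPb]]]; exists (val s * y)%g, r.
  have E : (val s * y * val r * (val s * y)^-1 = val s * (y * val r * y^-1) * val s)%g.
    by rewrite invMg gen_inv // !mulgA.
  rewrite geoactM // geoact_gen // -bE E; split=> //.
  - have [] := root_sign coxWS (val s * y)%g r; rewrite geoactM // geoact_gen // -bE //.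
    rewrite bE => Nsb; rewrite bE in b0; have := simple_root_switch coxWS b0 Nsb.
    rewrite -[RHS](geoact1 coxWS) => /(conj_gen_eq coxWS); rewrite mul1g invg1 mulg1 => rs.
    by case: nPb; rewrite rs; apply: Pbase.
  - have sJ : parabolic (letters g) (val s).
      by apply: parabolic_gen; rewrite inE -(perm_mem gg') mem_rcons mem_head.
    by apply: parabolicM => //; apply: parabolicM.
  - by move=> Ps; apply/nPb/Pstep => //; apply/reflectionP; exists y, r.
(* Rotating a whole block q applies it to the root; the block q = g gives one application of c and
   returns to the word g. *)
have Inv2 p q b : perm_eq (p ++ q) g -> Inv (p ++ q) b -> Inv (q ++ p) (wact q b).
  elim/last_ind: q p b => [|q s IHq] p b; first by rewrite cats0.
  rewrite -rcons_cat => pq /(Inv1 _ _ _ pq).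
  rewrite -cat_cons => /(IHq (s :: p)); rewrite -cats1 wact_cat -catA /=; apply.
  by apply: perm_trans pq; rewrite perm_sym perm_rcons.
have Invc k b : Inv g b -> Inv g (geoact (word_val g ^+ k)%g b).
  elim: k b => [|k IHk] b Ib; first by rewrite expg0 geoact1.
  rewrite expgS geoactM // geoactE //.
  by have := @Inv2 [::] g _ (perm_refl g) (IHk _ Ib); rewrite cats0.
case: Inv0 => b Ib; set c := word_val g in Invc.
pose z := \sum_(k < #[c]%g) geoact (c ^+ k)%g b.
have gJ : parabolic (letters g) c by exists g => //; apply/allP=> s; rewrite /= inE.
have cz : geoact c z = z.
  have -> : geoact c z = \sum_(k < #[c]%g) geoact (c ^+ k.+1)%g b.
    by rewrite linear_sum; apply: eq_bigr => k _; rewrite expgS geoactM.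
  rewrite /z.
  case: #[c]%g (expg_order c) (order_gt0 c) => // n cn _.
  rewrite big_ord_recr [RHS]big_ord_recl /= cn expg0 addrC; congr (_ + _).
have zk k r : 0 <= geoact (c ^+ k)%g b r.
  by have [y [s [-> p _ _]]] := Invc k b Ib; apply: p.
have zg : z \in root_space g.
  apply/root_spaceP=> r rg; rewrite sum_ffunE big1 // => k _.
  have [y [s [-> _ tJ' _]]] := Invc k b Ib.
  exact: reflection_root_coord tJ' rg.
have z0 := parabolic_fixed0 zg (cox_elt_fixed ug cz).
have [y [s [bE _ _ _]]] := Ib; have /eqP[] := root_neq0 coxWS y s; rewrite -bE.
apply/ffunP=> r; have /ffunP/(_ r) := z0; rewrite sum_ffunE [RHS]ffunE.
have : (0 < #[c]%g)%N by exact: order_gt0.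
case: #[c]%g => // n _; rewrite big_ord_recl expg0 geoact1 // => /eqP.
rewrite paddr_eq0 ?sumr_ge0 // => [/andP[/eqP->]|]; first by rewrite ffunE.
by have := zk 0%N r; rewrite expg0 geoact1.
Qed.

End CoxeterElement.

(** * The action of the Hecke algebra on functions on the group *)

Section ReducedAlternating.
Variables (W : finGroupType) (S : {set W}).
Hypothesis coxWS : coxeter_system S.
Local Notation I := (generator S).
Implicit Types (s t : I).

Lemma alternating_rcons k s t :
  alternating k.+1 s t = rcons (alternating k s t) (if odd k then t else s).
Proof.
elim: k s t => // k IHk s t.
rewrite -[LHS]/(s :: alternating k.+1 t s) IHk /=.
by case: odd.
Qed.

Lemma alternatingE k s t : alternating k s t = if odd k then altr k t s else altr k s t.
Proof. by elim: k s t => // k IHk s t; rewrite alternating_rcons IHk /=; case: odd. Qed.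

Lemma len_altr k s t : s != t -> (k <= cox_order s t)%N -> len S (word_val (altr k s t)) = k.
Proof.
elim: k s t => [|k IHk] s t st km; first by rewrite word_val_nil len1.
rewrite /= word_val_rcons lenMgen_ge //.
  by rewrite IHk 1?eq_sym // cox_orderC // ltnW.
rewrite -lenMgen_nlt //; apply: nneg_root_ascent => //.
rewrite -[word_val _]mul1g; apply: altr_root_nneg; rewrite 1?eq_sym ?(cox_orderC coxWS t s) //.
- by move=> r; rewrite geoact1 // ffunE ler0n.
- by move=> r; rewrite geoact1 // ffunE ler0n.
Qed.

Lemma word_val_alternating s t :
  word_val (alternating (cox_order s t) s t) = word_val (alternating (cox_order s t) t s).
Proof. by rewrite !alternatingE; case: odd; rewrite word_val_altrC. Qed.

Lemma size_alternating (A : Type) k (a b : A) : size (alternating k a b) = k.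
Proof. by elim: k a b => //= k IHk a b; rewrite IHk. Qed.

Lemma len_alternating s t : s != t ->
  len S (word_val (alternating (cox_order s t) s t)) = cox_order s t.
Proof.
move=> st; rewrite alternatingE; case: odd; last exact: len_altr.
by rewrite -word_val_altrC // len_altr.
Qed.

End ReducedAlternating.

(** * Commuting left and right multiplication operators *)

Section RegularOperators.
Variables (W : finGroupType) (S : {set W}).
Hypothesis coxWS : coxeter_system S.
Variables (R : comNzRingType) (q qi : R).
Hypothesis qiq : qi * q = 1.
Local Notation I := (generator S).
Local Notation E := {ffun W -> R^o}.
Local Notation len := (len S).
Implicit Types (s t : I) (w x y : W) (f : E) (u : seq I).

(** With f read as the coefficients of an element in the standard basis, this is left multiplication
    by T_s; [rop] is right multiplication. *)
Definition lop s f : E := [ffun y =>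
  if (len (val s * y)%g < len y)%N then f (val s * y)%g + (q - 1) * f y
  else q * f (val s * y)%g].

Definition rop s f : E := [ffun y =>
  if (len (y * val s)%g < len y)%N then f (y * val s)%g + (q - 1) * f y
  else q * f (y * val s)%g].

Definition lopV s f : E := qi *: (lop s f - (q - 1) *: f).

Definition dirac w : E := [ffun y => (y == w)%:R].

Lemma lenMl_nlt w s : (len w < len (val s * w)%g)%N = ~~ (len (val s * w)%g < len w)%N.
Proof. by rewrite lengenM // -(lenV coxWS w) lenMgen_nlt. Qed.

Lemma lop_linear s : linear (lop s).
Proof.
move=> a f f'; apply/ffunP=> y; rewrite !ffunE /=.
by case: ifP => _; rewrite /GRing.scale /=; ring.
Qed.
HB.instance Definition _ s := GRing.isLinear.Build R E E *:%R (lop s) (lop_linear s).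

Lemma rop_linear s : linear (rop s).
Proof.
move=> a f f'; apply/ffunP=> y; rewrite !ffunE /=.
by case: ifP => _; rewrite /GRing.scale /=; ring.
Qed.
HB.instance Definition _ s := GRing.isLinear.Build R E E *:%R (rop s) (rop_linear s).

Lemma lopV_linear s : linear (lopV s).
Proof.
move=> a f f'; rewrite /lopV linearP; apply/ffunP=> y; rewrite !ffunE /GRing.scale /=; ring.
Qed.
HB.instance Definition _ s := GRing.isLinear.Build R E E *:%R (lopV s) (lopV_linear s).

Lemma lop_quadratic s f : lop s (lop s f) = q *: f + (q - 1) *: lop s f.
Proof.
apply/ffunP=> y; rewrite !ffunE (mulKgen coxWS) /GRing.scale /= lenMl_nlt.
by case h: (len (val s * y)%g < len y)%N; rewrite /= ?h; ring.
Qed.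

Lemma lopK s : cancel (lop s) (lopV s).
Proof.
by move=> f; rewrite /lopV lop_quadratic addrK scalerA qiq scale1r.
Qed.

Lemma lopVK s : cancel (lopV s) (lop s).
Proof.
move=> f; rewrite /lopV linearZ linearB linearZ /= lop_quadratic.
by rewrite addrK scalerA qiq scale1r.
Qed.

Lemma lenMr_or w s : len (w * val s)%g = (len w).+1 \/ len w = (len (w * val s)%g).+1.
Proof.
have [h|h] := boolP (len (w * val s)%g < len w)%N.
  by right; exact: (lenMgen_lt coxWS h).
by left; exact: (lenMgen_ge coxWS h).
Qed.

Lemma lenMl_or w s : len (val s * w)%g = (len w).+1 \/ len w = (len (val s * w)%g).+1.
Proof. by rewrite lengenM // -(lenV coxWS w); apply: lenMr_or. Qed.

(** Lengths differ by one along each side of the square y, sy, yt, syt. Opposite sides can disagree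
    only in configurations that [descent_switch] turns into sy = yt. *)
Lemma descent_parallel y s t : (val s * y != y * val t)%g ->
  (len (val s * y * val t)%g < len (y * val t)%g)%N = (len (val s * y)%g < len y)%N /\
  (len (val s * y * val t)%g < len (val s * y)%g)%N = (len (y * val t)%g < len y)%N.
Proof.
move=> ne.
have h1 := lenMr_or y t; have h2 := lenMr_or (val s * y)%g t.
have h3 := lenMl_or y s.
have h4 : len (val s * y * val t)%g = (len (y * val t)%g).+1 \/
    len (y * val t)%g = (len (val s * y * val t)%g).+1 by rewrite -mulgA; apply: lenMl_or.
have sw1 : (len y < len (y * val t)%g)%N ->
    (len (val s * y * val t)%g < len (val s * y)%g)%N -> False.
  by move=> a b; case/eqP: ne; apply: descent_switch.
have sw2 : (len (val s * y)%g < len (val s * y * val t)%g)%N ->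
    (len (y * val t)%g < len y)%N -> False.
  move=> a b; case/eqP: ne.
  have := @descent_switch _ _ coxWS (val s * y)%g s t a; rewrite mulKgen // => /(_ b) yE.
  by rewrite {2}yE mulgenK.
move: h1 h2 h3 h4 sw1 sw2.
move: (len (val s * y * val t)%g) (len (y * val t)%g) (len (val s * y)%g) (len y) => c b a l.
lia.
Qed.

Lemma lop_rop s t f : lop s (rop t f) = rop t (lop s f).
Proof.
apply/ffunP=> y; rewrite !ffunE !mulgA.
have [E|ne] := eqVneq (val s * y)%g (y * val t)%g.
  have Ey : (val s * y * val t = y)%g by rewrite E mulgenK.
  rewrite Ey -E lenMl_nlt.
  by case h: (len (val s * y)%g < len y)%N; rewrite /= ?h; ring.
have [-> ->] := descent_parallel ne.
by case: ifP; case: ifP => _ _; ring.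
Qed.

Definition lword u f : E := foldr lop f u.
Definition rword u f : E := foldl (fun f t => rop t f) f u.

Lemma lword_rop u t f : lword u (rop t f) = rop t (lword u f).
Proof. by elim: u => //= s u ->; rewrite lop_rop. Qed.

Lemma lword_rword u u' f : lword u (rword u' f) = rword u' (lword u f).
Proof. by elim: u' f => //= t u' IHu' f; rewrite IHu' lword_rop. Qed.

Lemma lop_dirac s w : (len w < len (val s * w)%g)%N -> lop s (dirac w) = dirac (val s * w)%g.
Proof.
move=> sw; apply/ffunP=> y; rewrite !ffunE; have [->|ny] := eqVneq y (val s * w)%g.
  rewrite mulKgen // eqxx sw (_ : (_ == w) = false) ?mulr0 ?addr0 //.
  by apply: contraTF sw => /eqP->; rewrite ltnn.
rewrite (_ : (val s * y == w)%g = false); last first.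
  by apply: contraNF ny => /eqP<-; rewrite mulKgen.
case: ifP => [sy|]; last by rewrite mulr0.
by case: eqP sy => [->|_ _]; rewrite ?mulr0 ?addr0 // ltnNge ltnW.
Qed.

Lemma rop_dirac s w : (len w < len (w * val s)%g)%N -> rop s (dirac w) = dirac (w * val s)%g.
Proof.
move=> sw; apply/ffunP=> y; rewrite !ffunE; have [->|ny] := eqVneq y (w * val s)%g.
  rewrite mulgenK // eqxx sw (_ : (_ == w) = false) ?mulr0 ?addr0 //.
  by apply: contraTF sw => /eqP->; rewrite ltnn.
rewrite (_ : (y * val s == w)%g = false); last first.
  by apply: contraNF ny => /eqP<-; rewrite mulgenK.
case: ifP => [sy|]; last by rewrite mulr0.
by case: eqP sy => [->|_ _]; rewrite ?mulr0 ?addr0 // ltnNge ltnW.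
Qed.

Definition reduced u := size u = len (word_val u).

Lemma reduced_rconsE u s : reduced (rcons u s) ->
  reduced u /\ (len (word_val u) < len (word_val u * val s)%g)%N.
Proof.
rewrite /reduced word_val_rcons size_rcons => us.
by have h1 := len_word_le u; have h2 := lenMr_or (word_val u) s; lia.
Qed.

Lemma reduced_consE u s : reduced (s :: u) ->
  reduced u /\ (len (word_val u) < len (val s * word_val u)%g)%N.
Proof.
rewrite /reduced word_val_cons => us; have {}us : (size u).+1 = len (val s * word_val u)%g := us.
by have h1 := len_word_le u; have h2 := lenMl_or (word_val u) s; lia.
Qed.

Lemma lword_reduced u : reduced u -> lword u (dirac 1) = dirac (word_val u).
Proof.
elim: u => [|s u IHu]; first by rewrite word_val_nil.
by move=> /reduced_consE[/IHu/= -> us]; rewrite lop_dirac // word_val_cons.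
Qed.

Lemma rword_reduced u : reduced u -> rword u (dirac 1) = dirac (word_val u).
Proof.
elim/last_ind: u => [|u s IHu]; first by rewrite word_val_nil.
move=> /reduced_rconsE[/IHu E us]; rewrite -cats1 /rword foldl_cat [foldl _ _ u]E /=.
by rewrite rop_dirac // cats1 word_val_rcons.
Qed.

Lemma ffun_diracE f : f = \sum_w f w *: dirac w.
Proof.
apply/ffunP=> y; rewrite sum_ffunE (bigD1 y) //= big1 ?addr0 => [|w wy].
  by rewrite !ffunE eqxx [RHS]mulr1.
by rewrite !ffunE eq_sym (negPf wy) scaler0.
Qed.

Lemma lword_linear u : linear (lword u).
Proof.
elim: u => [//|s u IHu] a f f'.
have lwordE g : lword (s :: u) g = lop s (lword u g) by [].
by rewrite !lwordE IHu linearP.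
Qed.
HB.instance Definition _ u := GRing.isLinear.Build R E E *:%R (lword u) (lword_linear u).

(* Left and right operators commute and every dirac w is obtained from dirac 1 by
   right operators, so a product of left operators is determined by its value on
   dirac 1. *)
Lemma lword_eq u u' f : reduced u -> reduced u' -> word_val u = word_val u' ->
  lword u f = lword u' f.
Proof.
move=> ru ru' uu'; rewrite [f]ffun_diracE !linear_sum; apply: eq_bigr => w _.
rewrite !linearZ; congr (_ *: _) => /=.
have [v [<- vr]] := reduced_exists coxWS w.
by rewrite -(rword_reduced vr) !lword_rword !lword_reduced // uu'.
Qed.

Definition lletter (x : I * bool) f : E := if x.2 then lopV x.1 f else lop x.1 f.

Definition lbraid (z : braid_word S) f : E := foldr lletter f z.

Lemma lletter_linear (x : I * bool) : linear (lletter x).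
Proof. by move=> a f f'; rewrite /lletter; case: x.2; rewrite linearP. Qed.
HB.instance Definition _ (x : I * bool) := GRing.isLinear.Build R E E *:%R (lletter x) (lletter_linear x).

Lemma lbraid_linear z : linear (lbraid z).
Proof.
elim: z => [//|x z IHz] a f f'.
have lbE g : lbraid (x :: z) g = lletter x (lbraid z g) by [].
by rewrite !lbE IHz linearP.
Qed.
HB.instance Definition _ z := GRing.isLinear.Build R E E *:%R (lbraid z) (lbraid_linear z).

Lemma lbraid_cat z z' f : lbraid (z ++ z') f = lbraid z (lbraid z' f).
Proof. exact: foldr_cat. Qed.

Lemma lbraid_positive u f : lbraid (positive_word u) f = lword u f.
Proof. by elim: u => //= s u ->. Qed.

Lemma lbraid_cong (z z' : braid_word S) f : word_cong (@braid_rel W S) z z' ->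
  lbraid z f = lbraid z' f.
Proof.
move=> zz'; elim: zz' f => {z z'} [z z'|//|z z' _ IH f|z z' z2 _ IH1 _ IH2 f|].
- case=> [s b|s t st] f; first by case: b; rewrite /= /lletter /= ?lopK ?lopVK.
  have lst := len_alternating coxWS st; rewrite !lbraid_positive.
  apply: lword_eq; rewrite /reduced ?size_alternating ?lst //.
    by rewrite -word_val_alternating // lst.
  exact: word_val_alternating.
- by rewrite IH.
- by rewrite IH1 IH2.
- by move=> z1 z1' z2 z2' _ IH1 _ IH2 f; rewrite !lbraid_cat IH2 IH1.
Qed.

Lemma lbraid_rop z t f : lbraid z (rop t f) = rop t (lbraid z f).
Proof.
elim: z => // x z IHz; have lbE g : lbraid (x :: z) g = lletter x (lbraid z g) by [].
rewrite !lbE IHz /lletter; case: x.2; last exact: lop_rop.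
have roppZ (a : R) (g : E) : rop t (a *: g) = a *: rop t g by exact: linearZ.
have roppB (g g' : E) : rop t (g - g') = rop t g - rop t g' by exact: linearB.
by rewrite /lopV lop_rop roppZ roppB roppZ.
Qed.

End RegularOperators.

Local Notation "p %:F" := (FracField.tofrac p).

Lemma is_laurentXV : ('X : {poly int})%:F^-1 \in is_laurent.
Proof. by apply/asboolP; exists 1, 1%N; rewrite tofrac1 div1r expr1. Qed.

Definition laurent_qi : laurent := Laurent is_laurentXV.

Lemma laurent_qiq : laurent_qi * laurent_q = 1.
Proof.
apply: val_inj; rewrite rmorphM rmorph1 /= mulVf //.
by rewrite -['X]expr1 tofracXn_neq0.
Qed.

(** * The action of the braid group and of its group algebra *)

Section GalgAction.
Variables (W : finGroupType) (S : {set W}).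
Hypothesis coxWS : coxeter_system S.
Local Notation I := (generator S).
Local Notation L := laurent.
Local Notation q := laurent_q.
Local Notation qi := laurent_qi.
Local Notation B := (braid S).
Local Notation LB := (galg laurent (braid S)).
Local Notation E := {ffun W -> laurent^o}.
Local Notation lopp := (@lop W S laurent laurent_q).
Local Notation lbraid := (@lbraid W S laurent laurent_q laurent_qi).
Implicit Types (s t : I) (w : W) (f : E) (b : B) (x y : LB) (a : L).

Definition braid_act b f : E := lbraid (repr b) f.

Lemma braid_act_pi z f : braid_act (\pi_B z) f = lbraid z f.
Proof.
apply: (lbraid_cong coxWS laurent_qiq); apply/braid_eqP.
by rewrite reprK.
Qed.

Lemma braid_actM b b' f : braid_act (b * b')%g f = braid_act b (braid_act b' f).
Proof. by rewrite [LHS]braid_act_pi lbraid_cat. Qed.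

Lemma braid_act1 f : braid_act 1%g f = f.
Proof. by rewrite [LHS]braid_act_pi. Qed.

Lemma braid_act_gen s f : braid_act (braid_gen s) f = lopp s f.
Proof. by rewrite braid_act_pi. Qed.

HB.instance Definition _ b := GRing.Linear.copy (braid_act b) (lbraid (repr b)).

Definition galg_act x f : E := \sum_(b <- msupp x) x@_b *: braid_act b f.

Lemma galg_actw (d : {fset B}) x f : fsubset (msupp x) d ->
  galg_act x f = \sum_(b <- d) x@_b *: braid_act b f.
Proof.
move=> xd; apply: (big_fset_incl _ xd) => /= b _ /mcoeff_outdom ->.
by rewrite scale0r.
Qed.

Lemma galg_actBl x y f : galg_act (x - y) f = galg_act x f - galg_act y f.
Proof.
set d := fsetU (msupp x) (msupp y).
rewrite (@galg_actw d x) ?fsubsetUl // (@galg_actw d y) ?fsubsetUr //.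
rewrite (@galg_actw d (x - y)) ?msuppB_le // -sumrB.
by apply: eq_bigr => b _; rewrite mcoeffB scalerBl.
Qed.

Lemma galg_act0l f : galg_act 0 f = 0.
Proof. by rewrite -[0]subr0 galg_actBl subrr. Qed.

Lemma galg_actDl x y f : galg_act (x + y) f = galg_act x f + galg_act y f.
Proof. by rewrite -[y in LHS]opprK galg_actBl -[- y]add0r galg_actBl galg_act0l sub0r opprK. Qed.

Lemma galg_act_suml (J : Type) (r : seq J) (F : J -> LB) f :
  galg_act (\sum_(i <- r) F i) f = \sum_(i <- r) galg_act (F i) f.
Proof.
by elim/big_rec2: _ => [|i u v _ <-]; rewrite ?galg_act0l ?galg_actDl.
Qed.

Lemma galg_act_scaled b a f : galg_act (galg_scaled b a) f = a *: braid_act b f.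
Proof.
by rewrite (@galg_actw [fset b]%fset) ?msuppU_le // big_seq_fset1 mcoeffUU.
Qed.

Lemma galg_act_linear x : linear (galg_act x).
Proof.
move=> a f f'; rewrite /galg_act scaler_sumr -big_split; apply: eq_bigr => b _.
by rewrite linearP scalerDr scalerA mulrC -scalerA.
Qed.
HB.instance Definition _ x := GRing.isLinear.Build L E E *:%R (galg_act x) (galg_act_linear x).

Lemma galg_act_scaledM b a y f :
  galg_act (galg_scaled b a * y) f = a *: braid_act b (galg_act y f).
Proof.
rewrite [y]galgE mulr_sumr !galg_act_suml linear_sum scaler_sumr.
apply: eq_bigr => b' _; rewrite galg_scaledM !galg_act_scaled braid_actM linearZ.
by rewrite scalerA.
Qed.

Lemma galg_actM x y f : galg_act (x * y) f = galg_act x (galg_act y f).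
Proof.
rewrite [x]galgE mulr_suml !galg_act_suml; apply: eq_bigr => b _.
by rewrite galg_act_scaledM galg_act_scaled.
Qed.

Lemma galg_act_in b f : galg_act (galg_in _ b) f = braid_act b f.
Proof. by rewrite galg_act_scaled scale1r. Qed.

Lemma galg_actZl a x f : galg_act (a *: x) f = a *: galg_act x f.
Proof.
rewrite (@galg_actw (msupp x) (a *: x)) ?msuppZ_le // scaler_sumr.
by apply: eq_bigr => b _; rewrite mcoeffZ scalerA.
Qed.

Lemma galg_act1 f : galg_act 1 f = f.
Proof. by rewrite galg_act_in braid_act1. Qed.

Lemma galg_act_rel s f : galg_act (hecke_rel s) f = 0.
Proof.
rewrite galg_actM galg_actBl galg_actZl galg_act1 galg_actDl galg_act1 galg_act_in.
rewrite braid_act_gen linearD /= galg_act_in braid_act_gen (lop_quadratic coxWS).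
by rewrite scalerDr scalerBl scale1r addrA subrK [X in X - _]addrC subrr.
Qed.

(** Lets the action descend to the Hecke algebra. *)
Lemma galg_act_ideal x f : x \in @hecke_ideal W S -> galg_act x f = 0.
Proof.
move=> /asboolP[r ->]; rewrite galg_act_suml big1 // => t _.
by rewrite 2!galg_actM galg_act_rel linear0.
Qed.

End GalgAction.

(** * Matsumoto's theorem and the standard basis *)

Section Matsumoto.
Variables (W : finGroupType) (S : {set W}).
Hypothesis coxWS : coxeter_system S.
Local Notation I := (generator S).
Local Notation B := (braid S).
Implicit Types (s t : I) (w x y : W) (u v : seq I).
Local Open Scope group_scope.

(** If the stripping of the alternating suffix stopped before m letters, both s and t would be
    ascents of x, and [altr_root_nneg] would make s an ascent of w. *)
Lemma double_descent w s t : s != t ->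
  (len S (w * val s) < len S w)%N -> (len S (w * val t) < len S w)%N ->
  exists2 x, w = x * word_val (altr (cox_order s t) s t) &
    len S w = (len S x + cox_order s t)%N.
Proof.
move=> st ws wt; have m1 := cox_order_gt1 coxWS st.
have [k [x [km wE lw [kE|[xs xt]]]]] := strip_altr coxWS s (ltnW m1) wt.
  by exists x; rewrite -kE.
have [kE|km'] := eqVneq k (cox_order s t); first by exists x; rewrite -kE.
have klt : (k < cox_order s t)%N by rewrite ltn_neqAle km'; case/andP: km.
have := altr_root_nneg coxWS st klt (ascent_root_nneg coxWS xs) (ascent_root_nneg coxWS xt).
by rewrite -wE => /(nneg_root_ascent coxWS); rewrite ltnNge ltnW.
Qed.

Definition braid_prod u : B := \prod_(s <- u) braid_gen s.

Lemma braid_prodE u : braid_prod u = \pi_B (positive_word u).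
Proof.
rewrite /braid_prod; elim: u => [|s u IHu]; first by rewrite big_nil.
by rewrite big_cons IHu [LHS]braid_pi_mul.
Qed.

Lemma braid_prod_rcons u s : braid_prod (rcons u s) = braid_prod u * braid_gen s.
Proof. by rewrite /braid_prod big_rcons. Qed.

Lemma braid_prod_altr s t : s != t ->
  braid_prod (altr (cox_order s t) s t) = braid_prod (altr (cox_order s t) t s).
Proof.
move=> st; have E : braid_prod (alternating (cox_order s t) s t) =
    braid_prod (alternating (cox_order s t) t s).
  by rewrite !braid_prodE; apply/eqP/braid_eqP; apply: word_cong_rel; constructor.
by move: E; rewrite !alternatingE; case: odd.
Qed.

(** Induction on length. Words with the same last letter are compared without it. If the last
    letters s and t differ, both are descents, so w has reduced words ending in either alternating
    word of length m(s,t): these two differ by a braid relation, and each shares its last letter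
    with u or v. *)
Theorem matsumoto u v : reduced u -> reduced v -> word_val u = word_val v ->
  braid_prod u = braid_prod v.
Proof.
have [n] := ubnP (size u); elim: n u v => // n IHn u v un ru rv uv.
have szuv : size u = size v by rewrite ru rv uv.
case/lastP: u un ru uv szuv => [|u s]; first by case: v rv.
rewrite size_rcons ltnS => un ru uv szuv.
case/lastP: v rv uv szuv => [//|v t].
rewrite size_rcons => rv uv [szuv].
have same p p' r : (size p < n)%N -> reduced (rcons p r) -> reduced (rcons p' r) ->
    word_val (rcons p r) = word_val (rcons p' r) ->
    braid_prod (rcons p r) = braid_prod (rcons p' r).
  move=> pn /(reduced_rconsE coxWS)[rp _] /(reduced_rconsE coxWS)[rp' _] E.
  rewrite !braid_prod_rcons; congr (_ * _); apply: IHn => //.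
  by move: E; rewrite !word_val_rcons => /mulIg.
have [st|st] := eqVneq s t; first by rewrite -st in rv uv *; apply: same.
set w := word_val (rcons u s) in uv.
have ws : (len S (w * val s) < len S w)%N.
  have [_] := reduced_rconsE coxWS ru.
  by rewrite /w word_val_rcons mulgenK.
have wt : (len S (w * val t) < len S w)%N.
  have [_] := reduced_rconsE coxWS rv.
  by rewrite uv word_val_rcons mulgenK.
have [x wE lw] := double_descent st ws wt.
have [p [px sp]] := reduced_exists coxWS x.
have m1 := ltnW (cox_order_gt1 coxWS st); set m := cox_order s t in lw wE m1 *.
have Et : p ++ altr m s t = rcons (p ++ altr m.-1 t s) t.
  by rewrite -(prednK m1) /= rcons_cat.
have Es : p ++ altr m t s = rcons (p ++ altr m.-1 s t) s.
  by rewrite -(prednK m1) /= rcons_cat.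
have vt : word_val (p ++ altr m s t) = w by rewrite word_val_cat px wE.
have vs : word_val (p ++ altr m t s) = w by rewrite word_val_cat px wE word_val_altrC.
have sz a b : size (p ++ altr m a b) = len S w by rewrite size_cat size_altr sp lw.
have szp a b : (size (p ++ altr m.-1 a b) < n)%N.
  have su : (size u).+1 = len S w by rewrite /w -ru size_rcons.
  have := sz a b; rewrite !size_cat !size_altr; move: un su m1; lia.
rewrite (same u (p ++ altr m.-1 s t)) -?Es //; last first.
- by rewrite /reduced vs sz.
rewrite [RHS](same v (p ++ altr m.-1 t s)) -?Et ?vt //; last 2 first.
- by rewrite -szuv.
- by rewrite /reduced vt sz.
by rewrite /braid_prod !big_cat -!/(braid_prod _) braid_prod_altr.
Qed.

Lemma braid_liftE u : reduced u -> braid_lift S (word_val u) = braid_prod u.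
Proof.
move=> ru; have [uE su] := a_reduced_wordP coxWS (word_val u).
by apply: matsumoto => //; rewrite /reduced su uE.
Qed.

Lemma braid_liftM x y : len S (x * y) = (len S x + len S y)%N ->
  braid_lift S (x * y) = braid_lift S x * braid_lift S y.
Proof.
have [[u [<- su]] [v [<- sv]]] := (reduced_exists coxWS x, reduced_exists coxWS y).
rewrite -word_val_cat => E; rewrite !braid_liftE //; first by rewrite [LHS]big_cat.
by rewrite /reduced E size_cat su sv.
Qed.

Lemma braid_lift1 : braid_lift S 1 = 1.
Proof.
rewrite -(word_val_nil S) braid_liftE; first exact: big_nil.
by rewrite /reduced word_val_nil len1.
Qed.

Lemma braid_lift_gen s : braid_lift S (val s) = braid_gen s.
Proof.
have E : word_val [:: s] = val s by rewrite word_val_cons word_val_nil mulg1.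
by rewrite -E braid_liftE /reduced ?E ?len_gen // /braid_prod big_seq1.
Qed.

End Matsumoto.

Lemma quadratic_expand (R : comNzRingType) (A : algType R) (a : R) (x : A) :
  (x - a%:A) * (x + 1) = 0 -> x * x = a *: 1 + (a - 1) *: x.
Proof.
rewrite mulrDr mulr1 mulrBl mulr_algl => E0; apply/eqP; rewrite -subr_eq0 -E0; apply/eqP.
rewrite scalerBl scale1r opprD opprB -[RHS]addrA; congr (_ + _).
by rewrite addrCA [RHS]addrCA [- _ - _]addrC.
Qed.

Lemma quadraticM (R : comNzRingType) (A : algType R) (a : R) (x y : A) :
  x * x = a *: 1 + (a - 1) *: x -> x * (x * y) = a *: y + (a - 1) *: (x * y).
Proof. by move=> xx; rewrite mulrA xx mulrDl -!scalerAl mul1r. Qed.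

Lemma quadratic_inv (R : comNzRingType) (A : algType R) (a ai : R) (x y : A) :
  ai * a = 1 -> x * x = a *: 1 + (a - 1) *: x -> x * y = 1 -> y = ai *: (x - (a - 1) *: 1).
Proof.
move=> aia xx xy; have {1}-> : y = ai *: ((x - (a - 1) *: 1) * x) * y.
  by rewrite mulrBl xx mulr_algl addrK scalerA aia scale1r mul1r.
by rewrite -scalerAl -mulrA xy mulr1.
Qed.

Lemma scale_subM (R : comNzRingType) (A : algType R) (a b : R) (x y : A) :
  (a *: (x - b *: 1)) * y = a *: (x * y - b *: y).
Proof. by rewrite -scalerAl mulrBl mulr_algl. Qed.

(** * The standard basis of the Hecke algebra and its coefficients *)

Section HeckeCoefficients.
Variables (W : finGroupType) (S : {set W}).
Hypothesis coxWS : coxeter_system S.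
Local Notation I := (generator S).
Local Notation L := laurent.
Local Notation q := laurent_q.
Local Notation qi := laurent_qi.
Local Notation B := (braid S).
Local Notation LB := (galg laurent (braid S)).
Local Notation H := (hecke S).
Local Notation E := {ffun W -> laurent^o}.
Local Notation lopp := (@lop W S laurent laurent_q).
Local Notation ropp := (@rop W S laurent laurent_q).
Local Notation delta := (@dirac W laurent).
Local Notation "''T_' w" := (std_basis S w) (at level 8, w at level 2, format "''T_' w").
Implicit Types (s t : I) (w v : W) (f : E) (b : B) (x y : H) (a : L) (u : seq I).

Lemma hecke_of_braidM b b' : hecke_of_braid (b * b')%g = hecke_of_braid b * hecke_of_braid b'.
Proof. by rewrite /hecke_of_braid galg_inM rmorphM. Qed.

Lemma hecke_of_braid1 : hecke_of_braid (1%g : B) = 1.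
Proof. by rewrite /hecke_of_braid galg_in1 rmorph1. Qed.

(** Acting on the indicator of the identity reads off the coefficients in the standard basis. The
    representative is immaterial by [coefs_pi]. *)
Definition coefs x : E := galg_act (repr x) (delta 1%g).

Lemma coefs_pi (x : LB) : coefs (hecke_pi x) = galg_act x (delta 1%g).
Proof.
apply/eqP; rewrite -subr_eq0 -galg_actBl; apply/eqP.
by apply: (galg_act_ideal coxWS); apply: hecke_pi_reprB.
Qed.

Lemma coefs_linear : linear coefs.
Proof.
move=> a; elim/hecke_piW=> x; elim/hecke_piW=> y.
by rewrite -linearP !coefs_pi galg_actDl galg_actZl.
Qed.
Definition coefs_lin : {linear H -> E} :=
  HB.pack coefs (GRing.isLinear.Build L H E *:%R coefs coefs_linear).

Lemma coefsD x y : coefs (x + y) = coefs x + coefs y.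
Proof. exact: (linearD coefs_lin). Qed.

Lemma coefsZ a x : coefs (a *: x) = a *: coefs x.
Proof. exact: (linearZ_LR coefs_lin). Qed.

Lemma coefs0 : coefs 0 = 0.
Proof. exact: (linear0 coefs_lin). Qed.

Lemma coefsB x y : coefs (x - y) = coefs x - coefs y.
Proof. exact: (linearB coefs_lin). Qed.

Lemma coefs_sum (J : Type) (r : seq J) (F : J -> H) :
  coefs (\sum_(i <- r) F i) = \sum_(i <- r) coefs (F i).
Proof. exact: (linear_sum coefs_lin). Qed.

Lemma coefs_braidM b x : coefs (hecke_of_braid b * x) = braid_act b (coefs x).
Proof.
elim/hecke_piW: x => x.
by rewrite -rmorphM !coefs_pi (galg_actM coxWS) galg_act_in.
Qed.

Definition hgen s : H := hecke_of_braid (braid_gen s).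

Lemma coefs_genM s x : coefs (hgen s * x) = lopp s (coefs x).
Proof. by rewrite coefs_braidM braid_act_gen. Qed.

Lemma coefs1 : coefs 1 = delta 1%g.
Proof. by rewrite -hecke_of_braid1 coefs_pi (galg_act1 coxWS). Qed.

Lemma galg_act_rop (x : LB) t f : galg_act x (ropp t f) = ropp t (galg_act x f).
Proof.
rewrite /galg_act linear_sum; apply: eq_bigr => b _.
by rewrite linearZ /= /braid_act (lbraid_rop coxWS).
Qed.

(** On the indicator of the identity the left and right operators of s agree, and the right one
    commutes with the whole action. *)
Lemma coefsM_gen s x : coefs (x * hgen s) = ropp s (coefs x).
Proof.
elim/hecke_piW: x => x; rewrite -rmorphM !coefs_pi (galg_actM coxWS) galg_act_in.
rewrite braid_act_gen // -galg_act_rop; congr galg_act.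
rewrite lop_dirac ?rop_dirac ?mulg1 ?mul1g ?len1 ?len_gen //.
Qed.

Lemma coefs_basis w : coefs 'T_w = delta w.
Proof.
have [u [<- ru]] := reduced_exists coxWS w.
rewrite /std_basis braid_liftE // -(lword_reduced coxWS laurent_q ru).
rewrite /braid_prod; elim: u {ru} => [|s u IHu]; first by rewrite big_nil hecke_of_braid1 coefs1.
by rewrite big_cons hecke_of_braidM coefs_genM IHu.
Qed.

Lemma std_basisM w v : len S (w * v)%g = (len S w + len S v)%N -> 'T_(w * v)%g = 'T_w * 'T_v.
Proof. by move=> wv; rewrite /std_basis braid_liftM // hecke_of_braidM. Qed.

Lemma std_basis1 : 'T_1%g = 1.
Proof. by rewrite /std_basis braid_lift1 // hecke_of_braid1. Qed.

Lemma std_basis_gen s : 'T_(val s) = hgen s.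
Proof. by rewrite /std_basis braid_lift_gen. Qed.

Lemma hgen_sqr s : hgen s * hgen s = q *: 1 + (q - 1) *: hgen s.
Proof.
have : hecke_pi (hecke_rel s) = 0.
  apply/eqP; rewrite -(rmorph0 (@hecke_pi W S)) hecke_piE subr0; apply/asboolP.
  by exists [:: (1, s, 1)]; rewrite big_seq1 /= mul1r mulr1.
rewrite /hecke_rel rmorphM rmorphB rmorphD rmorph1 /= hecke_piZ [hecke_pi 1]rmorph1.
rewrite -/(hecke_of_braid _) -/(hgen s).
exact: quadratic_expand.
Qed.

Lemma hgen_basisM s w : hgen s * 'T_w =
  if (len S w < len S (val s * w)%g)%N then 'T_(val s * w)%g
  else q *: 'T_(val s * w)%g + (q - 1) *: 'T_w.
Proof.
have up v : (len S v < len S (val s * v)%g)%N -> hgen s * 'T_v = 'T_(val s * v)%g.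
  move=> sv; rewrite std_basisM ?std_basis_gen // len_gen // add1n.
  by case: (lenMl_or coxWS v s) sv => [->|->]; rewrite // ltnNge leqnSn.
case: ifP => [/up//|]; rewrite lenMl_nlt // => /negbFE ws.
have E := up (val s * w)%g; rewrite mulKgen // in E.
by rewrite -(E ws); apply: quadraticM; exact: hgen_sqr.
Qed.

Definition expand f : H := \sum_w f w *: 'T_w.

Lemma expand_linear : linear expand.
Proof.
move=> a f g; rewrite /expand scaler_sumr -big_split; apply: eq_bigr => w _ /=.
by rewrite !ffunE scalerDl scalerA.
Qed.
HB.instance Definition _ := GRing.isLinear.Build L E H *:%R expand expand_linear.

Lemma expandZ a f : expand (a *: f) = a *: expand f.
Proof. exact: linearZ. Qed.

Lemma expandB f g : expand (f - g) = expand f - expand g.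
Proof. exact: linearB. Qed.

Lemma expand_dirac w : expand (delta w) = 'T_w.
Proof.
rewrite /expand (bigD1 w) //= ffunE eqxx scale1r big1 ?addr0 // => v /negPf vw.
by rewrite ffunE vw scale0r.
Qed.

Lemma hgen_expand s f : hgen s * expand f = expand (lopp s f).
Proof.
rewrite [f](ffun_diracE) !linear_sum mulr_sumr; apply: eq_bigr => w _.
rewrite !linearZ /= -scalerAr; congr (_ *: _); rewrite expand_dirac hgen_basisM.
case: ifP => [sw|]; first by rewrite lop_dirac // expand_dirac.
rewrite lenMl_nlt // => /negbFE sw; have Ew : delta w = lopp s (delta (val s * w)%g).
  by rewrite lop_dirac ?mulKgen.
rewrite Ew lop_quadratic // -Ew linearP /= linearZ /= !expand_dirac.
by rewrite addrC.
Qed.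

(** The standard basis spans: its span is stable under the generators and under their inverses,
    which are combinations of 1 and T_s. Independence is [coefs_basis]. *)
Lemma coefsK x : expand (coefs x) = x.
Proof.
have genV s : hecke_of_braid (\pi_B [:: (s, true)]) = qi *: (hgen s - (q - 1) *: 1).
  set z := hecke_of_braid _.
  have sz : hgen s * z = 1.
    rewrite /z /hgen -hecke_of_braidM -hecke_of_braid1 /braid_gen [(_ * _)%g]braid_pi_mul.
    congr hecke_of_braid; apply/eqP/braid_eqP; apply: word_cong_rel.
    exact: (BraidCancel s false).
  exact: quadratic_inv laurent_qiq (hgen_sqr s) sz.
have expB z : expand (coefs (hecke_of_braid (\pi_B z))) = hecke_of_braid (\pi_B z).
  elim: z => [|[s b] z IHz].
    by rewrite -/(braid_one S) -[braid_one S]/(1%g : B) hecke_of_braid1 coefs1 expand_dirac std_basis1.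
  have -> : \pi_B ((s, b) :: z) = (\pi_B [:: (s, b)] * \pi_B z)%g by rewrite [RHS]braid_pi_mul.
  rewrite hecke_of_braidM -{2}IHz; case: b.
    rewrite genV !scale_subM coefsZ coefsB coefsZ coefs_genM hgen_expand.
    by rewrite expandZ expandB expandZ.
  by rewrite coefs_genM hgen_expand.
elim/hecke_piW: x => x; have -> : hecke_pi x = \sum_(b <- msupp x) hecke_pi (galg_scaled b x@_b).
  by rewrite [in LHS](galgE x) raddf_sum.
elim/big_ind: _ => [|y z Ey Ez|b _].
- by rewrite coefs0 linear0.
- by rewrite coefsD linearD; congr (_ + _).
have -> : galg_scaled b x@_b = x@_b *: galg_in L b by rewrite galg_scalerU mulr1.
rewrite /= hecke_piZ coefsZ linearZ; congr (_ *: _).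
by have := expB (repr b); rewrite reprK.
Qed.

Lemma std_coeffsE x : std_coeffs x = coefs x.
Proof.
have /(xchoose_orP 0)/eqP : exists a : {ffun W -> L}, x == \sum_w a w *: 'T_w.
  by exists (coefs x); rewrite -{1}[x]coefsK.
rewrite -/(std_coeffs x); set a := std_coeffs x => xE.
rewrite {}xE coefs_sum [LHS]ffun_diracE; apply: eq_bigr => w _.
by rewrite coefsZ coefs_basis.
Qed.

End HeckeCoefficients.

(** * Leading coefficients at q = 1 *)

Section LeadingCoefficients.
Variables (R : comNzRingType) (h : R).
Hypothesis h_quot : forall f : R, exists (a : int) (g : R), f = a%:~R + h * g.
Hypothesis h_int : forall (a : int) (g : R), a%:~R = h * g -> a = 0.
Hypothesis h_reg : forall f : R, h * f = 0 -> f = 0.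
Implicit Types (f g : R) (m n : nat) (a b : int).

Definition hdvd n f := exists g, f = h ^+ n * g.

(** The class of f / h^n modulo h is a, where the hypotheses identify R / h with the integers. The
    value a = 0 is allowed, so n is only a lower bound for the order of vanishing. *)
Definition approx n f a := exists g, f = h ^+ n * (a%:~R + h * g).

Definition lead n f : int :=
  if pselect (exists a, approx n f a) is left e then projT1 (cid e) else 0.

Lemma approx_hdvd n f a : approx n f a -> hdvd n f.
Proof. by case=> g ->; exists (a%:~R + h * g). Qed.

Lemma hdvd_approx n f : hdvd n f -> approx n f (lead n f).
Proof.
case=> g ->; have [a [g' ->]] := h_quot g; rewrite /lead.
case: pselect => [e|[]]; first by case: (cid e).
by exists a, g'.
Qed.

Lemma hX_reg n f : h ^+ n * f = 0 -> f = 0.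
Proof. by elim: n => [|n IHn]; rewrite ?mul1r // exprS -mulrA => /h_reg/IHn. Qed.

Lemma approx_unique n f a b : approx n f a -> approx n f b -> a = b.
Proof.
move=> [g ->] [g' /eqP]; rewrite -subr_eq0 -mulrBr => /eqP/hX_reg E.
apply/eqP; rewrite -subr_eq0; apply/eqP/(@h_int _ (g' - g)).
by apply/eqP; rewrite -subr_eq0 -E rmorphB /=; apply/eqP; ring.
Qed.

Lemma lead_eq n f a : approx n f a -> lead n f = a.
Proof. by move=> fa; apply: approx_unique (fa); apply/hdvd_approx/(approx_hdvd fa). Qed.

Lemma hdvdW m n f : (m <= n)%N -> hdvd n f -> hdvd m f.
Proof.
by move=> mn [g ->]; exists (h ^+ (n - m) * g); rewrite mulrA -exprD subnKC.
Qed.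

Lemma hdvd0 n : hdvd n 0.
Proof. by exists 0; rewrite mulr0. Qed.

Lemma hdvdD n f g : hdvd n f -> hdvd n g -> hdvd n (f + g).
Proof. by move=> [f' ->] [g' ->]; exists (f' + g'); rewrite mulrDr. Qed.

Lemma hdvdMl n f g : hdvd n g -> hdvd n (f * g).
Proof. by move=> [g' ->]; exists (f * g'); rewrite mulrCA. Qed.

Lemma hdvdB n f g : hdvd n f -> hdvd n g -> hdvd n (f - g).
Proof. by move=> [f' ->] [g' ->]; exists (f' - g'); rewrite mulrBr. Qed.

Lemma hdvdM m n f g : hdvd m f -> hdvd n g -> hdvd (m + n) (f * g).
Proof. by move=> [f' ->] [g' ->]; exists (f' * g'); rewrite exprD mulrACA. Qed.

Lemma hdvdS n f : hdvd n f -> hdvd n.+1 (h * f).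
Proof. by move=> [f' ->]; exists f'; rewrite exprS mulrA. Qed.

Lemma approx_small n f : hdvd n.+1 f -> approx n f 0.
Proof. by case=> g ->; exists g; rewrite add0r exprSr mulrA. Qed.

Lemma approx0 n : approx n 0 0.
Proof. exact/approx_small/hdvd0. Qed.

Lemma approxD n f g a b : approx n f a -> approx n g b -> approx n (f + g) (a + b).
Proof.
move=> [f' ->] [g' ->]; exists (f' + g'); rewrite rmorphD /=; ring.
Qed.

Lemma approxDsmall n f g a : approx n f a -> hdvd n.+1 g -> approx n (f + g) a.
Proof. by move=> fa /approx_small g0; rewrite -[a]addr0; apply: approxD. Qed.

Lemma approxM m n f g a b : approx m f a -> approx n g b -> approx (m + n) (f * g) (a * b).
Proof.
move=> [f' ->] [g' ->]; exists (f' * b%:~R + a%:~R * g' + h * f' * g').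
by rewrite rmorphM /= exprD; ring.
Qed.

Lemma approx1 : approx 0 1 1.
Proof. by exists 0; rewrite mul1r mulr0 addr0. Qed.

Lemma approx_h : approx 1 h 1.
Proof. by exists 0; rewrite expr1 mulr0 addr0 mulr1. Qed.

Lemma approx_unit f a n g : approx 0 f 1 -> approx n (f * g) a -> hdvd n g -> approx n g a.
Proof.
move=> f1 fg ng; have ga := hdvd_approx ng.
by have := approxM f1 ga; rewrite add0n mul1r => /(approx_unique fg)->.
Qed.

(** A term whose guaranteed divisibility exceeds n has leading coefficient 0 at order n; only the
    indices that attain the bound survive. *)
Lemma approx_sum (J : finType) (f g : J -> R) (m p : J -> nat) n (F G : J -> int) :
  (forall j, hdvd (m j) (f j)) -> (forall j, hdvd (p j) (g j)) ->
  (forall j, (n <= m j + p j)%N) ->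
  (forall j, (m j + p j <= n)%N -> approx (m j) (f j) (F j)) ->
  (forall j, (m j + p j <= n)%N -> approx (p j) (g j) (G j)) ->
  approx n (\sum_j f j * g j) (\sum_(j | (m j + p j <= n)%N) F j * G j).
Proof.
move=> mf pg nmp fF gG; rewrite [X in approx _ _ X]big_mkcond /=.
elim/big_rec2: _ => [|j a b _ ab]; first exact: approx0.
apply: approxD ab; case: leqP => mpn.
  have -> : n = (m j + p j)%N by apply/eqP; rewrite eqn_leq nmp.
  by apply: approxM; [apply: fF|apply: gG].
by apply: approx_small; apply: hdvdW mpn _; apply: hdvdM.
Qed.

End LeadingCoefficients.

(** * The projection of the braid group onto W *)

Section BraidValue.
Variables (W : finGroupType) (S : {set W}).
Hypothesis coxWS : coxeter_system S.
Local Notation I := (generator S).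
Local Notation B := (braid S).
Implicit Types (s t : I) (w : W) (b : B) (z : braid_word S).
Local Open Scope group_scope.

Definition braid_word_val z : W := word_val (map fst z).

Definition braid_val b : W := braid_word_val (repr b).

Lemma braid_word_val_cat z z' :
  braid_word_val (z ++ z') = braid_word_val z * braid_word_val z'.
Proof. by rewrite /braid_word_val map_cat word_val_cat. Qed.

Lemma braid_word_val_positive u : braid_word_val (positive_word u) = word_val u.
Proof. by rewrite /braid_word_val -map_comp map_id. Qed.

Lemma braid_word_val_cong z z' : word_cong (@braid_rel W S) z z' ->
  braid_word_val z = braid_word_val z'.
Proof.
elim=> {z z'} [z z' zz'|//|z z' _ ->|z z' z2 _ -> _ ->|z1 z1' z2 z2' _ E1 _ E2] //.
  case: zz' => [s b|s t st]; last by rewrite !braid_word_val_positive word_val_alternating.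
  by rewrite /braid_word_val /= !word_val_cons word_val_nil mulg1 gen_mulK.
by rewrite !braid_word_val_cat E1 E2.
Qed.

Lemma braid_val_pi z : braid_val (\pi_B z) = braid_word_val z.
Proof. by apply: braid_word_val_cong; apply/braid_eqP; rewrite reprK. Qed.

Lemma braid_valM b b' : braid_val (b * b') = braid_val b * braid_val b'.
Proof. by rewrite [LHS]braid_val_pi braid_word_val_cat. Qed.

Lemma braid_val1 : braid_val 1 = 1.
Proof. by rewrite [LHS]braid_val_pi /braid_word_val /= word_val_nil. Qed.

Lemma braid_valV b : braid_val b^-1 = (braid_val b)^-1.
Proof. by apply/eqP; rewrite eq_sym eq_invg_mul -braid_valM mulgV braid_val1. Qed.

Lemma braid_val_gen s : braid_val (braid_gen s) = val s.
Proof. by rewrite braid_val_pi /braid_word_val /= word_val_cons word_val_nil mulg1. Qed.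

Lemma braid_genV s : (braid_gen s)^-1 = \pi_B [:: (s, true)].
Proof.
apply: (mulgI (braid_gen s)); rewrite mulgV [RHS]braid_pi_mul; apply/esym.
by apply/eqP/braid_eqP; apply: word_cong_rel; exact: (BraidCancel s false).
Qed.

Lemma braid_val_lift w : braid_val (braid_lift S w) = w.
Proof.
have [u [<- ru]] := reduced_exists coxWS w; rewrite braid_liftE //.
by rewrite braid_prodE braid_val_pi braid_word_val_positive.
Qed.

End BraidValue.

(** * Associativity, units and uniqueness of inverses in the incidence algebra *)

Section IncidenceAlgebra.
Variables (X : finType) (P : {set X}) (le : rel X).
Hypothesis le_refl : reflexive le.
Hypothesis le_trans : transitive le.
Local Notation pair := (inc_pair P le).
Implicit Types (x y z : X) (f g : {ffun X * X -> int}).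

Lemma inc_pair_trans y x z : pair x y -> pair y z -> pair x z.
Proof.
by move=> /and3P[xP _ xy] /and3P[_ zP yz]; rewrite /inc_pair xP zP (le_trans xy yz).
Qed.

Lemma inc_mulA f1 f2 f3 :
  inc_mul P le f1 (inc_mul P le f2 f3) = inc_mul P le (inc_mul P le f1 f2) f3.
Proof.
apply/ffunP=> -[x v]; rewrite !ffunE /=.
transitivity (\sum_w \sum_(y | [&& pair x w, pair w y & pair y v])
    f1 (x, w) * f2 (w, y) * f3 (y, v)).
  rewrite big_mkcond; apply: eq_bigr => w _; rewrite ffunE /=; case: ifP => [/andP[xw wv]|xwv].
    by rewrite mulr_sumr; apply: eq_big => [y|y _]; rewrite ?xw // mulrA.
  rewrite big_pred0 // => y; apply/negP=> /and3P[xw wy yv]; move/negP: xwv; apply.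
  by rewrite xw (inc_pair_trans wy yv).
rewrite (exchange_big_dep predT) //= [RHS]big_mkcond; apply: eq_bigr => y _.
rewrite ffunE /=; case: ifP => [/andP[xy yv]|xyv].
  by rewrite mulr_suml; apply: eq_bigl => w; rewrite yv andbT.
rewrite big_pred0 // => w; apply/negP=> /and3P[xw wy yv]; move/negP: xyv; apply.
by rewrite yv (inc_pair_trans xw wy).
Qed.

Lemma inc_suppP f : inc_supp P le f -> forall x v, ~~ pair x v -> f (x, v) = 0.
Proof. by move=> /forallP fS x v xv; have /forallP/(_ v)/implyP/(_ xv)/eqP := fS x. Qed.

Lemma inc_mul1 f : inc_supp P le f -> inc_mul P le (inc_one P) f = f.
Proof.
move=> /inc_suppP fS; apply/ffunP=> -[x v]; rewrite ffunE /=.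
have [xv|xv] := boolP (pair x v); last first.
  by rewrite fS // big_pred0 // => w; apply: contraNF xv => /andP[]; apply: inc_pair_trans.
have /and3P[xP _ _] := xv; have xx : pair x x by rewrite /inc_pair xP le_refl.
rewrite (bigD1 x) /= ?xx // ffunE /= xP eqxx mul1r big1 ?addr0 // => w /andP[_ /negPf wx].
by rewrite ffunE /= [x == w]eq_sym wx andbF mul0r.
Qed.

Lemma inc_mulr1 f : inc_supp P le f -> inc_mul P le f (inc_one P) = f.
Proof.
move=> /inc_suppP fS; apply/ffunP=> -[x v]; rewrite ffunE /=.
have [xv|xv] := boolP (pair x v); last first.
  by rewrite fS // big_pred0 // => w; apply: contraNF xv => /andP[]; apply: inc_pair_trans.
have /and3P[_ vP _] := xv; have vv : pair v v by rewrite /inc_pair vP le_refl.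
rewrite (bigD1 v) /= ?vv ?xv // ffunE /= vP eqxx mulr1 big1 ?addr0 // => w /andP[_ /negPf wv].
by rewrite ffunE /= wv andbF mulr0.
Qed.

Lemma inc_inv_eq f f' : inc_supp P le f' ->
  inc_mul P le f f' = inc_one P -> inc_mul P le f' f = inc_one P -> inc_inv P le f = f'.
Proof.
move=> f'S ff' f'f; have /(xchoose_orP f) : exists g,
    [&& inc_supp P le g, inc_mul P le f g == inc_one P & inc_mul P le g f == inc_one P].
  by exists f'; rewrite f'S ff' f'f !eqxx.
rewrite -/(inc_inv P le f) => /and3P[IS _ /eqP If].
by rewrite -[LHS]inc_mulr1 // -ff' inc_mulA If inc_mul1.
Qed.

End IncidenceAlgebra.

(** * The full twist *)

(* H stands for the Hecke algebra: only the properties below are used, and leaving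
   it abstract prevents its quotient construction from being unfolded. *)
Section HeckeModel.
Variables (W : finGroupType) (S : {set W}).
Hypothesis coxWS : coxeter_system S.
Variables (R : comNzRingType) (q qi : R).
Hypothesis qiq : qi * q = 1.
Local Notation h := (q - 1).
Hypothesis h_quot : forall f : R, exists (a : int) (g : R), f = a%:~R + h * g.
Hypothesis h_int : forall (a : int) (g : R), a%:~R = h * g -> a = 0.
Hypothesis h_reg : forall f : R, h * f = 0 -> f = 0.
Local Notation I := (generator S).
Local Notation B := (braid S).
Local Notation E := {ffun W -> R^o}.
Local Notation len := (len S).
Local Notation rl := (reflength S).
Local Notation lopp := (@lop W S R q).
Local Notation ropp := (@rop W S R q).
Local Notation linv := (@lopV W S R q qi).
Local Notation delta := (@dirac W R).
Local Notation hdvd := (hdvd h).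
Local Notation approx := (approx h).
Variables (H : algType R) (hb : B -> H) (cf : {linear H -> E}) (T : W -> H).
Hypothesis TE : forall w, T w = hb (braid_lift S w).
Hypothesis hbM : forall b b', hb (b * b')%g = hb b * hb b'.
Hypothesis hb1 : hb 1%g = 1.
Hypothesis cf_genM : forall s x, cf (hb (braid_gen s) * x) = lopp s (cf x).
Hypothesis cfM_gen : forall s x, cf (x * hb (braid_gen s)) = ropp s (cf x).
Hypothesis cf_basis : forall w, cf (T w) = delta w.
Hypothesis cfK : forall x, x = \sum_w cf x w *: T w.
Implicit Types (s t : I) (u v w : W) (f : E) (b d : B) (x y : H) (J : {set I}).

Lemma T1 : T 1%g = 1.
Proof. by rewrite !TE braid_lift1. Qed.

Lemma TM u v : len (u * v)%g = (len u + len v)%N -> T (u * v)%g = T u * T v.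
Proof. by move=> uv; rewrite !TE braid_liftM. Qed.

Lemma T_gen s : T (val s) = hb (braid_gen s).
Proof. by rewrite !TE braid_lift_gen. Qed.

Lemma len_up_r w s : (len w < len (w * val s)%g)%N -> len (w * val s)%g = (len w + len (val s))%N.
Proof. by rewrite len_gen // addn1; case: (lenMr_or coxWS w s) => -> //; rewrite ltnNge leqnSn. Qed.

Lemma len_up_l w s : (len w < len (val s * w)%g)%N -> len (val s * w)%g = (len (val s) + len w)%N.
Proof. by rewrite len_gen // add1n; case: (lenMl_or coxWS w s) => -> //; rewrite ltnNge leqnSn. Qed.

Lemma cf1 : cf 1 = delta 1%g.
Proof. by rewrite -T1 cf_basis. Qed.

Lemma hb_gen_sqr s : hb (braid_gen s) * hb (braid_gen s) = q *: 1 + h *: hb (braid_gen s).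
Proof.
have cf_gen : cf (hb (braid_gen s)) = lopp s (cf 1) by rewrite -cf_genM mulr1.
rewrite [LHS]cfK [RHS]cfK; congr (\sum_w (_ : E) w *: _).
by rewrite cf_genM linearD !linearZ /= cf_gen lop_quadratic.
Qed.

Lemma cf_genVM s x : cf (hb (braid_gen s)^-1%g * x) = linv s (cf x).
Proof.
by rewrite -{2}[x]mul1r -hb1 -(mulgV (braid_gen s)) hbM -mulrA cf_genM lopK.
Qed.

Lemma hb_genK s : hb (braid_gen s) * hb (braid_gen s)^-1%g = 1.
Proof. by rewrite -hbM mulgV. Qed.

Lemma hb_genV s : hb (braid_gen s)^-1%g = qi *: (hb (braid_gen s) - h *: 1).
Proof.
apply: (quadratic_inv qiq (hb_gen_sqr s)).
by rewrite -hbM mulgV.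
Qed.

Lemma cfM_genV s x : cf (x * hb (braid_gen s)^-1%g) = qi *: (ropp s (cf x) - h *: cf x).
Proof.
rewrite hb_genV -scalerAr linearZ /= mulrBr linearB -scalerAr mulr1 linearZ /=.
by rewrite cfM_gen.
Qed.

(** The canonical symmetrising trace of the Hecke algebra. *)
Definition tau x : R := cf x 1%g.

Lemma tauD x y : tau (x + y) = tau x + tau y.
Proof. by rewrite /tau linearD ffunE. Qed.

Lemma tauZ a x : tau (a *: x) = a * tau x.
Proof. by rewrite /tau linearZ ffunE. Qed.

Lemma tau_sum (J : finType) (F : J -> H) : tau (\sum_j F j) = \sum_j tau (F j).
Proof. by rewrite /tau linear_sum sum_ffunE. Qed.

Lemma tau_genC s x : tau (hb (braid_gen s) * x) = tau (x * hb (braid_gen s)).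
Proof.
rewrite /tau cf_genM cfM_gen /lop /rop !ffunE mulg1 mul1g len1 //.
Qed.

Lemma tauC x y : tau (x * y) = tau (y * x).
Proof.
rewrite [y]cfK mulr_sumr mulr_suml !tau_sum; apply: eq_bigr => w _.
rewrite -scalerAr -scalerAl !tauZ; congr (_ * _).
have [u [<- ru]] := reduced_exists coxWS w; rewrite !TE braid_liftE //.
rewrite /braid_prod; elim: u x {ru} => [|s u IHu] x.
  by rewrite big_nil hb1 mul1r mulr1.
by rewrite big_cons hbM -mulrA tau_genC -mulrA -IHu mulrA.
Qed.

(** Up to powers of q, the inverses index the dual basis of the trace form, so coefficients become
    traces and can be rotated cyclically. *)
Lemma tau_basis x w : tau (x * T w^-1%g) = q ^+ len w * cf x w.
Proof.
have [u [<- ru]] := reduced_exists coxWS w.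
elim/last_ind: u x ru => [|u s IHu] x.
  by rewrite word_val_nil invg1 len1 // T1 mulr1 mul1r.
move=> rus; have [ru us] := reduced_rconsE coxWS rus; have lus := len_up_r us.
rewrite word_val_rcons invMg gen_inv // TM; last first.
  by rewrite -lenV // invMg invgK gen_inv // lus lenV // addnC.
rewrite T_gen mulrA IHu // cfM_gen ffunE ifN; last by rewrite -leqNgt ltnW.
by rewrite lus len_gen // exprD expr1 mulrA.
Qed.

(** The bound obeyed by the coefficients of a braid with image w. The second clause reflects that
    the Hecke algebra specialises to the group algebra at q = 1. *)
Definition degree w f :=
  (forall v, hdvd (rl (v * w^-1)%g) (f v)) /\ approx 0 (f w) 1.

Lemma approx_q n : approx 0 (q ^+ n) 1.
Proof.
have q1 : approx 0 q 1 by exists 1; ring.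
elim: n => [|n IHn]; first exact: approx1.
by rewrite exprS; apply: (approxM q1 IHn).
Qed.

Lemma approx_qi : approx 0 qi 1.
Proof. exists (- qi); rewrite -[qi in LHS]mulr1 -[1 in LHS]qiq; ring: qiq. Qed.

Lemma rl_shift v w s : rl (val s * v * (val s * w)^-1)%g = rl (v * w^-1)%g.
Proof. by rewrite -(rl_conj coxWS (val s) (v * w^-1)%g) invMg !mulgA. Qed.

Lemma rl_shift_le v w s : (rl (v * (val s * w)^-1)%g <= (rl (v * w^-1)%g).+1)%N.
Proof.
rewrite invMg mulgA -addn1 -(rl_gen coxWS s) gen_inv //.
exact: rlM_le.
Qed.

(** The term at sv has the same reflection distance to w as v has to sw, by conjugation. The term at
    v may be one reflection closer, which its factor h makes up for. *)
Lemma degree_lop s w f : degree w f -> degree (val s * w)%g (lopp s f).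
Proof.
move=> [fw fw1]; have sv v : hdvd (rl (v * (val s * w)^-1)%g) (f (val s * v)%g).
  by have := fw (val s * v)%g; rewrite -(rl_shift _ _ s) mulgA gen_mulK // mul1g.
have hv v : hdvd (rl (v * (val s * w)^-1)%g) (h * f v).
  by apply: (hdvdW (rl_shift_le v w s)); apply: hdvdS; apply: fw.
split=> [v|]; rewrite ffunE.
  case: ifP => _; last by apply: hdvdMl.
  by apply: hdvdD.
rewrite mulKgen //; case: ifP => _; last by apply: (approxM (approx_q 1) fw1).
apply: approxDsmall => //.
by exists (f (val s * w)%g); rewrite expr1.
Qed.

Lemma lopVE s f v : linv s f v = qi * (lopp s f v - h * f v).
Proof. by rewrite /lopV !ffunE. Qed.

Lemma degree_lopV s w f : degree w f -> degree (val s * w)%g (linv s f).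
Proof.
move=> fw; have [lf lf1] := degree_lop s fw; split=> [v|]; rewrite lopVE.
  apply: hdvdMl; apply: hdvdB; first exact: lf.
  by apply: (hdvdW (rl_shift_le v w s)); apply: hdvdS; apply: fw.1.
suff fw1 : approx 0 (lopp s f (val s * w)%g - h * f (val s * w)%g) 1.
  exact: (approxM approx_qi fw1).
apply: approxDsmall => //.
by exists (- f (val s * w)%g); rewrite expr1 mulrN.
Qed.

Lemma degree_braid b : degree (braid_val b) (cf (hb b)).
Proof.
suff deg z : degree (braid_word_val z) (cf (hb (\pi_B z))).
  by have := deg (repr b); rewrite reprK.
elim: z => [|[s c] z IHz].
  rewrite -/(braid_one S) -[braid_one S]/(1%g : B) hb1 cf1 /braid_word_val word_val_nil.
  split=> [v|]; rewrite ffunE; last by rewrite eqxx; exact: approx1.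
  by case: eqP => [->|_]; [rewrite invg1 mulg1 rl1 //; exists 1; rewrite mulr1 | exact: hdvd0].
rewrite /braid_word_val /= word_val_cons.
have -> : \pi_B ((s, c) :: z) = ((if c then (braid_gen s)^-1 else braid_gen s) * \pi_B z)%g.
  by case: c; rewrite ?braid_genV [RHS]braid_pi_mul.
rewrite hbM; case: c; first by rewrite cf_genVM; apply: degree_lopV.
by rewrite cf_genM; apply: degree_lop.
Qed.

Lemma cf_expand b b' x v :
  cf (hb b * x * hb b') v = \sum_w cf x w * cf (hb b * T w * hb b') v.
Proof.
rewrite {1}[x]cfK mulr_sumr mulr_suml linear_sum sum_ffunE; apply: eq_bigr => w _.
by rewrite -scalerAr -scalerAl linearZ ffunE.
Qed.

(* The matrix of leading coefficients of a product is the product of the matrices,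
   the intermediate index running over an interval of the absolute order. *)
Lemma approx_comp b b' d u v (F G : W -> int) : braid_val d = u ->
  (braid_val b' = (braid_val b)^-1)%g -> abs_le S v u ->
  (forall w, abs_le S v w -> abs_le S w u ->
     approx (rl (w * u^-1)%g) (cf (hb d) w) (F w)) ->
  (forall w, abs_le S v w -> abs_le S w u ->
     approx (rl (v * w^-1)%g)
       (cf (hb b * T w * hb b') (braid_val b * v * (braid_val b)^-1)%g) (G w)) ->
  approx (rl (v * u^-1)%g)
    (cf (hb b * hb d * hb b') (braid_val b * v * (braid_val b)^-1)%g)
    (\sum_(w | abs_le S v w && abs_le S w u) F w * G w).
Proof.
move=> <- {u} bb'; set u := braid_val d => vu dF bG; rewrite cf_expand.
have btw w : (rl (w * u^-1)%g + rl (v * w^-1)%g <= rl (v * u^-1)%g)%N =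
    abs_le S v w && abs_le S w u.
  apply/idP/idP => [|/andP[vw wu]]; first by rewrite addnC; apply: abs_le_between.
  by rewrite addnC rl_between.
under [X in approx _ _ X]eq_bigl => w do rewrite -btw.
apply: (approx_sum (m := fun w => rl (w * u^-1)%g) (p := fun w => rl (v * w^-1)%g)) => // w.
- exact: (degree_braid d).1.
- have := (degree_braid (b * braid_lift S w * b')%g).1 (braid_val b * v * (braid_val b)^-1)%g.
  rewrite !hbM -TE !braid_valM // braid_val_lift // bb'; set z := braid_val b.
  have -> : (z * v * z^-1 * (z * w * z^-1)^-1 = z * (v * w^-1) * z^-1)%g.
    by rewrite !invMg !invgK !mulgA mulgKV.
  by rewrite rl_conj.
- by rewrite addnC rl_triangle.
- by rewrite btw => /andP[]; apply: dF.
- by rewrite btw => /andP[]; apply: bG.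
Qed.

(** The root of s moved by v still has coordinate 1 at s, so it is positive. *)
Lemma parabolic_last_up g s v : uniq (rcons g s) -> parabolic (letters g) v ->
  (len v < len (v * val s)%g)%N.
Proof.
rewrite rcons_uniq => /andP[sg _] vg; apply: nneg_root_ascent => //.
have [//|/(_ s)] := root_sign coxWS v s.
rewrite ffunE (parabolic_coord _ _ vg) ?inE // ffunE eqxx oppr_ge0.
by rewrite ler10.
Qed.

Lemma abs_le_gen s u : abs_le S (val s) u = (rl u == (rl (u * val s)%g).+1).
Proof. by rewrite abs_leE // rl_gen // add1n rl_divC // gen_inv. Qed.

Lemma abs_le_mul_gen s v u : abs_le S (val s) v -> abs_le S v u ->
  abs_le S (v * val s)%g (u * val s)%g.
Proof.
move=> sv vu; have su := abs_le_trans coxWS sv vu; move: sv su vu.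
have E : (v * val s * (u * val s)^-1 = v * u^-1)%g by rewrite invMg mulgA mulgK.
by rewrite !abs_le_gen !abs_leE // E => /eqP-> /eqP->; rewrite addSn eqSS.
Qed.

Lemma cox_elt_parabolic_part g s u : uniq (rcons g s) ->
  abs_le S (val s) u -> abs_le S u (word_val (rcons g s)) ->
  abs_le S (u * val s)%g (word_val g) /\ parabolic (letters g) (u * val s)%g.
Proof.
move=> ug su uc; have := abs_le_mul_gen su uc; rewrite word_val_rcons mulgenK // => ug'.
split=> //; apply: cox_elt_le_parabolic => //.
by move: ug; rewrite rcons_uniq => /andP[].
Qed.

(** Conjugation by T_s has the identity matrix, after relabelling by s. If s lies below u, then u =
    xs with x in the smaller parabolic subgroup and the conjugate is exactly T_(sx); otherwise the
    possible support is inspected. *)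
Lemma conj_gen_approx g s v u : uniq (rcons g s) ->
  abs_le S v u -> abs_le S u (word_val (rcons g s)) ->
  approx (rl (v * u^-1)%g)
    (cf (hb (braid_gen s) * T u * hb (braid_gen s)^-1%g) (val s * v * val s)%g) (v == u)%:Z.
Proof.
move=> ug vu uc.
have diag : v = u -> approx (rl (v * u^-1)%g)
    (cf (hb (braid_gen s) * T u * hb (braid_gen s)^-1%g) (val s * v * val s)%g) 1.
  move=> ->; rewrite mulgV rl1 //.
  have := (degree_braid (braid_gen s * braid_lift S u * (braid_gen s)^-1)%g).2.
  by rewrite !hbM -TE !braid_valM // braid_val_lift // braid_valV // !braid_val_gen // gen_inv.
have [/diag//|ne] := eqVneq v u.
suff -> : cf (hb (braid_gen s) * T u * hb (braid_gen s)^-1%g) (val s * v * val s)%g = 0.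
  exact: approx0.
have [su|su] := boolP (abs_le S (val s) u).
  have [x uE xK] : exists2 x, u = (x * val s)%g & parabolic (letters g) x.
    exists (u * val s)%g; first by rewrite mulgenK.
    by have [] := cox_elt_parabolic_part ug su uc.
  have xs := parabolic_last_up ug xK.
  have sx : (len x < len (val s * x)%g)%N.
    by rewrite lengenM // -(lenV coxWS x) (parabolic_last_up ug) //; apply: parabolicV.
  have Tu : T u = T x * hb (braid_gen s).
    rewrite -T_gen.
    rewrite uE.
    apply: TM.
    exact: len_up_r.
  have -> : hb (braid_gen s) * T u * hb (braid_gen s)^-1%g = T (val s * x)%g.
    by rewrite Tu -!mulrA hb_genK mulr1 -T_gen -TM //; apply: len_up_l.
  rewrite cf_basis ffunE; case: eqP => // E'; case/eqP: ne; rewrite uE.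
  by apply: (mulgI (val s)); rewrite [RHS]mulgA -E' mulgenK.
(* A nonzero entry forces u to be one of svs, vs, sv, v. The first and last give v = u; the others
   give v = us or v = su below u, hence s below u. *)
have supp f (y : W) : lopp s f y != 0 -> (f y != 0) || (f (val s * y)%g != 0).
  apply: contraNT; rewrite negb_or !negbK => /andP[/eqP f0 /eqP f1].
  by rewrite ffunE f0 f1 mulr0 addr0 mulr0 if_same.
have suppr f (y : W) : (qi *: (ropp s f - h *: f) : E) y != 0 -> (f y != 0) || (f (y * val s)%g != 0).
  apply: contraNT; rewrite negb_or !negbK => /andP[/eqP f0 /eqP f1].
  by rewrite !ffunE f0 f1 !mulr0 addr0 if_same scaler0 subr0 scaler0.
have deltaN0 w (y : W) : delta w y != 0 -> y = w.
  by rewrite ffunE; case: (y =P w) => // _; rewrite mulr0n eqxx.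
have nle w : v = w -> rl (w * u^-1)%g = 1%N -> rl w = rl (u * val s)%g -> False.
  move=> vw r1 rw; case/negP: su; rewrite abs_le_gen.
  by move: vu; rewrite abs_leE // vw r1 rw addn1.
apply/eqP/negPn/negP; rewrite cfM_genV cf_genM cf_basis => nz; move: (suppr _ _ nz) => {nz}.
have rlsu : rl (val s * u)%g = rl (u * val s)%g by exact: rl_mulC.
have case1 : (val s * v * val s)%g = u -> False.
  move=> E; case/eqP: ne; apply: (abs_le_eq coxWS vu).
  by rewrite -E -(rl_conj coxWS (val s) v) gen_inv.
rewrite mulgenK // => /orP[] /supp /orP[] /deltaN0.
- exact: case1.
- rewrite -mulgA mulKgen // => vs; apply: (nle (u * val s)%g) => //.
    by rewrite -vs mulgenK.
  by rewrite rl_conj // rl_gen.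
- move=> sv; apply: (nle (val s * u)%g) => //.
    by rewrite -sv mulKgen.
  by rewrite mulgK rl_gen.
- by rewrite mulKgen // => /eqP; rewrite (negPf ne).
Qed.

Lemma longest_gen_swap J w s s' : longest_in J w -> s \in J ->
  (w * val s = val s' * w)%g -> T w * hb (braid_gen s) = hb (braid_gen s') * T w.
Proof.
move=> wJ sJ E; set z := (w * val s)%g.
have lw : len w = (len z + 1)%N.
  by have := longest_in_lenM coxWS wJ (parabolic_gen sJ); rewrite len_gen.
have wz : w = (z * val s)%g by rewrite /z mulgenK.
have zw : w = (val s' * z)%g by rewrite /z E mulKgen.
have E1 : T w = T z * hb (braid_gen s).
  by rewrite -T_gen {1}wz TM // -wz lw len_gen.
have E2 : T w = hb (braid_gen s') * T z.
  by rewrite -T_gen {1}zw TM // -zw lw len_gen // addnC.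
by rewrite [in LHS]E2 -mulrA -E1.
Qed.

(** Passing the half twist turns s into s' in J; as w is an involution, the second passage turns s'
    back into s. *)
Lemma twist_gen_comm J w s : longest_in J w -> s \in J ->
  T w * T w * hb (braid_gen s) = hb (braid_gen s) * (T w * T w).
Proof.
move=> wJ sJ; have [s' s'J E] := longest_in_conj coxWS wJ sJ.
have E' : (w * val s' = val s * w)%g.
  have -> : (val s' = w * val s * w^-1)%g by rewrite E mulgK.
  by rewrite (longest_in_inv coxWS wJ) !mulgA (longest_in_sqr coxWS wJ) mul1g.
rewrite -mulrA (longest_gen_swap wJ sJ E) mulrA (longest_gen_swap wJ s'J E').
by rewrite mulrA.
Qed.

Lemma T_parabolic J (x : W) (P : H -> Prop) : parabolic J x -> P 1 ->
  (forall s y, s \in J -> P y -> P (hb (braid_gen s) * y)) -> P (T x).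
Proof.
move=> /(parabolic_reduced coxWS)[u [uJ <- su]] P1 Pgen.
rewrite TE braid_liftE // /braid_prod; elim: u uJ {su} => [|s u IHu]; first by rewrite big_nil hb1.
by move=> /= /andP[sJ /IHu Pu]; rewrite big_cons hbM; apply: Pgen.
Qed.

Lemma twist_comm J w (x : W) : longest_in J w -> parabolic J x ->
  T w * T w * T x = T x * (T w * T w).
Proof.
move=> wJ xJ; apply: (T_parabolic (P := fun y => T w * T w * y = y * (T w * T w)) xJ).
  by rewrite mulr1 mul1r.
by move=> s y sJ E; rewrite mulrA (twist_gen_comm wJ sJ) -mulrA E mulrA.
Qed.

Lemma twistE w u : T w * T w * T u =
  hb (braid_lift S w * braid_lift S w * braid_lift S u)%g.
Proof. by rewrite !TE -!hbM. Qed.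

Lemma twist_val J w u : longest_in J w ->
  braid_val (braid_lift S w * braid_lift S w * braid_lift S u)%g = u.
Proof.
by move=> wJ; rewrite !braid_valM // !braid_val_lift // (longest_in_sqr coxWS wJ) mul1g.
Qed.

Lemma twist_degree J w u : longest_in J w -> degree u (cf (T w * T w * T u)).
Proof. by move=> wJ; rewrite twistE -{1}(twist_val u wJ); apply: degree_braid. Qed.

(** The conjugate X of the twisted T_u by T_s is expanded in two ways; by centrality of the full
    twist it is also the full twist times the conjugate of T_u. *)
Lemma twist_rotate J w g s v u : longest_in J w -> s \in J -> uniq (rcons g s) ->
  abs_le S v u -> abs_le S u (word_val (rcons g s)) ->
  approx (rl (v * u^-1)%g)
    (cf (T w * T w * T (val s * u * val s)%g) (val s * v * val s)%g) 1 ->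
  approx (rl (v * u^-1)%g) (cf (T w * T w * T u) v) 1.
Proof.
move=> wJ sJ ug vu uc Zvu; pose sc (x : W) := (val s * x * val s)%g.
have scJ (x : W) : sc x = (val s * x * (val s)^-1)%g by rewrite gen_inv.
have scK (x : W) : sc (sc x) = x by rewrite /sc !mulgA gen_mulK // mul1g mulgenK.
have scle (x y : W) : abs_le S (sc x) (sc y) = abs_le S x y by rewrite !scJ abs_le_conj.
have scrl (x y : W) : rl (sc x * (sc y)^-1)%g = rl (x * y^-1)%g.
  by rewrite !scJ -(rl_conj coxWS (val s) (x * y^-1)%g) !invMg !invgK !mulgA mulgKV.
pose b := braid_gen s; pose z := (braid_lift S w * braid_lift S w)%g : B.
have zval : braid_val z = 1%g.
  by rewrite /z braid_valM // !braid_val_lift // (longest_in_sqr coxWS wJ).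
have zE : hb z = T w * T w by rewrite /z hbM !TE.
pose F (x : W) := lead h (rl (x * u^-1)%g) (cf (T w * T w * T u) x).
have Flead (x : W) : approx (rl (x * u^-1)%g) (cf (T w * T w * T u) x) (F x).
  by apply: hdvd_approx => //; apply: (twist_degree u wJ).1.
suff F1 : F v = 1 by rewrite -F1.
pose X := hb b * (T w * T w * T u) * hb b^-1%g.
(* Conjugation is the outer factor; its matrix is the identity, so only the index v remains. *)
have X1 : approx (rl (v * u^-1)%g) (cf X (sc v)) (F v).
  have zu : braid_val (z * braid_lift S u)%g = u by rewrite braid_valM // zval mul1g braid_val_lift.
  have := @approx_comp b b^-1%g _ u v F (fun w' => (v == w')%:Z) zu (braid_valV coxWS b) vu.
  rewrite hbM zE -TE braid_val_gen // gen_inv // -/(sc v) => H1.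
  have := H1 (fun (x : W) _ _ => Flead x) _; rewrite (bigD1 v) /=; last by rewrite abs_le_refl.
  rewrite eqxx mulr1 big1 ?addr0 => [|x /andP[_ /negPf xv]]; last by rewrite eq_sym xv mulr0.
  apply=> x vx xu; apply: (conj_gen_approx ug vx).
  exact: (abs_le_trans coxWS xu uc).
(* The full twist is the outer factor; the conjugate of T_u contributes only at sus, where the
   hypothesis applies. *)
have X2 : approx (rl (v * u^-1)%g) (cf X (sc v)) 1.
  pose G (x : W) := lead h (rl (sc v * x^-1)%g) (cf (T w * T w * T x) (sc v)).
  have dval : braid_val (b * braid_lift S u * b^-1)%g = sc u.
    by rewrite !braid_valM // braid_val_lift // braid_valV // braid_val_gen // gen_inv.
  have dE : hb (b * braid_lift S u * b^-1)%g = hb b * T u * hb b^-1%g by rewrite !hbM TE.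
  have XE : X = hb z * (hb b * T u * hb b^-1%g) * hb 1%g.
    by rewrite hb1 mulr1 zE /X /b !mulrA (twist_gen_comm wJ sJ) !mulrA.
  have scvu : abs_le S (sc v) (sc u) by rewrite scle.
  have zV : braid_val (1%g : B) = (braid_val z)^-1%g by rewrite braid_val1 // zval invg1.
  have := @approx_comp z 1%g _ (sc u) (sc v) (fun x : W => (x == sc u)%:Z) G dval zV scvu.
  rewrite dE -XE zval invg1 mul1g mulg1 scrl => H2.
  have := H2 _ _; rewrite (bigD1 (sc u)) /=; last by rewrite scvu abs_le_refl.
  rewrite eqxx mul1r big1 ?addr0 => [|x /andP[_ /negPf->]]; last by rewrite mul0r.
  have -> : G (sc u) = 1 by apply: (lead_eq h_quot h_int h_reg); rewrite scrl.
  apply=> x vx xu.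
    rewrite -[x]scK scrl (can_eq scK); apply: (conj_gen_approx ug).
      by rewrite -scle scK.
    exact: uc.
  rewrite hb1 mulr1 zE; apply: hdvd_approx => //.
  exact: (twist_degree x wJ).1.
exact: (approx_unique h_int h_reg X1 X2).
Qed.

Lemma T_cancel (w : W) x y : T w * x = T w * y -> x = y.
Proof.
move=> E; rewrite -[x]mul1r -[y]mul1r -hb1 -(mulVg (braid_lift S w)) hbM -TE.
by rewrite -!mulrA E.
Qed.

Lemma T_cancelr (w : W) x y : x * T w = y * T w -> x = y.
Proof.
move=> E; rewrite -[x]mulr1 -[y]mulr1 -hb1 -(mulgV (braid_lift S w)) hbM -TE.
by rewrite !mulrA E.
Qed.

(** * Comparing the full twists of J and of K, which is J without its last letter *)

Section ParabolicReduction.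
Variables (g : seq I) (s : I) (wJ wK : W).
Hypothesis ug : uniq (rcons g s).
Hypothesis lJ : longest_in (letters (rcons g s)) wJ.
Hypothesis lK : longest_in (letters g) wK.
Local Notation J := (letters (rcons g s)).
Local Notation K := (letters g).
(** The element with w_J = w_K d. The product Y below is the quotient of the two full twists, by
    [DJ_Y]. *)
Let d := (wK * wJ)%g.
Local Notation Y := (T d * T d^-1%g).
Local Notation DJ := (T wJ * T wJ).
Local Notation DK := (T wK * T wK).

Lemma subKJ : K \subset J.
Proof. by apply/subsetP=> r; rewrite !inE mem_rcons inE => ->; rewrite orbT. Qed.

Lemma last_in_J : s \in J.
Proof. by rewrite inE mem_rcons mem_head. Qed.

Lemma len_d : (len d + len wK)%N = len wJ.
Proof. exact: (longest_in_lenMl coxWS lJ (parabolicS subKJ lK.1)). Qed.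

Lemma T_wJ : T wJ = T wK * T d.
Proof.
have wE : wJ = (wK * d)%g by rewrite /d mulgA (longest_in_sqr coxWS lK) mul1g.
by rewrite {1}wE TM // -wE -len_d addnC.
Qed.

Lemma T_wJV : T wJ = T d^-1%g * T wK.
Proof.
have wE : wJ = (d^-1 * wK)%g.
  by rewrite /d invMg (longest_in_inv coxWS lK) (longest_in_inv coxWS lJ) -mulgA
    (longest_in_sqr coxWS lK) mulg1.
by rewrite {1}wE TM // -wE -len_d lenV.
Qed.

(** Lengths add: l(ad) = l(w_J) - l(a w_K) = l(w_J) - l(w_K) + l(a) = l(d) + l(a). *)
Lemma T_parabolic_d (a : W) : parabolic K a -> T a * T d = T (a * d)%g.
Proof.
move=> aK; rewrite -TM //; have aw := parabolicM aK lK.1.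
have h1 := longest_in_lenMl coxWS lJ (parabolicS subKJ aw).
have h2 := longest_in_lenMl coxWS lK aK; have h3 := len_d.
have -> : len (a * d)%g = len (a * wK * wJ)%g by rewrite /d mulgA.
have {}h1 : (len (a * wK * wJ)%g + len (a * wK)%g = len wJ)%N := h1.
by clearbody d; lia.
Qed.

Lemma tau_T_Y (a : W) : parabolic K a -> tau (T a * Y) = q ^+ len d * (a == 1%g)%:R.
Proof.
move=> aK; rewrite mulrA T_parabolic_d // tau_basis cf_basis ffunE.
by rewrite -[in X in X == _](mul1g d) (inj_eq (mulIg d)) eq_sym.
Qed.

(** The inverse of sd is w_J w_K s, of length l(w_J) - l(w_K s), and w_K s is longer than w_K. *)
Lemma len_last_d : (len (val s * d)%g < len d)%N.
Proof.
have dV : (d^-1 = wJ * wK)%g.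
  by rewrite /d invMg (longest_in_inv coxWS lK) (longest_in_inv coxWS lJ).
rewrite lengenM //; have -> : (d^-1 * val s = wJ * (wK * val s))%g by rewrite dV mulgA.
have wsJ : parabolic J (wK * val s)%g.
  by apply: parabolicM; [apply: (parabolicS subKJ lK.1)|apply: parabolic_gen last_in_J].
have h1 := longest_in_lenM coxWS lJ wsJ.
have h2 := len_up_r (parabolic_last_up ug lK.1); rewrite len_gen // in h2.
by have h3 := len_d; clearbody d; lia.
Qed.

Lemma last_notin_K (a : W) : parabolic K a -> (val s == a) = false.
Proof.
move=> aK; apply/eqP=> sa; rewrite -sa in aK; have := parabolic_genE coxWS aK.
by move: ug; rewrite rcons_uniq inE => /andP[/negPf->].
Qed.

(** The trace reads the coefficient of T_d in T_s T_(ad). As s is a left descent of d, this is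
    [sd = ad] + h [d = ad], and s = a is impossible in K. *)
Lemma tau_T_Y_gen (a : W) : parabolic K a ->
  tau (T a * Y * hb (braid_gen s)) = q ^+ len d * (h * (a == 1%g)%:R).
Proof.
move=> aK; rewrite tauC !mulrA -[hb _ * T a * _]mulrA T_parabolic_d // tau_basis.
rewrite cf_genM cf_basis ffunE len_last_d !ffunE (inj_eq (mulIg d)) (last_notin_K aK) add0r.
by rewrite -[in X in X == _](mul1g d) (inj_eq (mulIg d)) eq_sym mulrA.
Qed.

Definition supported_in x := forall w, cf x w != 0 -> parabolic K w.

Lemma supported_tau_Y x : supported_in x -> tau (x * Y) = q ^+ len d * tau x.
Proof.
move=> xK; have -> : x * Y = \sum_w cf x w *: (T w * Y).
  by rewrite {1}[x]cfK mulr_suml; apply: eq_bigr => w _; rewrite -scalerAl.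
rewrite tau_sum (bigD1 1%g) //= big1 ?addr0 => [|w /negPf w1]; rewrite tauZ.
  by rewrite tau_T_Y ?eqxx ?mulr1 1?mulrC //; exact: parabolic1.
have [->|/xK wK'] := eqVneq (cf x w) 0; first by rewrite mul0r.
by rewrite tau_T_Y // w1 !mulr0.
Qed.

Lemma supported_tau_Y_gen x : supported_in x ->
  tau (x * Y * hb (braid_gen s)) = q ^+ len d * (h * tau x).
Proof.
move=> xK; have -> : x * Y * hb (braid_gen s) = \sum_w cf x w *: (T w * Y * hb (braid_gen s)).
  rewrite {1}[x]cfK !mulr_suml; apply: eq_bigr => w _.
  by rewrite -!scalerAl.
rewrite tau_sum (bigD1 1%g) //= big1 ?addr0 => [|w /negPf w1]; rewrite tauZ.
  by rewrite tau_T_Y_gen ?eqxx ?mulr1; [rewrite /tau; ring|exact: parabolic1].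
have [->|/xK wK'] := eqVneq (cf x w) 0; first by rewrite mul0r.
by rewrite tau_T_Y_gen // w1 !mulr0.
Qed.

Lemma supported1 : supported_in 1.
Proof.
move=> w; rewrite cf1 ffunE; case: (w =P 1%g) => [-> _|_]; first exact: parabolic1.
by rewrite mulr0n eqxx.
Qed.

Lemma supportedM (a : W) x : parabolic K a -> supported_in x -> supported_in (T a * x).
Proof.
move=> aK xK; apply: (T_parabolic (P := fun y => supported_in (y * x)) aK).
  by rewrite mul1r.
move=> r y rK yK w; rewrite -mulrA cf_genM ffunE.
have [rw0|/yK rwK _] := eqVneq (cf (y * x) (val r * w)%g) 0; last first.
  by rewrite -(mulKgen coxWS r w); apply: parabolicM => //; apply: parabolic_gen.
have [w0|/yK//] := eqVneq (cf (y * x) w) 0.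
by rewrite rw0 w0 mulr0 addr0 mulr0 if_same eqxx.
Qed.

(** The two factorisations of w_J give T_(w_K) Y T_(w_K) for the twist of J. Since that twist
    commutes with T_(w_K), so does Y. *)
Lemma DJ_Y : DJ = DK * Y.
Proof.
have comm : Y * T wK = T wK * Y.
  apply: (@T_cancel wK); apply: (@T_cancelr wK).
  have DJE : DJ = T wK * (Y * T wK) by rewrite {1}T_wJ T_wJV !mulrA.
  have := twist_comm lJ (parabolicS subKJ lK.1); rewrite DJE.
  by rewrite !mulrA.
by rewrite {1}T_wJ T_wJV -[RHS]mulrA -comm !mulrA.
Qed.

Lemma DJ_parabolic (x : W) : parabolic K x -> DJ * T x = T x * (DK * Y).
Proof. by move=> xK; rewrite (twist_comm lJ (parabolicS subKJ xK)) DJ_Y. Qed.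

Lemma tau_twist (x y : W) : parabolic K x -> parabolic K y ->
  let A := T y^-1%g * (T x * DK) in
  supported_in A /\ tau A = q ^+ len y * cf (DK * T x) y.
Proof.
move=> xK yK A; split.
  apply: supportedM; first exact: parabolicV.
  apply: supportedM => //; rewrite -[DK]mulr1 -mulrA.
  by apply: supportedM lK.1 _; apply: supportedM lK.1 supported1.
by rewrite -tau_basis tauC (twist_comm lK xK).
Qed.

Lemma T_last (x : W) : parabolic K x -> T (x * val s)%g = T x * hb (braid_gen s).
Proof. by move=> xK; rewrite TM ?T_gen //; apply/len_up_r/(parabolic_last_up ug). Qed.

(** As a trace, the left side is tau(A Y T_s) with A supported in K, and the single T_s produces the
    factor h. *)
Lemma twist_last1 (x y : W) : parabolic K x -> parabolic K y ->
  q ^+ len y * cf (DJ * T (x * val s)%g) y =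
  q ^+ len d * (h * (q ^+ len y * cf (DK * T x) y)).
Proof.
move=> xK yK; have [AK tA] := tau_twist xK yK.
rewrite -tau_basis -tA -(supported_tau_Y_gen AK) T_last // tauC.
congr tau; rewrite [DJ * (_ * _)]mulrA (DJ_parabolic xK).
by rewrite !mulrA.
Qed.

(** Here T_s occurs twice; the quadratic relation contributes q from the constant term and h times h
    from the linear one. *)
Lemma twist_last2 (x y : W) : parabolic K x -> parabolic K y ->
  q ^+ len (y * val s)%g * cf (DJ * T (x * val s)%g) (y * val s)%g =
  q ^+ len d * ((q + h * h) * (q ^+ len y * cf (DK * T x) y)).
Proof.
move=> xK yK; have [AK tA] := tau_twist xK yK.
rewrite -tau_basis -tA invMg gen_inv // T_last //.
have -> : T (val s * y^-1)%g = hb (braid_gen s) * T y^-1%g.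
  rewrite TM ?T_gen //; apply: len_up_l; rewrite lengenM // -(lenV coxWS y^-1%g).
  by apply: (parabolic_last_up ug); rewrite invgK.
set A := T y^-1%g * (T x * DK) in AK *.
have -> : tau (DJ * (T x * hb (braid_gen s)) * (hb (braid_gen s) * T y^-1%g)) =
    tau (A * Y * (hb (braid_gen s) * hb (braid_gen s))).
  rewrite [in LHS]mulrA tauC [DJ * (_ * _)]mulrA (DJ_parabolic xK); congr tau.
  by rewrite /A !mulrA.
rewrite hb_gen_sqr mulrDr -!scalerAr mulr1 tauD !tauZ supported_tau_Y // supported_tau_Y_gen //.
by ring.
Qed.

End ParabolicReduction.

Lemma approx_qhh : approx 0 (q + h * h) 1.
Proof. by apply: approxDsmall; [apply: (approx_q 1) | exists h; rewrite expr1]. Qed.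

(** The coefficient for J is the one for K up to factors congruent to 1 modulo h. For v = 1 there is
    one more factor h, matched by u having one reflection more than us. *)
Lemma twist_lead_hit g s wJ v u : uniq (rcons g s) ->
  longest_in (letters (rcons g s)) wJ ->
  (forall wK (x y : W), longest_in (letters g) wK -> abs_le S y x -> abs_le S x (word_val g) ->
     approx (rl (y * x^-1)%g) (cf (T wK * T wK * T x) y) 1) ->
  abs_le S v u -> abs_le S u (word_val (rcons g s)) -> abs_le S (val s) u ->
  v = 1%g \/ abs_le S (val s) v ->
  approx (rl (v * u^-1)%g) (cf (T wJ * T wJ * T u) v) 1.
Proof.
move=> ug lJ IHg vu uc su hit; have [wK lK] := longest_in_exists (letters g).
have [xc xK] := cox_elt_parabolic_part ug su uc; set x := (u * val s)%g in xc xK.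
have uE : u = (x * val s)%g by rewrite /x mulgenK.
have xE : (u * val s)%g = x by []; clearbody x.
have hd := (twist_degree u lJ).1 v.
case: hit => [v1|sv].
  have z1 := twist_last1 ug lJ lK xK (parabolic1 (letters g)).
  rewrite -uE len1 // !expr0 !mul1r in z1.
  have rE : rl (v * u^-1)%g = (rl (1 * x^-1)%g).+1.
    by rewrite v1 !mul1g !rlV //; move: su; rewrite abs_le_gen xE => /eqP.
  rewrite rE v1 z1.
  have A := approxM (approx_h h) (IHg _ _ _ lK (abs_le1 S x) xc).
  exact: (approxM (approx_q (len (wK * wJ)%g)) A).
have [yc yK] := cox_elt_parabolic_part ug sv (abs_le_trans coxWS vu uc).
have z2 := twist_last2 ug lJ lK xK yK.
have yx := abs_le_mul_gen sv vu; rewrite xE in yx.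
have rE : rl (v * val s * x^-1)%g = rl (v * u^-1)%g by rewrite uE invMg mulgA gen_inv.
rewrite -uE mulgenK // in z2.
apply: (approx_unit h_quot h_int h_reg (approx_q (len v)) _ hd); rewrite z2 -rE.
have A := approxM approx_qhh (approxM (approx_q (len (v * val s)%g)) (IHg _ _ _ lK yx xc)).
exact: (approxM (approx_q (len (wK * wJ)%g)) A).
Qed.

Lemma letters_perm (g g' : seq I) : perm_eq g g' -> letters g = letters g'.
Proof. by move=> gg'; apply/setP=> r; rewrite !inE (perm_mem gg'). Qed.

Theorem twist_lead (g : seq I) w v u : uniq g -> longest_in (letters g) w ->
  abs_le S v u -> abs_le S u (word_val g) ->
  approx (rl (v * u^-1)%g) (cf (T w * T w * T u) v) 1.
Proof.
have [n] := ubnP (size g); elim: n g w v u => // n IHn g w v u gn ug lw vu uc.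
have [<-|ne] := eqVneq v u.
  by rewrite mulgV rl1 //; apply: (twist_degree v lw).2.
(* Both v and u are quantified, because each rotation conjugates them. *)
pose P (g' : seq I) (t : W) := forall v u, abs_le S v u -> abs_le S u (word_val g') ->
  abs_le S t u -> v = 1%g \/ abs_le S t v ->
  approx (rl (v * u^-1)%g) (cf (T w * T w * T u) v) 1.
have [a aT [au av]] : exists2 a, a \in reflections S &
    abs_le S a u /\ (v = 1%g \/ abs_le S a v).
  have [v1|v1] := eqVneq v 1%g.
    have u1 : u != 1%g by rewrite -v1 eq_sym.
    by have [a aT au] := exists_reflection_le coxWS u1; exists a => //; split=> //; left.
  have [a aT av] := exists_reflection_le coxWS v1; exists a => //; split; last by right.
  exact: (abs_le_trans coxWS av vu).
have aJ := cox_elt_le_parabolic coxWS ug (abs_le_trans coxWS au uc).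
suff : P g a by apply.
clear v u vu uc ne au av.
apply: (rotation_ind coxWS (P := P) ug aT aJ) => [g' s gg'|g' s t gg' tT Pt] v u vu uc tu tv.
  have ug' : uniq (rcons g' s) by rewrite (perm_uniq gg').
  have lw' : longest_in (letters (rcons g' s)) w by rewrite (letters_perm gg').
  apply: (twist_lead_hit ug' lw' _ vu uc tu tv) => wK x y lK yx xc.
  apply: (IHn g') => //; last by move: ug'; rewrite rcons_uniq => /andP[].
  by move: gn; rewrite -(perm_size gg') size_rcons.
have ug' : uniq (rcons g' s) by rewrite (perm_uniq gg').
have sJ : s \in letters g by rewrite inE -(perm_mem gg') mem_rcons mem_head.
have scle (x y : W) : abs_le S (val s * x * val s)%g (val s * y * val s)%g = abs_le S x y.
  by rewrite -(abs_le_conj coxWS (val s) x y) gen_inv.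
apply: (twist_rotate lw sJ ug' vu uc).
have -> : rl (v * u^-1)%g = rl (val s * v * val s * (val s * u * val s)^-1)%g.
  by rewrite !invMg gen_inv // !mulgA mulgenK // -(rl_conj coxWS (val s)) gen_inv // !mulgA.
apply: Pt; rewrite ?scle //.
  have -> : word_val (s :: g') = (val s * word_val (rcons g' s) * val s)%g.
    by rewrite word_val_rcons word_val_cons mulgA mulgenK.
  by rewrite scle.
by case: tv => [->|tv]; [left; rewrite mulg1 gen_mulK|right].
Qed.

(** * Powers of the full twist as powers of the zeta function *)

Section TwistPowers.
Variable g : seq I.
Hypothesis ug : uniq g.
Hypothesis gT : letters g = setT.
Local Notation c := (word_val g).
Local Notation P := (NC S c).
Local Notation le := (abs_le S).
Local Notation pair := (inc_pair P le).
Local Notation D := (half_twist S).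

Lemma inc_pairE (x v : W) : pair x v = le x v && le v c.
Proof.
rewrite /inc_pair !inE !abs_le1 /=; apply/and3P/andP => [[]//|[xv vc]].
by split=> //; apply: (abs_le_trans coxWS xv).
Qed.

Definition leadmx b : {ffun W * W -> int} := [ffun p =>
  if pair p.1 p.2 then lead h (rl (p.1 * p.2^-1)%g) (cf (hb b * T p.2) p.1) else 0].

Lemma pure_approx b (x v : W) : braid_val b = 1%g -> pair x v ->
  approx (rl (x * v^-1)%g) (cf (hb b * T v) x) (leadmx b (x, v)).
Proof.
move=> b1 xv; rewrite ffunE xv; apply: hdvd_approx => //.
have := (degree_braid (b * braid_lift S v)%g).1 x.
by rewrite hbM -TE braid_valM // b1 mul1g braid_val_lift.
Qed.

Lemma leadmxE b (x v : W) a : pair x v ->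
  approx (rl (x * v^-1)%g) (cf (hb b * T v) x) a -> leadmx b (x, v) = a.
Proof. by move=> xv xa; rewrite ffunE xv; apply: (lead_eq h_quot h_int h_reg). Qed.

(** Pure braids do not move the index v, so [approx_comp] applies without relabelling and its sum
    over an interval is the convolution. *)
Lemma leadmxM b b' : braid_val b = 1%g -> braid_val b' = 1%g ->
  leadmx (b * b')%g = inc_mul P le (leadmx b) (leadmx b').
Proof.
move=> b1 b'1; apply/ffunP=> -[x v]; rewrite [RHS]ffunE /=.
have [xv|xv] := boolP (pair x v); last first.
  rewrite ffunE (negPf xv) big_pred0 // => w; apply: contraNF xv.
  rewrite !inc_pairE => /andP[/andP[xw _] /andP[wv ->]].
  by rewrite (abs_le_trans coxWS xw wv).
have /andP[xv' vc] : le x v && le v c by rewrite -inc_pairE.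
apply: leadmxE => //.
have b'v : braid_val (b' * braid_lift S v)%g = v.
  by rewrite braid_valM // b'1 mul1g braid_val_lift.
have bV : braid_val (1%g : B) = (braid_val b)^-1%g by rewrite braid_val1 // b1 invg1.
have := @approx_comp b 1%g _ v x (fun w => leadmx b' (w, v)) (fun w => leadmx b (x, w)) b'v bV xv'.
rewrite b1 invg1 mul1g mulg1 hb1 mulr1 hbM -TE mulrA -hbM => H1.
have -> : \sum_(w | pair x w && pair w v) leadmx b (x, w) * leadmx b' (w, v) =
    \sum_(w | le x w && le w v) leadmx b' (w, v) * leadmx b (x, w).
  apply: eq_big => [w|w _]; last by rewrite mulrC.
  rewrite !inc_pairE vc andbT; apply/andP/andP => [[/andP[-> _] ->]//|[-> wv]].
  by rewrite wv (abs_le_trans coxWS wv vc).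
apply: H1 => w xw wv.
  by apply: pure_approx; rewrite // inc_pairE wv.
by rewrite mulr1; apply: pure_approx; rewrite // inc_pairE xw (abs_le_trans coxWS wv vc).
Qed.

Lemma leadmx1 : leadmx 1%g = inc_one P.
Proof.
apply/ffunP=> -[x v]; rewrite [RHS]ffunE /=; have [xv|xv] := boolP (pair x v).
  apply: leadmxE => //; rewrite hb1 mul1r cf_basis ffunE.
  have xP : x \in P by case/and3P: xv.
  rewrite xP; case: eqP => [->|_]; last exact: approx0.
  by rewrite mulgV rl1 //; exact: approx1.
rewrite ffunE (negPf xv); case: eqP => [xv'|_]; last by rewrite andbF.
by move: xv; rewrite -xv' /inc_pair abs_le_refl // andbT andbb => /negPf->.
Qed.

Lemma longest_braid_val : (braid_val D * braid_val D = 1)%g.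
Proof.
have lT := longest_in_longest_element coxWS.
by rewrite braid_val_lift // (longest_in_sqr coxWS lT).
Qed.

Lemma leadmx_twist : leadmx (D * D)%g = zeta P le.
Proof.
apply/ffunP=> -[x v]; rewrite [RHS]ffunE /=; have [xv|xv] := boolP (pair x v).
  apply: leadmxE => //; rewrite hbM -!TE; move: xv; rewrite inc_pairE => /andP[xv vc].
  apply: (twist_lead ug) => //; rewrite gT; exact: longest_in_longest_element.
by rewrite ffunE (negPf xv).
Qed.

Lemma inc_supp_leadmx b : inc_supp P le (leadmx b).
Proof.
apply/forallP=> x; apply/forallP=> v; apply/implyP => /negPf xv.
by rewrite ffunE xv.
Qed.

Lemma twistV_val : braid_val (D * D)^-1%g = 1%g.
Proof. by rewrite braid_valV // braid_valM // longest_braid_val invg1. Qed.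

Lemma twist_val1 : braid_val (D * D)%g = 1%g.
Proof. by rewrite braid_valM // longest_braid_val. Qed.

(** The inverse full twist supplies a two-sided inverse, so negative powers require no formula for
    the Möbius function. *)
Lemma inc_inv_zeta : inc_inv P le (zeta P le) = leadmx (D * D)^-1%g.
Proof.
apply: inc_inv_eq; first exact: abs_le_refl.
- by move=> y x z; apply: abs_le_trans.
- exact: inc_supp_leadmx.
- by rewrite -leadmx_twist -leadmxM ?mulgV ?leadmx1 ?twistV_val ?twist_val1.
- by rewrite -leadmx_twist -leadmxM ?mulVg ?leadmx1 ?twistV_val ?twist_val1.
Qed.

Lemma twist_expg_val n b : braid_val b = 1%g -> braid_val (b ^+ n)%g = 1%g.
Proof.
move=> b1; elim: n => [|n IHn]; first by rewrite expg0 braid_val1.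
by rewrite expgS braid_valM // b1 IHn mulg1.
Qed.

Lemma leadmx_expg n b : braid_val b = 1%g ->
  leadmx (b ^+ n)%g = iter n (inc_mul P le (leadmx b)) (inc_one P).
Proof.
move=> b1; elim: n => [|n IHn]; first by rewrite expg0 leadmx1.
by rewrite expgS leadmxM ?twist_expg_val // IHn.
Qed.

Lemma expgz_twist (m : int) : expgz D (2 * m) =
  match m with Posz n => ((D * D) ^+ n)%g | Negz n => ((D * D)^-1 ^+ n.+1)%g end.
Proof.
case: m => n.
  have -> : (2 * Posz n = Posz (2 * n))%R by rewrite PoszM.
  by rewrite /expgz expgnA expg2.
(* Since [Negz k] is -(k + 1), twice -(n + 1) is [Negz] of 2n + 1. *)
have -> : (2 * Negz n = Negz (2 * n).+1)%R by rewrite !NegzE; lia.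
have -> : ((D * D)^-1 ^+ n.+1 = ((D * D) ^+ n.+1)^-1)%g by rewrite expVgn.
by rewrite /expgz -expg2 -expgnA mulnS add2n.
Qed.

Lemma twist_expgz_val m : braid_val (expgz D (2 * m)) = 1%g.
Proof.
by rewrite expgz_twist; case: m => n; apply: twist_expg_val; rewrite ?twist_val1 ?twistV_val.
Qed.

Lemma leadmx_expgz m : leadmx (expgz D (2 * m)) = inc_pow P le (zeta P le) m.
Proof.
rewrite expgz_twist; case: m => n; rewrite leadmx_expg ?twist_val1 ?twistV_val //.
  by rewrite leadmx_twist.
by rewrite -inc_inv_zeta.
Qed.

Theorem twist_power_lead m w : w \in P ->
  approx (rl (w * c^-1)%g) (cf (hb (expgz D (2 * m) * braid_lift S c)%g) w)
    (inc_pow P le (zeta P le) m (w, c)).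
Proof.
move=> wP; rewrite -leadmx_expgz hbM -TE; apply: pure_approx; first exact: twist_expgz_val.
by rewrite inc_pairE abs_le_refl // andbT; move: wP; rewrite inE => /andP[].
Qed.

Theorem twist_power_dvd m w :
  hdvd (rl (w * c^-1)%g) (cf (hb (expgz D (2 * m) * braid_lift S c)%g) w).
Proof.
have := (degree_braid (expgz D (2 * m) * braid_lift S c)%g).1 w.
by rewrite braid_valM // twist_expgz_val mul1g braid_val_lift.
Qed.

End TwistPowers.

End HeckeModel.

(** * Evaluation at q = 1 *)

Section LaurentAtOne.
Local Notation q := laurent_q.
Local Notation h := (laurent_q - 1).
Implicit Types (f g : laurent) (p : {poly int}) (a : int).

Lemma laurent_valE f : exists p n, val f = p%:F / ('X^n)%:F.
Proof. by case: f => f /= /asboolP. Qed.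

Lemma laurent_valD f g : val (f + g) = val f + val g.
Proof. exact: rmorphD. Qed.

Lemma laurent_valM f g : val (f * g) = val f * val g.
Proof. exact: rmorphM. Qed.

Lemma laurent_valX f n : val (f ^+ n) = val f ^+ n.
Proof. exact: rmorphXn. Qed.

Lemma val_h : val h = ('X - 1 : {poly int})%:F.
Proof. by rewrite rmorphB rmorph1 /= rmorphB rmorph1. Qed.

Lemma val_h_neq0 : val h != 0.
Proof. by rewrite val_h tofrac_eq0 -polyC1 polyXsubC_eq0. Qed.

Lemma polyC_int a : a%:P = a%:~R :> {poly int}.
Proof. by rewrite -[a in LHS]intz rmorph_int. Qed.

Lemma val_intr a : val (a%:~R : laurent) = (a%:P)%:F.
Proof. by rewrite rmorph_int polyC_int rmorph_int. Qed.

(** For f = p / X^n take a = p(1); then p - a X^n vanishes at 1, so X - 1 divides it. *)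
Lemma laurent_h_quot f : exists (a : int) (g : laurent), f = a%:~R + h * g.
Proof.
have [p [n fE]] := laurent_valE f.
have /factor_theorem[r rE] : root (p - p.[1]%:P * 'X^n) 1.
  by rewrite /root !hornerE ?hornerXn ?expr1n mulr1 subrr.
have rL : r%:F / ('X^n)%:F \in is_laurent by apply/asboolP; exists r, n.
exists p.[1], (Laurent rL); apply: val_inj.
rewrite laurent_valD laurent_valM val_intr val_h fE /= mulrA -tofracM [_ * r]mulrC -polyC1 -rE.
rewrite tofracB mulrBl tofracM mulfK ?tofracXn_neq0 //.
by rewrite addrCA subrr addr0.
Qed.

Lemma laurent_h_int a (g : laurent) : a%:~R = h * g -> a = 0.
Proof.
move=> /(congr1 val); rewrite laurent_valM val_intr val_h.
have [p [n ->]] := laurent_valE g.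
move/(congr1 (fun z => z * ('X^n)%:F)); rewrite mulrA divfK ?tofracXn_neq0 //.
rewrite -!tofracM => /eqP; rewrite tofrac_eq => /eqP/(congr1 (horner^~ 1)).
by rewrite !hornerE expr1n mulr1.
Qed.

Lemma laurent_h_reg f : h * f = 0 -> f = 0.
Proof.
move=> /(congr1 val); rewrite laurent_valM rmorph0 => /eqP.
by rewrite mulf_eq0 (negPf val_h_neq0) /= => /eqP f0; apply: val_inj; rewrite rmorph0.
Qed.

Lemma value_at1_approx n (k : int) f a : k + n%:Z = 0 -> approx h n f a ->
  value_at1 ((val q - 1) ^ k * val f) a.
Proof.
move=> kn [g ->]; have hE : val q - 1 = val h by rewrite rmorphB rmorph1.
rewrite hE laurent_valM laurent_valX mulrA exprnP -expfzDr ?val_h_neq0 // kn expr0z mul1r.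
have [p [j gE]] := laurent_valE g.
exists (a%:P * 'X^j + ('X - 1) * p), 'X^j; split.
- by rewrite hornerXn expr1n oner_eq0.
- rewrite laurent_valD laurent_valM val_intr val_h gE [(_ + _ * p)%:F]tofracD !tofracM mulrDl mulfK ?tofracXn_neq0 //.
  by rewrite mulrA.
- by rewrite !hornerE ?expr1n ?mulr1.
Qed.

Lemma value_at1_hdvd n (k : int) f : 0 < k + n%:Z -> hdvd h n f ->
  value_at1 ((val q - 1) ^ k * val f) 0.
Proof.
move=> kn [g ->]; have hE : val q - 1 = val h by rewrite rmorphB rmorph1.
rewrite hE laurent_valM laurent_valX mulrA exprnP -expfzDr ?val_h_neq0 //.
case: (k + n%:Z) kn => // -[//|i] _; rewrite -exprnP val_h.
have [p [j ->]] := laurent_valE g.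
exists (('X - 1) ^+ i.+1 * p), 'X^j; split.
- by rewrite hornerXn expr1n oner_eq0.
- by rewrite tofracM [(_ ^+ i.+1)%:F]tofracXn mulrA.
- by rewrite !hornerE subrr expr0n mul0r.
Qed.

End LaurentAtOne.

Lemma lift_generator_word (W : finGroupType) (S : {set W}) (u : seq W) :
  all (mem S) u -> exists g : seq (generator S), map val g = u.
Proof.
elim: u => [|a u IHu] /=; first by exists [::].
by case/andP=> aS /IHu[g <-]; exists (exist _ a aS :: g).
Qed.

(** The inverse is again a standard Coxeter element, given by the reversed word. *)
Lemma cox_elt_inv_word (W : finGroupType) (S : {set W}) (c : W) :
  coxeter_system S -> standard_coxeter_element S c ->
  exists g : seq (generator S), [/\ uniq g, letters g = setT, size g = #|S| &
    word_val g = c^-1%g].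
Proof.
move=> coxWS [u uS ->].
have /lift_generator_word[g gu] : all (mem S) u.
  by apply/allP=> a; rewrite (perm_mem uS) mem_enum.
exists (rev g); split.
- by rewrite rev_uniq -(map_inj_uniq val_inj) gu (perm_uniq uS) enum_uniq.
- apply/setP=> s; rewrite !inE mem_rev -(mem_map val_inj) gu (perm_mem uS) mem_enum.
  exact: valP.
- by rewrite size_rev -(size_map val) gu (perm_size uS) -cardE.
- by rewrite word_val_rev // /word_val -(big_map val predT id) gu.
Qed.

Theorem theorem5p5 (W : finGroupType) (S : {set W})
    (coxWS : coxeter_system S) (irrWS : coxeter_irreducible S)
    (c : W) (coxc : standard_coxeter_element S c) (m : int) (w : W) :
  value_at1
    ((val laurent_q - 1) ^ ((reflength S w)%:Z - #|S|%:Z) *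
     val (std_coeffs
            (hecke_of_braid
               (expgz (half_twist S) (2 * m) * braid_lift S c^-1)%g) w))
    (if w \in NC S c^-1%g
     then inc_pow (NC S c^-1%g) (abs_le S) (zeta (NC S c^-1%g) (abs_le S)) m
            (w, c^-1%g)
     else 0).
Proof.
have [g [ug gT sg cE]] := cox_elt_inv_word coxWS coxc.
rewrite std_coeffsE // -sg -(rl_cox_elt coxWS ug) -cE.
(* The rank has been replaced by the reflection length of c^-1. The total exponent of q - 1 is then
   the defect in the triangle inequality: zero for w below c^-1, positive otherwise. *)
have n_rl : (reflength S w)%:Z - (reflength S (word_val g))%:Z
    + (reflength S (w * (word_val g)^-1)%g)%:Z =
  (reflength S w + reflength S (w * (word_val g)^-1)%g)%N%:Z - (reflength S (word_val g))%:Z.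
  by rewrite PoszD addrAC.
have [wP|wP] := boolP (w \in NC S (word_val g)).
  apply: value_at1_approx; last first.
    apply: (twist_power_lead coxWS laurent_qiq laurent_h_quot laurent_h_int laurent_h_reg
      (cf := coefs_lin coxWS) (T := std_basis S)) => //.
    - exact: hecke_of_braidM.
    - exact: coefs_genM.
    - exact: coefsM_gen.
    - exact: coefs_basis.
    - by move=> x; rewrite [LHS](esym (coefsK coxWS x)).
  move: wP; rewrite n_rl inE => /andP[_]; rewrite abs_leE // => /eqP->.
  by rewrite subrr.
apply: value_at1_hdvd; last first.
  apply: (twist_power_dvd coxWS laurent_qiq (cf := coefs_lin coxWS) (T := std_basis S)) => //.
  - exact: hecke_of_braidM.
  - exact: coefs_genM.
  - exact: coefs_basis.
rewrite n_rl subr_gt0 ltz_nat ltn_neqAle rl_diff_le // andbT.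
by move: wP; rewrite inE abs_le1 abs_leE.
Qed.
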